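(* Let $w:\mathbb{Z}\to[1,\infty)$ be a strong Beurling weight, let $F=(F_j)_{j\in\mathbb{Z}}\in\ell^2(\mathbb{Z})$ be a sequence of complex numbers, and let $(a,b)$ be the $SU(2)$-valued nonlinear Fourier transform of $F$. (i) If $F\in\ell^1_w$, then $a^*\in A_w$ and $b\in A_w$. (ii) Conversely, if $a^*$ is outer on $\mathbb{D}$ and $b/a^*\in A_w$, then $F\in\ell^1_w$.
   Context: Notation. $\mathbb{T}$ is the unit circle, $\mathbb{D}$ the open unit disc. For a function $f$ on a subset $X$ of the Riemann sphere, $f^*$ is defined on $\{\bar z^{-1}:z\in X\}$ by $f^*(z)=\overline{f(\bar z^{-1})}$; on $\mathbb{T}$, $f^*=\overline{f}$. For $f\in L^2(\mathbb{T})$, $\hat f\in\ell^2(\mathbb{Z})$ is its sequence of Fourier coefficients. Nonlinear Fourier transform. For a finitely supported complex sequence $F=(F_k)_{k\in\mathbb{Z}}$ put, for $z\in\mathbb{T}$, $$\begin{pmatrix} a(z) & b(z)\\ -b^*(z) & a^*(z)\end{pmatrix}=\prod_{k=-\infty}^{\infty}\frac{1}{\sqrt{1+|F_k|^2}}\begin{pmatrix}1 & F_kz^k\\ -\overline{F_k}z^{-k} & 1\end{pmatrix},$$ where the factors with lower indices appear to the left. The pair $(a,b)$ is the $SU(2)$-valued nonlinear Fourier transform (NLFT) of $F$; it satisfies $|a|^2+|b|^2=1$ on $\mathbb{T}$. For $F\in\ell^2(\mathbb{Z})$, $(a,b)$ is defined as the limit (entrywise in $L^2(\mathbb{T})$)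 of the NLFTs of the truncations of $F$ to $[-N,N]$ as $N\to\infty$. The function $a^*$ extends to a bounded holomorphic function on $\mathbb{D}$, and $a^*(0)=\prod_k(1+|F_k|^2)^{-1/2}$. Weights. $w:\mathbb{Z}\to[1,\infty)$ is a strong Beurling weight if $w(-n)=w(n)$ for all $n$; $w(n+m)\le w(n)w(m)$ for all $n,m$; and $\lim_{n\to\infty}\frac{\log w(n)}{n}=0$. Define $\ell^1_w=\{c=(c_n)_{n\in\mathbb{Z}}:\|c\|_{\ell^1_w}:=\sum_{n}|c_n|w(n)<\infty\}$ and $A_w=\{f:\mathbb{T}\to\mathbb{C}:\hat f\in\ell^1_w\}$ with $\|f\|_{A_w}=\|\hat f\|_{\ell^1_w}$ and pointwise multiplication. *)

(* Defs.v *)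
From HB Require Import structures.
From mathcomp Require Import all_boot all_order all_algebra.
From mathcomp Require Import complex.
From mathcomp Require Import all_classical all_reals all_analysis.

Set Implicit Arguments.
Unset Strict Implicit.
Unset Printing Implicit Defensive.

Import Order.TTheory GRing.Theory Num.Theory numFieldNormedType.Exports.

Local Open Scope classical_set_scope.
Local Open Scope complex_scope.
Local Open Scope ring_scope.

Notation normc := Normc.normc.

(* A function on the circle is a function R[i] -> R[i] of which only the
   values at the points [circ t] matter; the circle carries the normalised arc
   length measure, i.e. the image under [circ] of Lebesgue measure on [0, 1].
   Elements of L^2(T) are represented by functions, up to a.e. equality. *)
Section Circle.
Variable R : realType.
Implicit Types (f g : R[i] -> R[i]) (F : int -> R[i]) (w : int -> R).

Local Notation I01 := (`[0%R, 1%R]%classic : set R).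
Local Notation leb := (@lebesgue_measure R).

Definition circ (t : R) : R[i] := cos (2 * pi * t) +i* sin (2 * pi * t).

Definition cexp (z : R[i]) : R[i] :=
  (expR (complex.Re z))%:C * (cos (complex.Im z) +i* sin (complex.Im z)).

Definition measurable_T f : Prop :=
  measurable_fun I01 (fun t : R => complex.Re (f (circ t))) /\
  measurable_fun I01 (fun t : R => complex.Im (f (circ t))).

Definition integrable_T f : Prop :=
  leb.-integrable I01
    (fun t => (complex.Re (f (circ t)))%:E) /\
  leb.-integrable I01
    (fun t => (complex.Im (f (circ t)))%:E).

Definition integral_T f : R[i] :=
  Rintegral leb I01
    (fun t => complex.Re (f (circ t)))
  +i*
  Rintegral leb I01
    (fun t => complex.Im (f (circ t))).

Definition cvg_L2T (f_ : nat -> R[i] -> R[i]) f : Prop :=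
  (\int[leb]_(t in I01)
     ((normc (f_ n (circ t) - f (circ t))) ^+ 2)%:E)%E @[n --> \oo] --> 0%E.

(* On the circle, star f is the complex conjugate of f. *)
Definition star f : R[i] -> R[i] := fun z => (f (z^*)^-1)^*.

Definition fourier f (n : int) : R[i] := integral_T (fun z => f z * z ^ (- n)).

Definition ell2 F : Prop :=
  (\esum_(n in [set: int]) ((normc (F n)) ^+ 2)%:E < +oo)%E.

Definition ell1 w F : Prop :=
  (\esum_(n in [set: int]) (normc (F n) * w n)%:E < +oo)%E.

Definition strong_beurling_weight w : Prop :=
  [/\ forall n : int, 1 <= w n,
      forall n : int, w (- n) = w n,
      forall n m : int, w (n + m) <= w n * w m
    & ln (w n%:Z) / n%:R @[n --> \oo] --> (0 : R)].

(* ell1 only makes sense for f with Fourier coefficients, hence the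
   integrability; membership depends only on f up to a.e. equality. *)
Definition beurling_algebra w f : Prop :=
  integrable_T f /\ ell1 w (fourier f).

Definition nlft_factor F (k : int) (z : R[i]) : 'M[R[i]]_2 :=
  (sqrtC (1 + `|F k| ^+ 2))^-1 *:
  \matrix_(i, j)
    if i == 0 then (if j == 0 then 1 else F k * z ^ k)
    else (if j == 0 then - ((F k)^* * z ^ (- k)) else 1).

(* Product over -N <= k <= N, lower indices to the left. *)
Definition nlft_trunc F (N : nat) (z : R[i]) : 'M[R[i]]_2 :=
  \prod_(0 <= j < (2 * N).+1) nlft_factor F (j%:Z - N%:Z) z.

(* (a, b) is the first row; the factors have the form
   ((p, q), (- star q, star p)), which products preserve, so the first row
   determines the matrix. *)
Definition is_nlft F (a b : R[i] -> R[i]) : Prop :=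
  [/\ measurable_T a, measurable_T b,
      cvg_L2T (fun N z => nlft_trunc F N z 0 0) a
    & cvg_L2T (fun N z => nlft_trunc F N z 0 1) b].

Definition bounded_holomorphic_disc (G : R[i] -> R[i]) : Prop :=
  (forall z, normc z < 1 -> derivable (G : R[i]^o -> R[i]^o) z 1) /\
  (exists M : R, forall z, normc z < 1 -> normc (G z) <= M).

(* Radial limits, almost everywhere. *)
Definition boundary_values (G : R[i] -> R[i]) g : Prop :=
  {ae leb, forall t : R, I01 t ->
    (G (r%:C * circ t) : R[i]^o) @[r --> 1^'-] --> (g (circ t) : R[i]^o)}.

(* The textbook definition of an outer function on the disc:
   G(z) = c exp(int (u + z) / (u - z) log phi(u) dm(u)). *)
Definition outer_formula (G : R[i] -> R[i]) : Prop :=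
  exists (c : R[i]) (phi : R[i] -> R),
    [/\ normc c = 1,
        forall t, 0 < phi (circ t),
        integrable_T (fun u => (ln (phi u))%:C)
      & forall z, normc z < 1 ->
          G z = c * cexp (integral_T
                   (fun u => (u + z) / (u - z) * (ln (phi u))%:C))].

(* G is the bounded holomorphic extension of g to the disc. *)
Definition outer_on_disc g : Prop :=
  exists G : R[i] -> R[i],
    [/\ bounded_holomorphic_disc G, boundary_values G g & outer_formula G].

End Circle.

(* Main.v *)
(** The norm of A_w is submultiplicative, so the truncated transforms are
bounded in A_w by a multiple of prod (1 + |F_k| w(k)); Fatou's lemma on the
coefficients gives (i).

For (ii), |a|^2 + |b|^2 = 1 gives 1 + |b / a^*|^2 = |a|^-2.  As w is
subexponential, the logarithm operates on positive elements of A_w (its power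
series converges there, the spectral radius being the sup norm), so log |a| is
in A_w.  Hence a^* = c exp(h), with h the analytic completion of log |a|, and
1 / a^* is in A_w with coefficients on n >= 0.  Split the product defining
(a, b) at n into factors of index <= n and > n, with first rows (a_-, b_-) and
(a_+, b_+).  Since c := b / a^* satisfies
  a_-^* c - b_- = b_+ / a^*   and   a_- + b_-^* c = a_+^* / a^*,
whose right sides have only coefficients of index > n resp. >= 0, the
coefficients of b_- of index <= n and those of a_- of index < 0 solve a linear
system whose Hankel kernel is made of the coefficients of c of index <= n.
For -n large this kernel is a contraction of norm 1/2 on the weighted l^1
space, which bounds the lowest-order interaction F_n kappa_n, the n-th
coefficient of b_-, by a sequence in l^1_w that does not depend on n.
Positive indices are treated in the same way with b / a.  All of this is run
on the truncations, with an L^1 error term that tends to 0. *)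

Require Import Defs.
From HB Require Import structures.
From mathcomp Require Import all_boot all_order all_algebra.
From mathcomp Require Import complex.
From mathcomp Require Import all_classical all_reals all_analysis.
From mathcomp Require Import finmap measurable_realfun.
From mathcomp Require Import ring lra zify.
Set Implicit Arguments.
Unset Strict Implicit.
Unset Printing Implicit Defensive.
Import Order.TTheory GRing.Theory Num.Theory numFieldNormedType.Exports.
Local Open Scope classical_set_scope.
Local Open Scope complex_scope.
Local Open Scope ring_scope.

(** Two devices keep the analysis elementary. Membership in A_w is expressed by [wiener]:
    trigonometric polynomials of bounded weighted norm that converge uniformly on the circle. This
    survives sums, products and uniform limits, so exponentials and logarithms are handled through
    explicit uniform approximations. And since the outer hypothesis already supplies radial limits,
    L^1 convergence of Poisson integrals can stand in for Fatou's theorem: for almost every t, some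
    radii near 1 give values near the boundary value.

    The linear system attached to a cut leaves one unknown free, the coefficient of a_- at 0. It is
    bounded a priori by 2, and this single source term, fed through the iterated Hankel operator,
    gives the bound for b_-. Beyond a fixed threshold the weighted kernel entries sum to at most 1/2
    whatever the cut, so one majorant serves all cuts. The operator bound rests on w(j) <= w(j+l)
    w(l), hence on evenness together with submultiplicativity. *)

Local Notation Re := complex.Re.
Local Notation Im := complex.Im.

(** * Complex modulus and the parametrisation of the circle *)

Section ComplexBasics.
Variable R : realType.
Implicit Types (z w : R[i]) (t : R).

Lemma normcEnorm z : `|z| = (normc z)%:C.
Proof. by []. Qed.

Lemma normc_ge0 z : 0 <= normc z.
Proof. by case: z => x y /=; exact: sqrtr_ge0. Qed.

Lemma sqr_normcE z : normc z ^+ 2 = Re z ^+ 2 + Im z ^+ 2.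
Proof. by case: z => x y /=; rewrite sqr_sqrtr// addr_ge0 ?sqr_ge0. Qed.

Lemma normc_addr z w : normc (z + w) <= normc z + normc w.
Proof. exact: le_normcD. Qed.

Lemma normc_opp z : normc (- z) = normc z.
Proof. exact: normcN. Qed.

Lemma normc_subr z w : normc (z - w) <= normc z + normc w.
Proof. by rewrite (le_trans (normc_addr _ _))// normc_opp. Qed.

Lemma normc_distC z w : normc (z - w) = normc (w - z).
Proof. by rewrite -normc_opp opprB. Qed.

Lemma normc_tri z w v : normc (z - w) <= normc (z - v) + normc (v - w).
Proof. by rewrite (le_trans _ (normc_addr _ _))// addrA subrK. Qed.

Lemma normc_lerB z w : normc z - normc w <= normc (z - w).
Proof. by rewrite lerBlDr (le_trans _ (normc_addr _ _))// subrK. Qed.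

Lemma normc_ler_dist z w : `|normc z - normc w| <= normc (z - w).
Proof.
by rewrite ler_norml normc_lerB andbT lerNl opprB normc_distC normc_lerB.
Qed.

Lemma normc_exp z n : normc (z ^+ n) = normc z ^+ n.
Proof.
elim: n => [|n IH]; first by rewrite !expr0 Normc.normc1.
by rewrite !exprS Normc.normcM IH.
Qed.

Lemma normc_conj z : normc (Num.conj z) = normc z.
Proof. by case: z => x y /=; rewrite sqrrN. Qed.

Lemma normc_RtoC (x : R) : normc x%:C = `|x|.
Proof. by rewrite /= expr0n/= addr0 sqrtr_sqr. Qed.

Lemma Re_le_normc z : `|Re z| <= normc z.
Proof.
by case: z => x y /=; rewrite -sqrtr_sqr ler_wsqrtr// lerDl sqr_ge0.
Qed.

Lemma Im_le_normc z : `|Im z| <= normc z.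
Proof.
by case: z => x y /=; rewrite -(sqrtr_sqr y) ler_wsqrtr// lerDr sqr_ge0.
Qed.

Lemma normc_le_ReIm z : normc z <= `|Re z| + `|Im z|.
Proof.
have zE : z = (Re z)%:C + 'i%C * (Im z)%:C by exact: complexE.
rewrite {1}zE (le_trans (normc_addr _ _))// Normc.normcM !normc_RtoC.
by rewrite /= expr0n/= add0r expr1n sqrtr1 mul1r.
Qed.

Lemma normc_sum (I : Type) (r : seq I) (P : pred I) (f : I -> R[i]) :
  normc (\sum_(i <- r | P i) f i) <= \sum_(i <- r | P i) normc (f i).
Proof.
elim/big_rec2: _ => [|i y x _ h]; first by rewrite Normc.normc0.
by rewrite (le_trans (normc_addr _ _))// lerD2l.
Qed.

Lemma mulz_conj z : z * Num.conj z = (normc z ^+ 2)%:C.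
Proof. by rewrite -sqr_normc normcEnorm rmorphXn. Qed.

Lemma Re_conj z : Re (Num.conj z) = Re z. Proof. by case: z. Qed.
Lemma Im_conj z : Im (Num.conj z) = - Im z. Proof. by case: z. Qed.
Lemma ReD z w : Re (z + w) = Re z + Re w. Proof. by case: z; case: w. Qed.
Lemma ImD z w : Im (z + w) = Im z + Im w. Proof. by case: z; case: w. Qed.
Lemma ReN z : Re (- z) = - Re z. Proof. by case: z. Qed.
Lemma ImN z : Im (- z) = - Im z. Proof. by case: z. Qed.
Lemma ReM z w : Re (z * w) = Re z * Re w - Im z * Im w.
Proof. by case: z; case: w. Qed.
Lemma ImM z w : Im (z * w) = Re z * Im w + Im z * Re w.
Proof. by case: z; case: w. Qed.

Lemma circ0 : circ 0 = 1 :> R[i].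
Proof. by rewrite /circ mulr0 cos0 sin0. Qed.

Lemma circD (s t : R) : circ (s + t) = circ s * circ t.
Proof.
rewrite /circ mulrDr cosD sinD /=; apply/eqP; rewrite eq_complex /=.
by rewrite eqxx/= addrC eqxx.
Qed.

Lemma normc_circ t : normc (circ t) = 1.
Proof. by rewrite /= cos2Dsin2 sqrtr1. Qed.

Lemma circ_neq0 t : circ t != 0.
Proof.
apply/eqP => h; have := normc_circ t.
by rewrite h Normc.normc0 => /eqP; rewrite eq_sym oner_eq0.
Qed.

Lemma circN t : circ (- t) = (circ t)^-1.
Proof.
by apply: (mulIf (circ_neq0 t)); rewrite -circD addNr circ0 mulVf// circ_neq0.
Qed.

Lemma circ_conj t : Num.conj (circ t) = (circ t)^-1.
Proof.
by rewrite -circN /circ mulrN cosN sinN.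
Qed.

Lemma circX t (n : nat) : circ t ^+ n = circ (n%:R * t).
Proof.
elim: n => [|n IH]; first by rewrite expr0 mul0r circ0.
by rewrite exprS IH -circD mulrS mulrDl mul1r.
Qed.

Lemma circXz t (n : int) : circ t ^ n = circ (n%:~R * t).
Proof.
case: n => n; first by rewrite -exprnP circX.
by rewrite NegzE -exprnN circX -circN rmorphN /= mulNr.
Qed.

Lemma normc_circXz t (n : int) : normc (circ t ^ n) = 1.
Proof. by rewrite circXz normc_circ. Qed.

Lemma conj_circXz t (n : int) : Num.conj (circ t ^ n) = circ t ^ (- n).
Proof. by rewrite !circXz circ_conj rmorphN mulNr circN. Qed.

Lemma star_circ (f : R[i] -> R[i]) t : star f (circ t) = Num.conj (f (circ t)).
Proof. by rewrite /star circ_conj invrK. Qed.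

End ComplexBasics.

(** * Integration and Fourier coefficients on the circle *)

Section IntegralBasics.
Variable R : realType.
Local Notation I01 := (`[0%R, 1%R]%classic : set R).
Local Notation leb := (@lebesgue_measure R).
Implicit Types (u v : R -> R) (f g : R[i] -> R[i]).

Definition integrable01 u := leb.-integrable I01 (EFin \o u).
Definition int01 u := Rintegral leb I01 u.

Lemma measurable01 : measurable I01. Proof. exact: measurable_itv. Qed.
Hint Resolve measurable01 : core.

Lemma leb01 : leb I01 = 1%E.
Proof. by rewrite lebesgue_measure_itv/= lte_fin ltr01 oppr0 adde0. Qed.

Lemma leb01_fin : (leb I01 < +oo)%E. Proof. by rewrite leb01 ltry. Qed.

Lemma integrable01_measurable u : integrable01 u -> measurable_fun I01 u.
Proof. by move=> /integrableP[/measurable_EFinP]. Qed.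

Lemma integrable01D u v : integrable01 u -> integrable01 v ->
  integrable01 (fun t => u t + v t).
Proof. by move=> hu hv; exact: integrableD hu hv. Qed.

Lemma integrable01Z k u : integrable01 u -> integrable01 (fun t => k * u t).
Proof. by move=> hu; exact: integrableZl hu. Qed.

Lemma integrable01N u : integrable01 u -> integrable01 (fun t => - u t).
Proof. by move=> hu; exact: integrableN hu. Qed.

Lemma integrable01B u v : integrable01 u -> integrable01 v ->
  integrable01 (fun t => u t - v t).
Proof. by move=> hu hv; apply: integrable01D hu (integrable01N hv). Qed.

Lemma integrable01_norm u : integrable01 u -> integrable01 (fun t => `|u t|).
Proof. by move=> hu; exact: integrable_norm hu. Qed.

Lemma integrable01_le u v : measurable_fun I01 u ->
  (forall t, I01 t -> `|u t| <= v t) -> integrable01 v -> integrable01 u.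
Proof.
move=> mu uv hv; apply: le_integrable hv => //; first exact/measurable_EFinP.
move=> t It; rewrite /= lee_fin (le_trans (uv _ It))// ler_norm//.
Qed.

Lemma integrable01_cst k : integrable01 (fun=> k).
Proof.
apply: measurable_bounded_integrable => //; first exact: leb01_fin.
exists `|k|; split; first exact: num_real.
by move=> x xk t _ /=; rewrite ltW.
Qed.

Lemma integrable01_bounded M u : measurable_fun I01 u ->
  (forall t, I01 t -> `|u t| <= M) -> integrable01 u.
Proof. by move=> mu uM; apply: integrable01_le mu uM (integrable01_cst M). Qed.

Lemma int01D u v : integrable01 u -> integrable01 v ->
  int01 (fun t => u t + v t) = int01 u + int01 v.
Proof. exact: RintegralD. Qed.

Lemma int01Z k u : integrable01 u -> int01 (fun t => k * u t) = k * int01 u.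
Proof. exact: RintegralZl. Qed.

Lemma int01N u : integrable01 u -> int01 (fun t => - u t) = - int01 u.
Proof.
move=> hu; rewrite -mulN1r -int01Z//.
by apply: eq_Rintegral => t _; rewrite mulN1r.
Qed.

Lemma int01B u v : integrable01 u -> integrable01 v ->
  int01 (fun t => u t - v t) = int01 u - int01 v.
Proof. exact: RintegralB. Qed.

Lemma int01_cst k : int01 (fun=> k) = k.
Proof.
transitivity (k * fine (leb I01)); first exact: Rintegral_cst.
by rewrite leb01 /= mulr1.
Qed.

Lemma le_int01 u v : integrable01 u -> integrable01 v ->
  (forall t, I01 t -> u t <= v t) -> int01 u <= int01 v.
Proof. exact: le_Rintegral. Qed.

Lemma int01_ge0 u : (forall t, I01 t -> 0 <= u t) -> 0 <= int01 u.
Proof. by move=> h; rewrite /int01; apply: Rintegral_ge0. Qed.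

Lemma eq_int01 u v : (forall t, I01 t -> u t = v t) -> int01 u = int01 v.
Proof. by move=> h; apply: eq_Rintegral => t /set_mem; exact: h. Qed.

Lemma ler_norm_int01 u : integrable01 u -> `|int01 u| <= int01 (fun t => `|u t|).
Proof. exact: le_normr_Rintegral. Qed.

Lemma EFin_int01 u : integrable01 u ->
  (int01 u)%:E = (\int[leb]_(t in I01) (u t)%:E)%E.
Proof. by move=> hu; rewrite /int01 /Rintegral fineK//; exact: integrable_fin_num. Qed.

Global Instance ae_leb_filter : Filter (almost_everywhere leb) :=
  @ae_filter_ringOfSetsType _ _ _ lebesgue_measure.

Definition ae01 (P : R -> Prop) := {ae leb, forall t, I01 t -> P t}.

Lemma ae01_mono (P Q : R -> Prop) : (forall t : R, I01 t -> P t -> Q t) ->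
  ae01 P -> ae01 Q.
Proof.
by move=> PQ; rewrite /ae01; apply: filterS => t h It; exact: PQ It (h It).
Qed.

Lemma ae01_and (P Q : R -> Prop) : ae01 P -> ae01 Q -> ae01 (fun t => P t /\ Q t).
Proof.
by rewrite /ae01 => hP hQ; apply: filterS2 hP hQ => t p q It; split; auto.
Qed.

Lemma ae01_bigand (P : nat -> R -> Prop) : (forall n, ae01 (P n)) ->
  ae01 (fun t => forall n, P n t).
Proof.
move=> h; have := (ae_foralln (fun n => h n)); rewrite /ae01.
by rewrite /ae01; apply: filterS => t ht It n; exact: ht.
Qed.

Lemma int01_ae_eq u v : measurable_fun I01 u -> measurable_fun I01 v ->
  ae01 (fun t => u t = v t) -> int01 u = int01 v.
Proof.
move=> mu mv uv; congr fine; apply: ae_eq_integral => //;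
  [exact/measurable_EFinP|exact/measurable_EFinP|].
by move: uv; rewrite /ae01; apply: filterS => t h It; rewrite (h It).
Qed.

Lemma int01_eq0_ae u : integrable01 u -> int01 (fun t => `|u t|) = 0 ->
  ae01 (fun t => u t = 0).
Proof.
move=> hu h0.
have : (\int[leb]_(t in I01) `|(EFin \o u) t| = 0)%E.
  by rewrite /= -(EFin_int01 (integrable01_norm hu)) h0.
move/(ae_eq_integral_abs leb measurable01 (measurable_int leb hu)).
rewrite /ae01; apply: filterS => t h It; by have := h It => /= -[].
Qed.

Lemma measurable_normcP (p q : R -> R) : measurable_fun I01 p ->
  measurable_fun I01 q -> measurable_fun I01 (fun t => normc (p t +i* q t)).
Proof.
move=> mp mq /=.
have h : measurable_fun [set: R] (@Num.sqrt R).
  by apply: continuous_measurable_fun; exact: sqrt_continuous.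
apply: measurableT_comp h _.
by apply: measurable_funD; exact: measurable_funX.
Qed.

Lemma measurable_T_normc f : measurable_T f ->
  measurable_fun I01 (fun t => normc (f (circ t))).
Proof.
move=> [mp mq]; apply: eq_measurable_fun (measurable_normcP mp mq) => t _.
by case: (f (circ t)).
Qed.

Lemma measurable_TD f g : measurable_T f -> measurable_T g ->
  measurable_T (fun z => f z + g z).
Proof.
move=> [f1 f2] [g1 g2]; split.
  by apply: eq_measurable_fun (measurable_funD f1 g1) => t _; rewrite ReD.
by apply: eq_measurable_fun (measurable_funD f2 g2) => t _; rewrite ImD.
Qed.

Lemma measurable_TM f g : measurable_T f -> measurable_T g ->
  measurable_T (fun z => f z * g z).
Proof.
move=> [f1 f2] [g1 g2]; split.
  apply: eq_measurable_fun (measurable_funB (measurable_funM f1 g1)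
    (measurable_funM f2 g2)) => t _; by rewrite ReM.
apply: eq_measurable_fun (measurable_funD (measurable_funM f1 g2)
    (measurable_funM f2 g1)) => t _; by rewrite ImM.
Qed.

Lemma measurable_T_cst (c : R[i]) : measurable_T (fun=> c).
Proof. by split; exact: measurable_cst. Qed.

Lemma measurable_TZ (c : R[i]) f : measurable_T f -> measurable_T (fun z => c * f z).
Proof. by move=> mf; apply: measurable_TM mf; exact: measurable_T_cst. Qed.

Lemma measurable_TN f : measurable_T f -> measurable_T (fun z => - f z).
Proof.
move=> [f1 f2]; split.
  by apply: eq_measurable_fun (measurable_funN f1) => t _; rewrite ReN.
by apply: eq_measurable_fun (measurable_funN f2) => t _; rewrite ImN.
Qed.

Lemma measurable_TB f g : measurable_T f -> measurable_T g ->
  measurable_T (fun z => f z - g z).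
Proof. by move=> mf mg; apply: measurable_TD mf (measurable_TN mg). Qed.

Lemma measurable_T_ext f g : (forall t, f (circ t) = g (circ t)) ->
  measurable_T f -> measurable_T g.
Proof.
move=> fg [f1 f2]; split.
  by apply: eq_measurable_fun f1 => t _; rewrite fg.
by apply: eq_measurable_fun f2 => t _; rewrite fg.
Qed.

Lemma measurable_T_conj f : measurable_T f -> measurable_T (fun z => Num.conj (f z)).
Proof.
move=> [f1 f2]; split.
  by apply: eq_measurable_fun f1 => t _; rewrite Re_conj.
by apply: eq_measurable_fun (measurable_funN f2) => t _; rewrite Im_conj.
Qed.

Lemma measurable_T_star f : measurable_T f -> measurable_T (star f).
Proof.
move=> mf; apply: measurable_T_ext (measurable_T_conj mf) => t.
by rewrite star_circ.
Qed.

Lemma continuous_linear_comp (k : R) (F : R -> R) : continuous F ->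
  continuous (fun t : R => F (k * t)).
Proof.
move=> cF t; apply: continuous_comp; last exact: cF.
by apply: cvgM; [exact: cvg_cst|exact: cvg_id].
Qed.

Lemma measurable_T_exp (n : int) : measurable_T (fun z : R[i] => z ^ n).
Proof.
split; apply: measurable_funTS; apply: continuous_measurable_fun.
- have -> : (fun t : R => Re (circ t ^ n)) = (fun t => cos (2 * pi * n%:~R * t)).
    by apply/funext => t; rewrite circXz /= mulrA.
  by apply: continuous_linear_comp; exact: continuous_cos.
- have -> : (fun t : R => Im (circ t ^ n)) = (fun t => sin (2 * pi * n%:~R * t)).
    by apply/funext => t; rewrite circXz /= mulrA.
  by apply: continuous_linear_comp; exact: continuous_sin.
Qed.

Lemma integrable_T_measurable f : integrable_T f -> measurable_T f.
Proof. by move=> [f1 f2]; split; apply: integrable01_measurable. Qed.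

(** Real and imaginary parts are integrated separately by definition, but it is the modulus that can
    be dominated; [integrable_T_le] and all that follows from it rest on this equivalence. *)
Lemma integrable_TP f : measurable_T f ->
  integrable_T f <-> integrable01 (fun t => normc (f (circ t))).
Proof.
move=> mf; split => [[f1 f2]|h].
  apply: integrable01_le (measurable_T_normc mf) _
    (integrable01D (integrable01_norm f1) (integrable01_norm f2)).
  by move=> t _; rewrite ger0_norm ?normc_ge0//; exact: normc_le_ReIm.
case: mf => m1 m2; split; apply: (integrable01_le _ _ h) => //.
  by move=> t _; exact: Re_le_normc.
by move=> t _; exact: Im_le_normc.
Qed.

Definition norm1_T f := int01 (fun t => normc (f (circ t))).

Lemma norm1_T_ge0 f : 0 <= norm1_T f.
Proof. by apply: int01_ge0 => t _; exact: normc_ge0. Qed.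

Lemma integrable_T_normc f : integrable_T f -> integrable01 (fun t => normc (f (circ t))).
Proof. by move=> hf; apply/integrable_TP => //; exact: integrable_T_measurable. Qed.

Lemma integrable_T_le f (v : R -> R) : measurable_T f ->
  (forall t, I01 t -> normc (f (circ t)) <= v t) -> integrable01 v -> integrable_T f.
Proof.
move=> mf fv hv; apply/integrable_TP => //; apply: integrable01_le hv.
  exact: measurable_T_normc.
by move=> t It; rewrite ger0_norm ?normc_ge0//; exact: fv.
Qed.

Lemma integrable_T_bounded M f : measurable_T f ->
  (forall t, normc (f (circ t)) <= M) -> integrable_T f.
Proof.
by move=> mf fM; apply: integrable_T_le mf _ (integrable01_cst M) => t _.
Qed.

Lemma integrable_TD f g : integrable_T f -> integrable_T g ->
  integrable_T (fun z => f z + g z).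
Proof.
move=> hf hg; apply: integrable_T_le
  (integrable01D (integrable_T_normc hf) (integrable_T_normc hg)).
  by apply: measurable_TD; exact: integrable_T_measurable.
by move=> t _; exact: normc_addr.
Qed.

Lemma integrable_TM M f g : measurable_T f -> (forall t, normc (f (circ t)) <= M) ->
  integrable_T g -> integrable_T (fun z => f z * g z).
Proof.
move=> mf fM hg; apply: integrable_T_le (integrable01Z M (integrable_T_normc hg)).
  by apply: measurable_TM => //; exact: integrable_T_measurable.
by move=> t _; rewrite Normc.normcM ler_wpM2r// normc_ge0.
Qed.

Lemma integrable_TZ c f : integrable_T f -> integrable_T (fun z => c * f z).
Proof. by apply: (@integrable_TM (normc c)) => //; exact: measurable_T_cst. Qed.

Lemma integrable_TN f : integrable_T f -> integrable_T (fun z => - f z).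
Proof.
move=> hf; apply: integrable_T_le (integrable_T_normc hf).
  by apply: measurable_TN; exact: integrable_T_measurable.
by move=> t _; rewrite normc_opp.
Qed.

Lemma integrable_TB f g : integrable_T f -> integrable_T g ->
  integrable_T (fun z => f z - g z).
Proof. by move=> hf hg; apply: integrable_TD hf (integrable_TN hg). Qed.

Lemma integrable_T_ext f g : (forall t, f (circ t) = g (circ t)) ->
  integrable_T f -> integrable_T g.
Proof.
move=> fg hf; apply: integrable_T_le (integrable_T_normc hf).
  by apply: measurable_T_ext fg (integrable_T_measurable hf).
by move=> t _; rewrite fg.
Qed.

Lemma integral_TE f : integral_T f =
  int01 (fun t => Re (f (circ t))) +i* int01 (fun t => Im (f (circ t))).
Proof. by []. Qed.

Lemma integral_T_ext f g : (forall t, f (circ t) = g (circ t)) ->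
  integral_T f = integral_T g.
Proof.
by move=> fg; rewrite !integral_TE; congr (_ +i* _); apply: eq_int01 => t _; rewrite fg.
Qed.

Lemma integral_TD f g : integrable_T f -> integrable_T g ->
  integral_T (fun z => f z + g z) = integral_T f + integral_T g.
Proof.
move=> [f1 f2] [g1 g2]; rewrite !integral_TE.
apply/eqP; rewrite eq_complex /=; apply/andP; split; apply/eqP.
  by rewrite -int01D//; apply: eq_int01 => t _; rewrite ReD.
by rewrite -int01D//; apply: eq_int01 => t _; rewrite ImD.
Qed.

Lemma integral_TZ c f : integrable_T f ->
  integral_T (fun z => c * f z) = c * integral_T f.
Proof.
move=> [f1 f2]; rewrite !integral_TE; case: c => p q.
apply/eqP; rewrite eq_complex /=; apply/andP; split; apply/eqP.
  rewrite -!int01Z// -int01B; [|exact: integrable01Z|exact: integrable01Z].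
  by apply: eq_int01 => t _; rewrite ReM.
rewrite -!int01Z// -int01D; [|exact: integrable01Z|exact: integrable01Z].
by apply: eq_int01 => t _; rewrite ImM.
Qed.

Lemma integral_TN f : integrable_T f ->
  integral_T (fun z => - f z) = - integral_T f.
Proof.
move=> hf; rewrite -mulN1r -integral_TZ//.
by apply: integral_T_ext => t; rewrite mulN1r.
Qed.

Lemma integral_TB f g : integrable_T f -> integrable_T g ->
  integral_T (fun z => f z - g z) = integral_T f - integral_T g.
Proof.
by move=> hf hg; rewrite -integral_TN// -integral_TD//; exact: integrable_TN.
Qed.

Lemma integral_T_conj f : integrable_T f ->
  integral_T (fun z => Num.conj (f z)) = Num.conj (integral_T f).
Proof.
move=> [f1 f2]; rewrite !integral_TE.
apply/eqP; rewrite eq_complex /=; apply/andP; split; apply/eqP.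
  by apply: eq_int01 => t _; rewrite Re_conj.
by rewrite -int01N//; apply: eq_int01 => t _; rewrite Im_conj.
Qed.

(** The two parts are estimated separately, at the price of a factor 2, which reappears in the
    coefficient bounds [normc_fourier], [coef_le2] and [coef_estimate]. *)
Lemma normc_integral_T f : integrable_T f -> normc (integral_T f) <= 2 * norm1_T f.
Proof.
move=> hf; have [f1 f2] := hf; rewrite (le_trans (normc_le_ReIm _))//=.
rewrite mulrDl mul1r lerD//.
  apply: (le_trans (ler_norm_int01 f1)); apply: le_int01.
  - exact: integrable01_norm.
  - exact: integrable_T_normc.
  - by move=> t _; exact: Re_le_normc.
apply: (le_trans (ler_norm_int01 f2)); apply: le_int01.
- exact: integrable01_norm.
- exact: integrable_T_normc.
- by move=> t _; exact: Im_le_normc.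
Qed.

Lemma integral_T_ae_eq f g : measurable_T f -> measurable_T g ->
  ae01 (fun t => f (circ t) = g (circ t)) -> integral_T f = integral_T g.
Proof.
move=> [f1 f2] [g1 g2] fg; rewrite !integral_TE; congr (_ +i* _).
  by apply: int01_ae_eq => //; apply: ae01_mono fg => t _ ->.
by apply: int01_ae_eq => //; apply: ae01_mono fg => t _ ->.
Qed.

Lemma norm1_T_ae_eq f g : measurable_T f -> measurable_T g ->
  ae01 (fun t => f (circ t) = g (circ t)) -> norm1_T f = norm1_T g.
Proof.
move=> mf mg fg; apply: int01_ae_eq; try exact: measurable_T_normc.
by apply: ae01_mono fg => t _ ->.
Qed.

Lemma le_norm1_T f g (k : R) : integrable_T f -> integrable_T g ->
  (forall t, normc (f (circ t)) <= k * normc (g (circ t))) ->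
  norm1_T f <= k * norm1_T g.
Proof.
move=> hf hg fg; rewrite -int01Z; last exact: integrable_T_normc.
apply: le_int01; first exact: integrable_T_normc.
  by apply: integrable01Z; exact: integrable_T_normc.
by move=> t _; exact: fg.
Qed.

Lemma norm1_T_bounded f M : measurable_T f ->
  (forall t, normc (f (circ t)) <= M) -> norm1_T f <= M.
Proof.
move=> mf fM; rewrite -[leRHS](int01_cst M); apply: le_int01.
- exact: (integrable_T_normc (integrable_T_bounded mf fM)).
- exact: integrable01_cst.
- by move=> t _; exact: fM.
Qed.

Lemma integrable_T_monomial f (n : int) : integrable_T f ->
  integrable_T (fun z => f z * z ^ n).
Proof.
move=> hf; apply: (@integrable_T_ext (fun z => z ^ n * f z)).
  by move=> t; rewrite mulrC.
apply: (@integrable_TM 1) => //; first exact: measurable_T_exp.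
by move=> t; rewrite normc_circXz.
Qed.

Lemma fourierD f g n : integrable_T f -> integrable_T g ->
  fourier (fun z => f z + g z) n = fourier f n + fourier g n.
Proof.
move=> hf hg; rewrite -integral_TD; [|exact: integrable_T_monomial..].
by apply: integral_T_ext => t; rewrite mulrDl.
Qed.

Lemma fourierZ c f n : integrable_T f ->
  fourier (fun z => c * f z) n = c * fourier f n.
Proof.
move=> hf; rewrite -integral_TZ; [|exact: integrable_T_monomial].
by apply: integral_T_ext => t; rewrite mulrA.
Qed.

Lemma fourierB f g n : integrable_T f -> integrable_T g ->
  fourier (fun z => f z - g z) n = fourier f n - fourier g n.
Proof.
move=> hf hg; rewrite -integral_TB; [|exact: integrable_T_monomial..].
by apply: integral_T_ext => t; rewrite mulrBl.
Qed.

Lemma fourier_ext f g n : (forall t, f (circ t) = g (circ t)) ->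
  fourier f n = fourier g n.
Proof. by move=> fg; apply: integral_T_ext => t; rewrite fg. Qed.

Lemma fourier_ae_eq f g n : measurable_T f -> measurable_T g ->
  ae01 (fun t => f (circ t) = g (circ t)) -> fourier f n = fourier g n.
Proof.
move=> mf mg fg; apply: integral_T_ae_eq; [apply: measurable_TM => //; exact: measurable_T_exp..|].
by apply: ae01_mono fg => t _ ->.
Qed.

Lemma normc_fourier f n : integrable_T f -> normc (fourier f n) <= 2 * norm1_T f.
Proof.
move=> hf; rewrite (le_trans (normc_integral_T (integrable_T_monomial _ hf)))//.
rewrite ler_wpM2l// -[leRHS]mul1r; apply: le_norm1_T => //.
  exact: integrable_T_monomial.
by move=> t; rewrite Normc.normcM normc_circXz mulr1 mul1r.
Qed.

Lemma fourier_shift f (m n : int) : 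
  fourier (fun z => z ^ m * f z) n = fourier f (n - m).
Proof.
apply: integral_T_ext => t; rewrite mulrAC mulrC -expfzDr ?circ_neq0//.
by rewrite opprB.
Qed.

Lemma fourier_conj f n : integrable_T f ->
  fourier (fun z => Num.conj (f z)) n = Num.conj (fourier f (- n)).
Proof.
move=> hf; rewrite /fourier -integral_T_conj; last exact: integrable_T_monomial.
by apply: integral_T_ext => t; rewrite rmorphM /= conj_circXz opprK.
Qed.

End IntegralBasics.

(** * Trigonometric polynomials as lists of terms *)

Section TrigPoly.
Variable R : realType.
Implicit Types (f g : R[i] -> R[i]).

Lemma int01_derive (F f : R -> R) :
  (forall x : R, is_derive x (1 : R) F (f x)) -> continuous f -> int01 f = F 1 - F 0.
Proof.
move=> dF cf; rewrite /int01 /Rintegral (@continuous_FTC2 _ _ F)//.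
- exact/continuous_subspaceT.
- have cF : continuous F.
    by move=> x; apply: differentiable_continuous; apply/derivable1_diffP; case: (dF x).
  split=> [x _| |]; first by case: (dF x).
  + by apply: cvg_at_right_filter; exact: cF.
  + by apply: cvg_at_left_filter; exact: cF.
- by move=> x _; rewrite derive1E; case: (dF x).
Qed.

Lemma is_derive_scale (k x : R) : is_derive x (1 : R) (fun t : R => k * t) k.
Proof.
have := @is_deriveZ _ _ _ (@id R) k x 1 1 (is_derive_id x 1).
by rewrite /GRing.scale/= mulr1.
Qed.

Lemma is_derive_sin_scale (k x : R) :
  is_derive x (1 : R) (fun t : R => sin (k * t)) (cos (k * x) * k).
Proof.
have := @is_derive1_comp _ (@sin R) (fun t => k * t) x _ _
  (is_derive_sin (k * x)) (is_derive_scale k x).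
by rewrite mulrC.
Qed.

Lemma is_derive_cos_scale (k x : R) :
  is_derive x (1 : R) (fun t : R => cos (k * t)) (- sin (k * x) * k).
Proof.
have := @is_derive1_comp _ (@cos R) (fun t => k * t) x _ _
  (is_derive_cos (k * x)) (is_derive_scale k x).
by rewrite mulrC.
Qed.

Lemma int01_cos (k : R) : k != 0 -> int01 (fun t => cos (k * t)) = sin k / k.
Proof.
move=> k0.
have h := @int01_derive _ (fun t => cos (k * t) * k) (is_derive_sin_scale k).
have c : continuous (fun t : R => cos (k * t)).
  by apply: continuous_linear_comp; exact: continuous_cos.
have ic : integrable01 (fun t : R => cos (k * t)).
  apply: (@integrable01_bounded _ 1); last by move=> t _; exact: cos_max.
  by apply: measurable_funTS; exact: continuous_measurable_fun.
have ck : continuous (fun t : R => cos (k * t) * k).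
  by move=> t; apply: cvgM; [exact: c|exact: cvg_cst].
have := h ck; rewrite mulr1 mulr0 sin0 subr0 => <-.
have -> : int01 (fun t : R => cos (k * t) * k) = k * int01 (fun t => cos (k * t)).
  by rewrite -int01Z//; apply: eq_int01 => t _; rewrite mulrC.
by rewrite mulrAC divff// mul1r.
Qed.

Lemma int01_sin (k : R) : k != 0 ->
  int01 (fun t => sin (k * t)) = (1 - cos k) / k.
Proof.
move=> k0.
have h := @int01_derive _ (fun t => - sin (k * t) * k) (is_derive_cos_scale k).
have c : continuous (fun t : R => sin (k * t)).
  by apply: continuous_linear_comp; exact: continuous_sin.
have ic : integrable01 (fun t : R => sin (k * t)).
  apply: (@integrable01_bounded _ 1); last by move=> t _; exact: sin_max.
  by apply: measurable_funTS; exact: continuous_measurable_fun.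
have ck : continuous (fun t : R => - sin (k * t) * k).
  by move=> t; apply: cvgM; [apply: cvgN; exact: c|exact: cvg_cst].
have := h ck; rewrite mulr1 mulr0 cos0.
have -> : int01 (fun t : R => - sin (k * t) * k) = - k * int01 (fun t => sin (k * t)).
  by rewrite -int01Z//; apply: eq_int01 => t _; rewrite mulrC mulNr mulrN.
move=> h1; apply: (mulfI k0); rewrite mulrCA divff// mulr1.
by rewrite -[LHS]opprK -mulNr h1 ?opprB.
Qed.

Lemma cos_2pi_nat (n : nat) : cos (2 * pi * n%:R) = 1 :> R.
Proof.
elim: n => [|n IH]; first by rewrite mulr0 cos0.
by rewrite -[n.+1]addn1 natrD mulrDr mulr1 [2 * pi]mulr_natl cosD2pi -mulr_natl.
Qed.

Lemma sin_2pi_nat (n : nat) : sin (2 * pi * n%:R) = 0 :> R.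
Proof.
elim: n => [|n IH]; first by rewrite mulr0 sin0.
by rewrite -[n.+1]addn1 natrD mulrDr mulr1 [2 * pi]mulr_natl sinD2pi -mulr_natl.
Qed.

Lemma circ_int (n : int) : circ n%:~R = 1 :> R[i].
Proof.
case: n => n; first by rewrite /circ cos_2pi_nat sin_2pi_nat.
by rewrite NegzE rmorphN circN /circ cos_2pi_nat sin_2pi_nat invr1.
Qed.

Lemma integral_monomial (n : int) :
  integral_T (fun z : R[i] => z ^ n) = (n == 0)%:R.
Proof.
rewrite integral_TE; have [->|n0] := eqVneq n 0.
  by rewrite !int01_cst.
set k := 2 * pi * n%:~R : R.
have k0 : k != 0 by rewrite !mulf_neq0// ?intr_eq0// gt_eqF// pi_gt0.
have := circ_int n; rewrite /circ -/k => -[ck sk].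
rewrite (_ : int01 _ = int01 (fun t => cos (k * t))); last first.
  by apply: eq_int01 => t _; rewrite circXz /= mulrA.
rewrite (_ : int01 (fun t => Im _) = int01 (fun t => sin (k * t))); last first.
  by apply: eq_int01 => t _; rewrite circXz /= mulrA.
by rewrite int01_cos// int01_sin// ck sk subrr !mul0r.
Qed.

(** Terms are pairs (coefficient, exponent), and exponents may repeat. Sums and products are then
    plain list operations, while [tp_norm] is only an upper bound for the norm in A_w, as
    cancellation between terms is ignored. *)
Definition tpoly := seq (R[i] * int).
Implicit Types (p q : tpoly) (w : int -> R) (Q : pred int).

Definition tp_eval p (z : R[i]) := \sum_(x <- p) x.1 * z ^ x.2.
Definition tp_norm w p := \sum_(x <- p) normc x.1 * w x.2.
Definition tp_mul p q : tpoly := [seq (x.1 * y.1, x.2 + y.2) | x <- p, y <- q].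
Definition tp_conj p : tpoly := [seq (Num.conj x.1, - x.2) | x <- p].
Definition tp_scale (c : R[i]) p : tpoly := [seq (c * x.1, x.2) | x <- p].
Definition tp_coef p n := \sum_(x <- p | x.2 == n) x.1.
Definition tp_supp Q p := all (fun x => Q x.2) p.

Lemma tp_eval_cat p q z : tp_eval (p ++ q) z = tp_eval p z + tp_eval q z.
Proof. exact: big_cat. Qed.

Lemma tp_eval_nil z : tp_eval [::] z = 0.
Proof. exact: big_nil. Qed.

Lemma tp_eval_cons x p z : tp_eval (x :: p) z = x.1 * z ^ x.2 + tp_eval p z.
Proof. exact: big_cons. Qed.

Lemma tp_eval_mul p q t :
  tp_eval (tp_mul p q) (circ t) = tp_eval p (circ t) * tp_eval q (circ t).
Proof.
rewrite /tp_eval /tp_mul big_allpairs_dep mulr_suml; apply: eq_bigr => x _.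
rewrite mulr_sumr; apply: eq_bigr => y _ /=.
by rewrite expfzDr ?circ_neq0// mulrACA.
Qed.

Lemma tp_eval_conj p t : tp_eval (tp_conj p) (circ t) = Num.conj (tp_eval p (circ t)).
Proof.
rewrite /tp_eval /tp_conj big_map rmorph_sum; apply: eq_bigr => x _ /=.
by rewrite rmorphM /= conj_circXz.
Qed.

Lemma tp_eval_scale c p z : tp_eval (tp_scale c p) z = c * tp_eval p z.
Proof.
by rewrite /tp_eval /tp_scale big_map mulr_sumr; apply: eq_bigr => x _; rewrite mulrA.
Qed.

Lemma tp_norm_cat w p q : tp_norm w (p ++ q) = tp_norm w p + tp_norm w q.
Proof. exact: big_cat. Qed.

Lemma tp_norm_scale w c p : tp_norm w (tp_scale c p) = normc c * tp_norm w p.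
Proof.
rewrite /tp_norm /tp_scale big_map mulr_sumr; apply: eq_bigr => x _.
by rewrite Normc.normcM mulrA.
Qed.

Lemma tp_norm_conj w p : (forall n, w (- n) = w n) ->
  tp_norm w (tp_conj p) = tp_norm w p.
Proof.
move=> we; rewrite /tp_norm /tp_conj big_map; apply: eq_bigr => x _.
by rewrite normc_conj we.
Qed.

Lemma tp_norm_mul w p q : (forall n m, w (n + m) <= w n * w m) ->
  tp_norm w (tp_mul p q) <= tp_norm w p * tp_norm w q.
Proof.
move=> wM; rewrite /tp_norm /tp_mul big_allpairs_dep mulr_suml.
apply: ler_sum => x _; rewrite mulr_sumr; apply: ler_sum => y _ /=.
by rewrite Normc.normcM mulrACA ler_wpM2l// mulr_ge0// normc_ge0.
Qed.

Lemma tp_supp_cat Q p q : tp_supp Q (p ++ q) = tp_supp Q p && tp_supp Q q.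
Proof. exact: all_cat. Qed.

Lemma tp_supp_mul Q Q' Q'' p q : (forall n m, Q n -> Q' m -> Q'' (n + m)) ->
  tp_supp Q p -> tp_supp Q' q -> tp_supp Q'' (tp_mul p q).
Proof.
move=> QQ /allP hp /allP hq; apply/allP => x /allpairsP[[a b] /= [ap bq ->]] /=.
by apply: QQ; [exact: hp|exact: hq].
Qed.

Lemma tp_supp_conj Q Q' p : (forall n, Q n -> Q' (- n)) ->
  tp_supp Q p -> tp_supp Q' (tp_conj p).
Proof.
move=> QQ /allP hp; apply/allP => x /mapP[y yp ->] /=.
by apply: QQ; exact: hp.
Qed.

Lemma tp_supp_scale Q c p : tp_supp Q p -> tp_supp Q (tp_scale c p).
Proof. by move=> /allP hp; apply/allP => x /mapP[y yp ->] /=; exact: hp. Qed.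

Lemma tp_suppS Q Q' p : (forall n, Q n -> Q' n) -> tp_supp Q p -> tp_supp Q' p.
Proof. by move=> QQ; apply: sub_all => x; exact: QQ. Qed.

Lemma normc_tp_eval w p t : (forall n, 1 <= w n) ->
  normc (tp_eval p (circ t)) <= tp_norm w p.
Proof.
move=> w1; apply: (le_trans (normc_sum _ _ _)); apply: ler_sum => x _.
by rewrite Normc.normcM normc_circXz mulr1 ler_peMr// normc_ge0.
Qed.

Lemma tp_norm_ge0 w p : (forall n, 1 <= w n) -> 0 <= tp_norm w p.
Proof.
by move=> w1; apply: sumr_ge0 => x _; rewrite mulr_ge0 ?normc_ge0// (le_trans ler01).
Qed.

Lemma measurable_tp_eval p : measurable_T (tp_eval p).
Proof.
elim: p => [|x p IH].
  by apply: measurable_T_ext (@measurable_T_cst R 0) => t; rewrite tp_eval_nil.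
apply: measurable_T_ext (measurable_TD (measurable_TZ x.1 (@measurable_T_exp R x.2)) IH).
by move=> t; rewrite tp_eval_cons.
Qed.

Lemma integrable_tp_eval p : integrable_T (tp_eval p).
Proof.
apply: (@integrable_T_bounded _ (tp_norm (fun=> 1) p)); first exact: measurable_tp_eval.
by move=> t; apply: normc_tp_eval.
Qed.

Lemma tp_integrableM p f : integrable_T f -> integrable_T (fun z => tp_eval p z * f z).
Proof.
apply: integrable_TM; first exact: measurable_tp_eval.
by move=> t; apply: (@normc_tp_eval (fun=> 1)).
Qed.

Lemma fourier_tp_mul p f n : integrable_T f ->
  fourier (fun z => tp_eval p z * f z) n = \sum_(x <- p) x.1 * fourier f (n - x.2).
Proof.
move=> hf; elim: p => [|x p IH].
  rewrite big_nil (@fourier_ext _ _ (fun z => 0 * f z)).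
    by rewrite fourierZ// mul0r.
  by move=> t; rewrite tp_eval_nil.
rewrite big_cons -IH -fourier_shift -fourierZ; last first.
  by apply: integrable_T_ext (integrable_T_monomial x.2 hf) => t; rewrite mulrC.
rewrite -fourierD.
- by apply: fourier_ext => t; rewrite tp_eval_cons mulrDl mulrA.
- apply: integrable_TZ.
  by apply: integrable_T_ext (integrable_T_monomial x.2 hf) => t; rewrite mulrC.
- exact: tp_integrableM.
Qed.

Lemma fourier1 n : fourier (fun=> 1 : R[i]) n = (n == 0)%:R.
Proof.
rewrite /fourier (@integral_T_ext _ _ (fun z => z ^ (- n))).
  by rewrite integral_monomial oppr_eq0.
by move=> t; rewrite mul1r.
Qed.

Lemma integrable_T_cst (c : R[i]) : integrable_T (fun=> c).
Proof. by apply: (@integrable_T_bounded _ (normc c)) => //; exact: measurable_T_cst. Qed.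

Lemma fourier_tp p n : fourier (tp_eval p) n = tp_coef p n.
Proof.
rewrite (@fourier_ext _ _ (fun z => tp_eval p z * 1)); last first.
  by move=> t; rewrite mulr1.
rewrite fourier_tp_mul; last exact: integrable_T_cst.
rewrite /tp_coef [RHS]big_mkcond /=; apply: eq_bigr => x _.
rewrite fourier1 subr_eq0 eq_sym; case: ifP => _; [by rewrite mulr1|by rewrite mulr0].
Qed.

Lemma tp_coef_supp Q p n : tp_supp Q p -> ~~ Q n -> tp_coef p n = 0.
Proof.
move=> /allP hp nQ; rewrite /tp_coef big_seq_cond big1// => x /andP[/hp + /eqP xn].
by rewrite xn (negbTE nQ).
Qed.

Lemma normc_tp_coef p n : normc (tp_coef p n) <= \sum_(x <- p | x.2 == n) normc x.1.
Proof. exact: normc_sum. Qed.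

(** Collecting repeated exponents can only lower the norm, by the triangle inequality. *)
Lemma tp_coef_norm w p (s : seq int) : (forall n, 0 <= w n) -> uniq s ->
  \sum_(n <- s) normc (tp_coef p n) * w n <= tp_norm w p.
Proof.
move=> w0 us.
apply: (@le_trans _ _ (\sum_(n <- s) \sum_(x <- p) (x.2 == n)%:R * (normc x.1 * w x.2))).
  apply: ler_sum => n _; rewrite (le_trans (ler_wpM2r (w0 n) (normc_tp_coef p n)))//.
  rewrite mulr_suml big_mkcond /=; apply: ler_sum => x _.
  by case: eqVneq => [->|]; rewrite ?mul1r ?mul0r.
(* After the exchange, a term of p is counted at most once because [s] has no repetitions. *)
rewrite exchange_big /=; apply: ler_sum => x _.
rewrite -mulr_suml ler_piMl ?mulr_ge0 ?normc_ge0//.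
rewrite -natr_sum -[leRHS]/(1%:R) ler_nat.
rewrite (_ : (\sum_(i <- s) _)%N = (\sum_(i <- s | i == x.2) 1)%N); last first.
  by rewrite [RHS]big_mkcond; apply: eq_bigr => n _; rewrite eq_sym; case: eqP.
by rewrite sum1_count (count_uniq_mem x.2 us) leq_b1.
Qed.

End TrigPoly.

(** * Summable families indexed by the integers *)

Section Summable.
Variable R : realType.
Implicit Types a : int -> R.

Lemma esum_finite_ub a (M : R) : (forall n, 0 <= a n) ->
  (forall s : seq int, uniq s -> \sum_(n <- s) a n <= M) ->
  (\esum_(n in [set: int]) (a n)%:E < +oo)%E.
Proof.
move=> a0 aM; apply: (@le_lt_trans _ _ M%:E); last exact: ltry.
apply: ge_ereal_sup => _ [A [finA _] <-].
rewrite fsbig_finite//= sumEFin lee_fin.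
by apply: aM; exact: fset_uniq.
Qed.

(** [M] is the total sum, repackaged as the supremum of finite sums over duplicate-free lists, the
    form in which later proofs use summability. *)
Lemma esum_finite_bound a : (\esum_(n in [set: int]) (a n)%:E < +oo)%E ->
  (forall n, 0 <= a n) ->
  exists2 M, 0 <= M & (forall s : seq int, uniq s -> \sum_(n <- s) a n <= M) /\
    forall e, 0 < e -> exists s : seq int, uniq s /\ M - e < \sum_(n <- s) a n.
Proof.
move=> afin a0.
have e0 : (0 <= \esum_(n in [set: int]) (a n)%:E)%E.
  by apply: esum_ge0 => n _; rewrite lee_fin.
have efin : (\esum_(n in [set: int]) (a n)%:E)%E \is a fin_num.
  by rewrite ge0_fin_numE.
exists (fine (\esum_(n in [set: int]) (a n)%:E)%E); first exact: fine_ge0.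
split.
  move=> s us; rewrite -lee_fin fineK// -sumEFin fsbig_seq//.
  apply: ereal_sup_ubound; exists [set` s] => //; split=> //; exact: finite_seq.
move=> e e0'.
have := @ub_ereal_sup_adherent R [set (\sum_(x \in A) (a x)%:E)%E | A in fsets [set: int]] e e0' efin.
move=> [_ [A [finA _] <-]]; rewrite fsbig_finite//= sumEFin => hA.
exists (fset_set A); split; first exact: fset_uniq.
by rewrite -lte_fin EFinB fineK.
Qed.

Lemma esum_finite_tail a : (\esum_(n in [set: int]) (a n)%:E < +oo)%E ->
  (forall n, 0 <= a n) -> forall e, 0 < e ->
  exists K : nat, forall s : seq int, uniq s -> (forall n, n \in s -> (K < `|n|)%N) ->
    \sum_(n <- s) a n <= e.
Proof.
move=> afin a0 e e0; have [M M0 [aM /(_ _ e0) [s0 [us0 hs0]]]] := esum_finite_bound afin a0.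
(* [s0] already exhausts the total up to e, and a list beyond its largest index is disjoint from it,
   so the concatenation is still bounded by [M]. *)
exists (\max_(n <- s0) `|n|%N)%N => s us hs.
have := aM (s0 ++ s); rewrite cat_uniq us0 us andbT.
have -> : ~~ has (in_mem^~ (mem s0)) s.
  apply/hasPn => n /hs; apply: contraTN => ns0.
  by rewrite -leqNgt (big_rem n ns0) /= leq_maxl.
move=> /(_ isT); rewrite big_cat /= => h.
by move: hs0 h; lra.
Qed.

End Summable.

(** * Functions with absolutely summable weighted coefficients *)

Section BeurlingClass.
Variables (R : realType) (w : int -> R).
Hypothesis w1 : forall n, 1 <= w n.
Hypothesis wN : forall n, w (- n) = w n.
Hypothesis wM : forall n m, w (n + m) <= w n * w m.
Implicit Types (f g : R[i] -> R[i]) (Q : pred int) (M : R) (p : tpoly R).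

Let w0 n : 0 <= w n. Proof. exact: le_trans (w1 n). Qed.
Hint Resolve w0 : core.

(** Stands for: the spectrum of f lies in Q and its norm in A_w is at most M. It is closed under
    uniform limits by construction, and it concerns the value at every point of the circle, not a
    class up to a.e. equality. *)
Definition wiener Q M f := forall e : R, 0 < e -> exists p : tpoly R,
  [/\ tp_supp Q p, tp_norm w p <= M &
      forall t, normc (tp_eval p (circ t) - f (circ t)) <= e].

Lemma wiener_ge0 Q M f : wiener Q M f -> 0 <= M.
Proof.
by move=> /(_ _ ltr01)[p [_ h _]]; rewrite (le_trans _ h)// tp_norm_ge0.
Qed.

Lemma wiener_bounded Q M f t : wiener Q M f -> normc (f (circ t)) <= M.
Proof.
move=> hf; apply/ler_addgt0Pr => e /hf [p [_ h1 h2]].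
rewrite -[f _](subKr (tp_eval p (circ t))) (le_trans (normc_subr _ _))//.
by rewrite lerD// (le_trans _ h1)// normc_tp_eval.
Qed.

Lemma wienerS Q Q' M M' f : (forall n, Q n -> Q' n) -> M <= M' ->
  wiener Q M f -> wiener Q' M' f.
Proof.
move=> QQ MM hf e /hf [p [h1 h2 h3]]; exists p; split => //.
  exact: tp_suppS h1.
exact: le_trans MM.
Qed.

Lemma wiener_ext Q M f g : (forall t, f (circ t) = g (circ t)) ->
  wiener Q M f -> wiener Q M g.
Proof.
by move=> fg hf e /hf [p [h1 h2 h3]]; exists p; split => // t; rewrite -fg.
Qed.

Lemma wiener_tp Q p : tp_supp Q p -> wiener Q (tp_norm w p) (tp_eval p).
Proof.
by move=> Qp e e0; exists p; split => // t; rewrite subrr Normc.normc0 ltW.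
Qed.

Lemma wiener_lim Q M f : (forall e, 0 < e -> exists2 g, wiener Q M g &
  forall t, normc (g (circ t) - f (circ t)) <= e) -> wiener Q M f.
Proof.
move=> h e e0; have e2 : 0 < e / 2 by rewrite divr_gt0.
have [g /(_ _ e2)[p [h1 h2 h3]] gf] := h _ e2; exists p; split => // t.
rewrite (le_trans (normc_tri _ _ (g (circ t))))// [leRHS]splitr.
by rewrite lerD.
Qed.

Lemma wiener_cst Q (c : R[i]) : Q 0 -> wiener Q (normc c * w 0) (fun=> c).
Proof.
move=> Q0; have h : tp_supp Q [:: (c, 0)] by rewrite /tp_supp /= Q0.
apply: wiener_ext (wienerS (fun n => id) _ (wiener_tp h)) => [t|].
  by rewrite tp_eval_cons tp_eval_nil /= expr0z mulr1 addr0.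
by rewrite /tp_norm big_cons big_nil /= addr0.
Qed.

Lemma wienerD Q M M' f g : wiener Q M f -> wiener Q M' g ->
  wiener Q (M + M') (fun z => f z + g z).
Proof.
move=> hf hg e e0; have e2 : 0 < e / 2 by rewrite divr_gt0.
have [p [p1 p2 p3]] := hf _ e2; have [q [q1 q2 q3]] := hg _ e2.
exists (p ++ q); split.
- by rewrite tp_supp_cat p1 q1.
- by rewrite tp_norm_cat lerD.
- move=> t; rewrite tp_eval_cat opprD addrACA (le_trans (normc_addr _ _))//.
  by rewrite [leRHS]splitr lerD.
Qed.

Lemma wienerZ Q M f c : wiener Q M f -> wiener Q (normc c * M) (fun z => c * f z).
Proof.
move=> hf e e0.
have c1 : 0 < normc c + 1 by rewrite ltr_wpDl ?normc_ge0.
have [p [p1 p2 p3]] := hf _ (divr_gt0 e0 c1).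
exists (tp_scale c p); split.
- exact: tp_supp_scale.
- by rewrite tp_norm_scale ler_wpM2l// normc_ge0.
- move=> t; rewrite tp_eval_scale -mulrBr Normc.normcM.
  rewrite (@le_trans _ _ ((normc c + 1) * (e / (normc c + 1))))//.
    by apply: ler_pM; rewrite ?normc_ge0// lerDl.
  by rewrite mulrC divfK// gt_eqF.
Qed.

Lemma wienerM Q M M' f g : (forall n m, Q n -> Q m -> Q (n + m)) ->
  wiener Q M f -> wiener Q M' g -> wiener Q (M * M') (fun z => f z * g z).
Proof.
move=> QD hf hg e e0.
have M0 := wiener_ge0 hf; have M'0 := wiener_ge0 hg.
(* The splitting ab - xy = a(b - y) + (a - x)y below gives an error of at most (M + M')d; the
   summand 1 keeps the denominator positive. *)
set d := e / (M + M' + 1).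
have s0 : 0 < M + M' + 1 by rewrite ltr_wpDl// addr_ge0.
have d0 : 0 < d by rewrite divr_gt0.
have [p [p1 p2 p3]] := hf _ d0; have [q [q1 q2 q3]] := hg _ d0.
exists (tp_mul p q); split.
- exact: tp_supp_mul p1 q1.
- by rewrite (le_trans (tp_norm_mul _ _ wM))// ler_pM// tp_norm_ge0.
- move=> t; rewrite tp_eval_mul.
  set a := tp_eval p _; set b := tp_eval q _; set x := f _; set y := g _.
  have -> : a * b - x * y = a * (b - y) + (a - x) * y by ring.
  rewrite (le_trans (normc_addr _ _))// !Normc.normcM.
  rewrite (@le_trans _ _ (M * d + d * M'))//.
    apply: lerD; apply: ler_pM; rewrite ?normc_ge0//; [|exact: q3|exact: p3|].
      by rewrite (le_trans _ p2)// normc_tp_eval.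
    exact: wiener_bounded hg.
  by rewrite (mulrC d) -mulrDl /d mulrA ler_pdivrMr// mulrC ler_pM2l// lerDl ler01.
Qed.

Lemma wiener_conj M f : wiener xpredT M f -> wiener xpredT M (fun z => Num.conj (f z)).
Proof.
move=> hf e /hf [p [p1 p2 p3]]; exists (tp_conj p); split.
- exact: tp_supp_conj p1.
- by rewrite tp_norm_conj.
- by move=> t; rewrite tp_eval_conj -rmorphB normc_conj.
Qed.

Lemma wiener_sum Q (M_ : nat -> R) (f_ : nat -> R[i] -> R[i]) K :
  (forall k, wiener Q (M_ k) (f_ k)) ->
  wiener Q (\sum_(k < K) M_ k) (fun z => \sum_(k < K) f_ k z).
Proof.
move=> h; elim: K => [|K IH].
  rewrite big_ord0 => e e0; exists [::]; split => //.
    by rewrite /tp_norm big_nil.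
  by move=> t; rewrite big_ord0 tp_eval_nil subrr Normc.normc0 ltW.
rewrite big_ord_recr /=; apply: wiener_ext (wienerD IH (h K)) => t.
by rewrite big_ord_recr.
Qed.

Lemma measurable_wiener Q M f : wiener Q M f -> measurable_T f.
Proof.
move=> hf.
have ex k : exists p, forall t, normc (tp_eval p (circ t) - f (circ t)) <= (k.+1%:R)^-1.
  by have [|p [_ _ h]] := hf (k.+1%:R)^-1; [rewrite invr_gt0|exists p].
have [p hp] := choice ex.
have lim (F : R[i] -> R) : (forall z y, F (z - y) = F z - F y) ->
    (forall z, `|F z| <= normc z) ->
    forall t : R, F (tp_eval (p k) (circ t)) @[k --> \oo] --> F (f (circ t)).
  move=> FB Fle t; apply/cvgrPdist_le => e e0.
  have := @near_infty_natSinv_lt R (PosNum e0).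
  apply: filterS => k /= hk; rewrite distrC -FB (le_trans (Fle _))//.
  by rewrite (le_trans (hp k t))// ltW.
split.
  apply: (@measurable_fun_cvg _ _ _ _ (fun k t => complex.Re (tp_eval (p k) (circ t)))).
    by move=> k; have [] := measurable_tp_eval (p k).
  move=> t _; apply: lim => [z y|z]; last exact: Re_le_normc.
  by rewrite ReD ReN.
apply: (@measurable_fun_cvg _ _ _ _ (fun k t => complex.Im (tp_eval (p k) (circ t)))).
  by move=> k; have [] := measurable_tp_eval (p k).
move=> t _; apply: lim => [z y|z]; last exact: Im_le_normc.
by rewrite ImD ImN.
Qed.

Lemma integrable_wiener Q M f : wiener Q M f -> integrable_T f.
Proof.
move=> hf; apply: (integrable_T_bounded (measurable_wiener hf)) => t.
exact: wiener_bounded hf.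
Qed.

(** L^1 approximation is enough: on a fixed finite set of indices the coefficients of p converge to
    those of f, and the bound M passes to the limit. Each coefficient moves by at most twice the L^1
    distance, so the tolerance is divided by twice the weight [W] of the set, plus 1. *)
Lemma ell1_fourier_lim M f : integrable_T f ->
  (forall e, 0 < e -> exists2 p, tp_norm w p <= M &
     norm1_T (fun z => tp_eval p z - f z) <= e) ->
  ell1 w (fourier f).
Proof.
move=> hf hp; apply: (@esum_finite_ub _ _ M) => [n|s us].
  by rewrite mulr_ge0// normc_ge0.
apply/ler_addgt0Pr => e e0.
set W := \sum_(n <- s) w n.
have W0 : 0 <= W by apply: sumr_ge0 => n _.
have W1 : 0 < 2 * W + 1 by rewrite ltr_wpDl// mulr_ge0.
have [p pM pf] := hp _ (divr_gt0 e0 W1).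
have hd : integrable_T (fun z => tp_eval p z - f z).
  by apply: integrable_TB => //; exact: integrable_tp_eval.
apply: (@le_trans _ _ (\sum_(n <- s) (normc (tp_coef p n) * w n +
   2 * (e / (2 * W + 1)) * w n))).
  apply: ler_sum => n _; rewrite -mulrDl ler_wpM2r//.
  rewrite -[fourier f n](subKr (tp_coef p n)) (le_trans (normc_subr _ _))//.
  rewrite lerD2l -fourier_tp -fourierB//; last exact: integrable_tp_eval.
  by rewrite (le_trans (normc_fourier _ hd))// ler_wpM2l.
rewrite big_split /= lerD//.
  by rewrite (le_trans _ pM)// tp_coef_norm.
rewrite -mulr_sumr -/W mulrAC mulrA ler_pdivrMr// mulrC ler_pM2l//.
by rewrite lerDl ler01.
Qed.

Lemma wiener_norm1_approx Q M f e : wiener Q M f -> 0 < e ->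
  exists p, [/\ tp_supp Q p, tp_norm w p <= M &
    norm1_T (fun z => tp_eval p z - f z) <= e].
Proof.
move=> hf e0; have [p [p1 p2 p3]] := hf _ e0; exists p; split => //.
apply: norm1_T_bounded p3.
by apply: measurable_TB; [exact: measurable_tp_eval|exact: measurable_wiener hf].
Qed.

Lemma wiener_ell1 Q M f : wiener Q M f -> ell1 w (fourier f).
Proof.
move=> hf; apply: (@ell1_fourier_lim M); first exact: integrable_wiener hf.
by move=> e e0; have [p [_ p1 p2]] := wiener_norm1_approx hf e0; exists p.
Qed.

(** The n-th coefficient vanishes for every approximating polynomial, and it depends continuously on
    the function in L^1. *)
Lemma wiener_fourier0 Q M f n : wiener Q M f -> ~~ Q n -> fourier f n = 0.
Proof.
move=> hf nQ; apply: Normc.eq0_normc; apply/le_anti/andP; split; last exact: normc_ge0.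
apply/ler_addgt0Pr => e e0; rewrite add0r.
have e2 : 0 < e / 2 by rewrite divr_gt0.
have [p [p1 p2 p3]] := wiener_norm1_approx hf e2.
have hd : integrable_T (fun z => tp_eval p z - f z).
  by apply: integrable_TB; [exact: integrable_tp_eval|exact: integrable_wiener hf].
rewrite -normc_opp -[- _]add0r -(tp_coef_supp p1 nQ) -fourier_tp -fourierB.
- by rewrite (le_trans (normc_fourier _ hd))// mulrC -ler_pdivlMr.
- exact: integrable_tp_eval.
- exact: integrable_wiener hf.
Qed.

End BeurlingClass.

(** * Fourier series with weighted summable coefficients *)

Section CoefficientSeries.
Variables (R : realType) (w : int -> R).
Hypothesis w1 : forall n, 1 <= w n.
Implicit Types (f g : R[i] -> R[i]) (Q : pred int) (M : R) (p : tpoly R).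

Let w0 n : 0 <= w n. Proof. exact: le_trans (w1 n). Qed.
Hint Resolve w0 : core.

Definition zrange (K : nat) : seq int := [seq (i%:Z - K%:Z) | i <- iota 0 (2 * K).+1].

Lemma zrange_uniq K : uniq (zrange K).
Proof. by rewrite map_inj_uniq ?iota_uniq// => i j /addIr[]. Qed.

Lemma mem_zrange K n : (n \in zrange K) = (`|n| <= K)%N.
Proof.
apply/mapP/idP => [[i + ->]|nK].
  by rewrite mem_iota add0n /= ltnS => iK; lia.
by exists (absz (n + K%:Z)); rewrite ?mem_iota; lia.
Qed.

Lemma cauchy_real (u : nat -> R) :
  (forall e, 0 < e -> exists K0 : nat, forall K K', (K0 <= K)%N -> (K <= K')%N ->
     `|u K' - u K| <= e) -> cvgn u.
Proof.
move=> h; apply/cauchy_cvgP/cauchy_exP => e e0.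
have [K0 hK] := h _ (divr_gt0 e0 (ltr0n R 2)).
exists (u K0); exists K0 => // K /= K0K; rewrite /ball /= distrC.
by rewrite (le_lt_trans (hK _ _ _ K0K))// ltr_pdivrMr// ltr_pMr// ltr1n.
Qed.

Lemma lim_dist (u : nat -> R) K b : cvgn u ->
  (forall K', (K <= K')%N -> `|u K' - u K| <= b) -> `|u K - limn u| <= b.
Proof.
move=> cu h; rewrite distrC.
have hc : (fun k => `|u k - u K|) @ \oo --> `|limn u - u K|.
  by apply: cvg_norm; apply: cvgB => //; exact: cvg_cst.
rewrite -(cvg_lim _ hc)//; apply: limr_le; first by apply: cvgP hc.
by exists K => //= k kK; exact: h.
Qed.

Variable d : int -> R[i].
Hypothesis dw : ell1 w d.

Definition partial_series (K : nat) : tpoly R := [seq (d n, n) | n <- zrange K].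

Lemma partial_seriesE K z :
  tp_eval (partial_series K) z = \sum_(n <- zrange K) d n * z ^ n.
Proof. by rewrite /tp_eval /partial_series big_map. Qed.

Let a n := normc (d n) * w n.
Let a0 n : 0 <= a n. Proof. by rewrite mulr_ge0 ?normc_ge0. Qed.

Definition tail_list (K K' : nat) : tpoly R :=
  [seq (d n, n) | n <- zrange K' & (K < `|n|)%N].

Lemma partial_series_diff K K' z : (K <= K')%N ->
  tp_eval (partial_series K') z - tp_eval (partial_series K) z =
  tp_eval (tail_list K K') z.
Proof.
move=> KK; rewrite !partial_seriesE /tp_eval /tail_list [RHS]big_map big_filter /=.
rewrite (bigID (fun n : int => (K < `|n|)%N)) /= -addrA.
rewrite (_ : \sum_(n <- zrange K' | ~~ _) _ = \sum_(n <- zrange K) d n * z ^ n).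
  by rewrite subrr addr0.
rewrite -big_filter; apply: perm_big; apply: uniq_perm.
- by rewrite filter_uniq// zrange_uniq.
- exact: zrange_uniq.
- move=> n; rewrite mem_filter !mem_zrange -leqNgt andb_idr// => nK.
  exact: leq_trans KK.
Qed.

Lemma tail_list_small e : 0 < e -> exists K0 : nat, forall K K', (K0 <= K)%N ->
  tp_norm w (tail_list K K') <= e.
Proof.
move=> e0; have [K0 h] := esum_finite_tail dw a0 e0.
exists K0 => K K' K0K; rewrite /tp_norm /tail_list big_map /=.
apply: (h [seq n <- zrange K' | (K < `|n|)%N]).
  by rewrite filter_uniq// zrange_uniq.
by move=> n; rewrite mem_filter => /andP[+ _]; exact: leq_ltn_trans.
Qed.

(** Meaningful on the circle, where [fseries_cvg] gives uniform convergence; [limn] takes an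
    arbitrary value where there is no limit. *)
Definition fseries (z : R[i]) : R[i] :=
  limn (fun K => complex.Re (tp_eval (partial_series K) z)) +i*
  limn (fun K => complex.Im (tp_eval (partial_series K) z)).

Lemma fseries_cvg e : 0 < e -> exists K0 : nat, forall K, (K0 <= K)%N ->
  forall t, normc (tp_eval (partial_series K) (circ t) - fseries (circ t)) <= e.
Proof.
move=> e0; have e2 : 0 < e / 2 by rewrite divr_gt0.
have dist x K K' t : (forall K', tp_norm w (tail_list K K') <= x) -> (K <= K')%N ->
    normc (tp_eval (partial_series K') (circ t) -
           tp_eval (partial_series K) (circ t)) <= x.
  move=> h KK; rewrite partial_series_diff// (le_trans _ (h K'))//.
  exact: normc_tp_eval.
have cRe t : cvgn (fun K => complex.Re (tp_eval (partial_series K) (circ t))).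
  apply: cauchy_real => x /tail_list_small[K0 hK]; exists K0 => K K' K0K KK.
  rewrite -ReN -ReD (le_trans (Re_le_normc _))//; apply: dist KK => L.
  exact: hK.
have cIm t : cvgn (fun K => complex.Im (tp_eval (partial_series K) (circ t))).
  apply: cauchy_real => x /tail_list_small[K0 hK]; exists K0 => K K' K0K KK.
  rewrite -ImN -ImD (le_trans (Im_le_normc _))//; apply: dist KK => L.
  exact: hK.
have [K0 hK] := tail_list_small e2; exists K0 => K K0K t.
have hK' L := hK K L K0K.
rewrite (le_trans (normc_le_ReIm _))// [leRHS]splitr; apply: lerD.
  rewrite ReD ReN /=; apply: (lim_dist (cRe t)) => K' KK.
  by rewrite -ReN -ReD (le_trans (Re_le_normc _))//; exact: dist KK.
rewrite ImD ImN /=; apply: (lim_dist (cIm t)) => K' KK.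
by rewrite -ImN -ImD (le_trans (Im_le_normc _))//; exact: dist KK.
Qed.

(** Dropping the zero terms outside Q makes the list itself supported in Q, as [wiener] asks,
    without changing values or norm. *)
Lemma tp_supp_partial Q K : (forall n, ~~ Q n -> d n = 0) ->
  exists2 p, tp_supp Q p & (forall z, tp_eval p z = tp_eval (partial_series K) z) /\
   tp_norm w p = tp_norm w (partial_series K).
Proof.
move=> dQ; exists [seq (d n, n) | n <- zrange K & Q n].
  by apply/allP => x /mapP[n]; rewrite mem_filter => /andP[Qn _ ->].
split=> [z|].
  rewrite partial_seriesE /tp_eval [LHS]big_map big_filter [LHS]big_mkcond.
  by apply: eq_bigr => n _; case: ifPn => // /dQ ->; rewrite mul0r.
rewrite /tp_norm /partial_series [LHS]big_map [RHS]big_map big_filter [LHS]big_mkcond.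
by apply: eq_bigr => n _ /=; case: ifPn => // /dQ ->; rewrite Normc.normc0 mul0r.
Qed.

Lemma wiener_fseries Q : (forall n, ~~ Q n -> d n = 0) ->
  exists M, wiener w Q M fseries.
Proof.
move=> dQ; have [M M0 [aM _]] := esum_finite_bound dw a0; exists M => e e0.
have [K0 /(_ K0 (leqnn _)) h] := fseries_cvg e0.
have [p p1 [p2 p3]] := tp_supp_partial K0 dQ.
exists p; split => // [|t]; last by rewrite p2.
by rewrite p3 /tp_norm /partial_series big_map /=; apply: aM; exact: zrange_uniq.
Qed.

(** More than uniform approximation: the remainder is a limit of tails of the series, so it is small
    in the norm of A_w. This is the property later called [tp_approx]. *)
Lemma wiener_fseries_tail e : 0 < e -> exists K : nat,
  wiener w xpredT e (fun z => fseries z - tp_eval (partial_series K) z).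
Proof.
move=> e0; have [K hK] := tail_list_small e0; exists K => x x0.
have [K1 h1] := fseries_cvg x0; set L := maxn K K1.
exists (tail_list K L); split.
- exact/allP.
- exact: hK.
- move=> t; rewrite -partial_series_diff ?leq_maxl// opprB addrA subrK.
  by apply: h1; exact: leq_maxr.
Qed.

Lemma tp_coef_partial K n : (`|n| <= K)%N -> tp_coef (partial_series K) n = d n.
Proof.
move=> nK; rewrite /tp_coef /partial_series big_map /= big_mkcond (bigD1_seq n) ?mem_zrange//=; last first.
  exact: zrange_uniq.
by rewrite eqxx big1 ?addr0// => i /negbTE ->.
Qed.

Lemma fourier_fseries n : fourier fseries n = d n.
Proof.
have [M hM] : exists M, wiener w xpredT M fseries by exact: wiener_fseries.
apply/eqP; rewrite -subr_eq0; apply/eqP/Normc.eq0_normc.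
apply/le_anti/andP; split; last exact: normc_ge0.
apply/ler_addgt0Pr => e e0; rewrite add0r.
have e2 : 0 < e / 2 by rewrite divr_gt0.
have [K0 /(_ (maxn K0 `|n|) (leq_maxl _ _)) h] := fseries_cvg e2.
have hf := integrable_wiener w1 hM.
set p := partial_series (maxn K0 `|n|) in h *.
have hp := integrable_tp_eval p.
rewrite -(@tp_coef_partial (maxn K0 `|n|)) ?leq_maxr// -fourier_tp normc_distC -fourierB//.
rewrite (le_trans (normc_fourier _ (integrable_TB hp hf)))// mulrC -ler_pdivlMr//.
by apply: norm1_T_bounded h; exact: (integrable_T_measurable (integrable_TB hp hf)).
Qed.

End CoefficientSeries.

(** * The complex exponential, and exponentials in A_w *)

Section ComplexExponential.
Variable R : realType.
Implicit Types (z y : R[i]).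

Lemma mvt_abs (f df : R -> R) (K x : R) :
  (forall c : R, is_derive c (1 : R) f (df c)) ->
  (forall c, `|c| <= `|x| -> `|df c| <= K) -> `|f x - f 0| <= K * `|x|.
Proof.
move=> hd hK.
have cf : continuous f.
  by move=> c; apply: differentiable_continuous; apply/derivable1_diffP; case: (hd c).
have [x0|x0] := leP 0 x.
  have [|c + ->] := @MVT_segment R f df 0 x x0 (fun c _ => hd c).
    exact: continuous_subspaceT.
  rewrite in_itv /= => /andP[c0 cx]; rewrite subr0 normrM ler_wpM2r//.
  by apply: hK; rewrite !ger0_norm.
have [|c + ] := @MVT_segment R f df x 0 (ltW x0) (fun c _ => hd c).
  exact: continuous_subspaceT.
rewrite in_itv /= => /andP[xc c0]; rewrite distrC => ->.
rewrite sub0r normrM normrN ler_wpM2r//.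
by apply: hK; rewrite !ler0_norm ?lerN2// ltW.
Qed.

Lemma abs_sin_le (x : R) : `|sin x| <= `|x|.
Proof.
rewrite -[sin x]subr0 -[X in _ - X](@sin0 R) -[leRHS]mul1r.
by apply: (@mvt_abs _ cos) => c _; exact: cos_max.
Qed.

Lemma abs_cos_sub1 (x : R) : `|cos x - 1| <= `|x| ^+ 2.
Proof.
rewrite -[X in _ - X](@cos0 R) expr2.
apply: (@mvt_abs _ (fun c => - sin c)) => c cx.
by rewrite normrN (le_trans (abs_sin_le c)).
Qed.

Lemma abs_sin_subx (x : R) : `|sin x - x| <= `|x| ^+ 3.
Proof.
rewrite -[_ - x]subr0 (_ : sin x - x - 0 = (sin x - x) - (sin 0 - 0)); last first.
  by rewrite sin0 !subr0.
rewrite exprSr; apply: (@mvt_abs (fun x => sin x - x) (fun c => cos c - 1)) => c cx.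
rewrite (le_trans (abs_cos_sub1 c))//.
by rewrite lerXn2r// nnegrE normr_ge0.
Qed.

(** Both bounds come from e^y >= 1 + y, used at x and at -x. *)
Lemma expR_taylor (x : R) : `|x| <= 2^-1 -> `|expR x - 1 - x| <= 2 * `|x| ^+ 2.
Proof.
move=> hx; have h1 := expR_ge1Dx x.
have h2 := expR_ge1Dx (- x); have h3 := expR_gt0 x.
move: h2; rewrite expRN => h2.
have x2 : `|x| ^+ 2 = x ^+ 2 by rewrite real_normK// num_real.
move: hx; rewrite ler_norml => /andP[xa xb].
rewrite ger0_norm ?x2; last by lra.
have : (1 - x) * expR x <= 1.
  by rewrite -ler_pdivlMr// mul1r.
by nra.
Qed.

Lemma cexpD z y : cexp (z + y) = cexp z * cexp y.
Proof.
rewrite /cexp ReD ImD expRD cosD sinD.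
by apply/eqP; rewrite eq_complex /=; apply/andP; split; apply/eqP; ring.
Qed.

Lemma cexp0 : cexp (0 : R[i]) = 1.
Proof. by rewrite /cexp /= expR0 cos0 sin0 mul1r. Qed.

Lemma normc_cexp z : normc (cexp z) = expR (Re z).
Proof.
rewrite /cexp Normc.normcM normc_RtoC ger0_norm ?expR_ge0//=.
by rewrite cos2Dsin2 sqrtr1 mulr1.
Qed.

Lemma cexpX z n : cexp z ^+ n = cexp (n%:R * z).
Proof.
elim: n => [|n IH]; first by rewrite expr0 mul0r cexp0.
by rewrite exprS IH -cexpD -[n.+1]add1n natrD mulrDl mul1r.
Qed.

Lemma cexp_taylor z : normc z <= 2^-1 -> normc (cexp z - 1 - z) <= 10 * normc z ^+ 2.
Proof.
move=> hz; have := Re_le_normc z; have := Im_le_normc z.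
set x := Re z; set y := Im z; set r := normc z => yr xr.
rewrite (le_trans (normc_le_ReIm _))//.
have -> : Re (cexp z - 1 - z) = (expR x - 1 - x) + expR x * (cos y - 1).
  by rewrite !ReD !ReN /cexp ReM /= -/x -/y; ring.
have -> : Im (cexp z - 1 - z) = expR x * (sin y - y) + ((expR x - 1 - x) + x) * y.
  by rewrite !ImD !ImN /cexp ImM /= -/x -/y; ring.
have r0 : 0 <= r by exact: normc_ge0.
have rh : r <= 2^-1 by [].
have t1 : `|expR x - 1 - x| <= 2 * r ^+ 2.
  apply: le_trans (expR_taylor (le_trans xr hz)) _.
  by rewrite ler_wpM2l// lerXn2r// nnegrE normr_ge0.
have t2 : `|cos y - 1| <= r ^+ 2.
  apply: le_trans (abs_cos_sub1 y) _.
  by rewrite lerXn2r// nnegrE normr_ge0.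
have t3 : `|sin y - y| <= r ^+ 3.
  apply: le_trans (abs_sin_subx y) _.
  by rewrite lerXn2r// nnegrE normr_ge0.
have e2 : `|expR x| <= 2.
  move: t1 xr; rewrite !ler_norml => /andP[_ t1] /andP[_ xr].
  have e0 := expR_gt0 x; apply/andP; split; first exact: le_trans (ltW e0).
  have r2 : r ^+ 2 <= 2^-1 * 2^-1 by rewrite expr2 ler_pM.
  by lra.
have b1 : `|expR x * (cos y - 1)| <= 2 * r ^+ 2 by rewrite normrM ler_pM.
have b2 : `|expR x * (sin y - y)| <= 2 * r ^+ 3 by rewrite normrM ler_pM.
have b3 : `|(expR x - 1 - x + x) * y| <= (2 * r ^+ 2 + r) * r.
  by rewrite normrM ler_pM// (le_trans (ler_normD _ _))// lerD.
apply: (@le_trans _ _ (2 * r ^+ 2 + 2 * r ^+ 2 + (2 * r ^+ 3 + (2 * r ^+ 2 + r) * r))).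
  by rewrite lerD// (le_trans (ler_normD _ _))// lerD.
have r3 : r ^+ 3 <= r ^+ 2 * 2^-1 by rewrite exprSr ler_wpM2l// sqr_ge0.
have -> : 2 * r ^+ 2 + 2 * r ^+ 2 + (2 * r ^+ 3 + (2 * r ^+ 2 + r) * r) =
  5 * r ^+ 2 + 4 * r ^+ 3 by ring.
have := sqr_ge0 r; move: r3; set r2 := r ^+ 2; set rr := r ^+ 3; lra.
Qed.

Lemma normc_subXX z y (b : R) n : 0 <= b -> normc z <= b -> normc y <= b ->
  normc (z ^+ n - y ^+ n) <= n%:R * normc (z - y) * b ^+ n.-1.
Proof.
move=> b0 zb yb; rewrite subrXX Normc.normcM.
rewrite -mulrA mulrCA ler_wpM2l ?normc_ge0// (le_trans (normc_sum _ _ _))//.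
rewrite mulr_natl -[X in _ *+ X]card_ord -sumr_const; apply: ler_sum => i _.
rewrite Normc.normcM !normc_exp (_ : n.-1 = (n.-1 - i) + i)%N; last first.
  by rewrite subnK//; case: n i => [[]//|n] i; rewrite -ltnS.
by rewrite exprD addnK ler_pM ?exprn_ge0 ?normc_ge0 ?lerXn2r ?nnegrE ?normc_ge0.
Qed.

(** With m = n + 1, cexp z is the m-th power of cexp(z/m), so the difference of the two powers
    telescopes into m terms, each of order (M/m)^2. The hypothesis 2M <= m puts z/m in the range of
    [cexp_taylor]. *)
Lemma cexp_lim z (M : R) n : normc z <= M -> 2 * M <= n.+1%:R ->
  normc ((1 + n.+1%:R^-1 * z) ^+ n.+1 - cexp z) <= 10 * M ^+ 2 * expR M / n.+1%:R.
Proof.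
move=> zM Mn; have M0 : 0 <= M by rewrite (le_trans _ zM)// normc_ge0.
set m : R := n.+1%:R; have m0 : 0 < m by rewrite ltr0n.
have mC : (n.+1%:R : R[i]) = m%:C by rewrite rmorph_nat.
set u := n.+1%:R^-1 * z.
have uM : normc u <= M / m.
  rewrite /u Normc.normcM Normc.normcV mC normc_RtoC (ger0_norm (ltW m0)).
  by rewrite mulrC ler_wpM2r// invr_ge0 ltW.
have zE : cexp z = cexp u ^+ n.+1.
  by rewrite cexpX /u mulrA divff ?mul1r// pnatr_eq0.
have Mm2 : M / m <= 2^-1 by rewrite ler_pdivrMr// mulrC ler_pdivlMr// mulrC.
have a1 : normc (1 + u) <= expR (M / m).
  rewrite (le_trans (normc_addr _ _))// Normc.normc1 (le_trans _ (expR_ge1Dx _))//.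
  by rewrite lerD2l.
have a2 : normc (cexp u) <= expR (M / m).
  rewrite normc_cexp ler_expR (le_trans (ler_norm _))//.
  exact: le_trans (Re_le_normc _) uM.
have h1 : normc (1 + u - cexp u) <= 10 * (M / m) ^+ 2.
  rewrite normc_distC opprD addrA (le_trans (cexp_taylor (le_trans uM Mm2)))//.
  by rewrite ler_wpM2l// lerXn2r ?nnegrE ?normc_ge0// divr_ge0// ltW.
have h2 : expR (M / m) ^+ n <= expR M.
  rewrite -expRM_natl ler_expR mulrA mulrAC ler_piMl//.
  by rewrite ler_pdivrMr// mul1r /m ler_nat.
rewrite zE (le_trans (normc_subXX _ (expR_ge0 _) a1 a2))//=.
rewrite (@le_trans _ _ (m * (10 * (M / m) ^+ 2) * expR M))//.
  apply: (ler_pM _ _ _ h2); last by rewrite ler_wpM2l// ltW.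
    by rewrite mulr_ge0 ?normc_ge0// ltW.
  by rewrite exprn_ge0 ?expR_ge0.
by rewrite le_eqVlt; apply/orP; left; apply/eqP; field; rewrite gt_eqF.
Qed.

Variable w : int -> R.
Hypothesis w1 : forall n, 1 <= w n.
Hypothesis wM : forall n m, w (n + m) <= w n * w m.

(* The factors are kept of the form (identity + small), so that the possibly
   large norm [w 0] of the constant 1 enters only once. *)
Lemma wienerX1 (Q : pred int) M (f : R[i] -> R[i]) k : Q 0 ->
  (forall n m, Q n -> Q m -> Q (n + m)) -> wiener w Q M f ->
  wiener w Q (w 0 * (1 + M) ^+ k) (fun z => (1 + f z) ^+ k).
Proof.
move=> Q0 QD hf; elim: k => [|k IH].
  have := wiener_cst w (1 : R[i]) Q0; rewrite Normc.normc1 mul1r expr0 mulr1.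
  by apply: wiener_ext => t; rewrite expr0.
rewrite exprSr mulrA mulrDr mulr1.
apply: wiener_ext (wienerD IH (wienerM w1 wM QD IH hf)) => t.
by rewrite exprSr mulrDr mulr1.
Qed.

(** The products (1 + f/m)^m have norm at most w(0) e^M for all large m and converge uniformly to
    exp f, which is what [wiener_lim] asks for. *)
Lemma wiener_cexp (Q : pred int) M (f : R[i] -> R[i]) : Q 0 ->
  (forall n m, Q n -> Q m -> Q (n + m)) -> wiener w Q M f ->
  wiener w Q (w 0 * expR M) (fun z => cexp (f z)).
Proof.
move=> Q0 QD hf; have M0 := wiener_ge0 w1 hf.
apply: wiener_lim => e e0.
(* A number m >= B of factors meets both demands: 2M <= m for [cexp_lim], and an error of at most
   e. *)
set B := 2 * M + 10 * M ^+ 2 * expR M / e.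
have [n hn] : exists n : nat, B <= n.+1%:R.
  exists (Num.trunc B); exact/ltW/truncnS_gt.
have A0 : 0 <= 10 * M ^+ 2 * expR M by rewrite !mulr_ge0 ?expR_ge0 ?exprn_ge0.
have m0 : 0 < n.+1%:R :> R by rewrite ltr0n.
have h2 : 2 * M <= n.+1%:R.
  by rewrite (le_trans _ hn)// lerDl divr_ge0// ltW.
have h3 : 10 * M ^+ 2 * expR M / n.+1%:R <= e.
  rewrite ler_pdivrMr// -ler_pdivrMl// mulrC (le_trans _ hn)// lerDr mulr_ge0//.
exists (fun z => (1 + n.+1%:R^-1 * f z) ^+ n.+1).
  have := wienerX1 n.+1 Q0 QD (wienerZ n.+1%:R^-1 hf).
  apply: wienerS => //; rewrite ler_wpM2l ?(le_trans ler01)//.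
  have -> : normc (n.+1%:R^-1 : R[i]) = n.+1%:R^-1.
    rewrite Normc.normcV (_ : n.+1%:R = (n.+1%:R : R)%:C); last by rewrite rmorph_nat.
    by rewrite normc_RtoC ger0_norm.
  have {2}-> : M = n.+1%:R * (n.+1%:R^-1 * M) by rewrite mulrA divff ?mul1r// gt_eqF.
  rewrite expRM_natl lerXn2r ?nnegrE ?expR_ge0//.
    by rewrite addr_ge0// mulr_ge0// invr_ge0.
  exact: expR_ge1Dx.
move=> t; rewrite (le_trans _ h3)//; apply: cexp_lim => //.
exact: wiener_bounded hf.
Qed.

End ComplexExponential.

(** * A Wiener-Levy theorem for the logarithm *)

Section WienerLevy.
Variables (R : realType) (w : int -> R).
Hypothesis w1 : forall n, 1 <= w n.
Hypothesis wN : forall n, w (- n) = w n.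
Hypothesis wM : forall n m, w (n + m) <= w n * w m.
Hypothesis wlog : ln (w n%:Z) / n%:R @[n --> \oo] --> (0 : R).
Implicit Types (f g : R[i] -> R[i]) (p : tpoly R).

Let w0 n : 0 <= w n. Proof. exact: le_trans (w1 n). Qed.
Hint Resolve w0 : core.

(** Beyond some N the limit gives w(n) <= exp(en); the finitely many smaller indices are absorbed
    into [S], and negative indices follow by evenness. *)
Lemma weight_subexponential (e : R) : 0 < e ->
  exists2 C : R, 0 < C & forall n, w n <= C * expR (e * `|n|%:R).
Proof.
move=> e0; have /cvgrPdist_le /(_ _ e0) [N _ hN] := wlog.
set S := \sum_(i < N.+1) w i%:Z.
have S0 : 0 <= S by apply: sumr_ge0.
have nat_bound (n : nat) : w n <= (1 + S) * expR (e * n%:R).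
  have [nN|Nn] := leqP n N.
    apply: (@le_trans _ _ (1 + S)); last first.
      rewrite ler_peMr ?addr_ge0//.
      by rewrite -[leLHS]expR0 ler_expR mulr_ge0// ltW.
    rewrite ler_wpDl// /S (bigD1 (Ordinal (n := N.+1) (m := n) nN))//= lerDl.
    exact: sumr_ge0.
  have n0 : (0 < n)%N by exact: leq_trans Nn.
  have := hN n (ltnW Nn); rewrite /= sub0r normrN => h.
  have wpos : 0 < w n by exact: lt_le_trans (w1 n).
  have : ln (w n) <= e * n%:R.
    rewrite -ler_pdivrMr ?ltr0n//; exact: le_trans (ler_norm _) h.
  rewrite -ler_expR lnK ?posrE// => /le_trans; apply.
  by rewrite ler_peMl ?expR_ge0// lerDl.
exists (1 + S) => [|n]; first by rewrite ltr_pwDl.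
case: n => n; first exact: nat_bound.
by rewrite NegzE wN abszN; exact: nat_bound.
Qed.

Definition tp_pow p k : tpoly R := iter k (tp_mul p) [:: (1, 0)].

Lemma tp_eval_pow p k t : tp_eval (tp_pow p k) (circ t) = tp_eval p (circ t) ^+ k.
Proof.
elim: k => [|k IH]; first by rewrite tp_eval_cons tp_eval_nil /= expr0z mulr1 addr0 expr0.
by rewrite /tp_pow iterS tp_eval_mul IH exprS.
Qed.

Lemma tp_supp_pow (D : nat) p k : tp_supp (fun n => `|n| <= D)%N p ->
  tp_supp (fun n => `|n| <= D * k)%N (tp_pow p k).
Proof.
move=> hp; elim: k => [|k IH]; first by [].
apply: tp_supp_mul hp IH => n m /=; rewrite mulnS => h1 h2.
by lia.
Qed.

(** An expanded power is a list with many repeated exponents, whose [tp_norm] grows like a power of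
    that of p. Once collected it has one term per exponent, and each coefficient is controlled by
    the sup norm of the function. *)
Lemma tp_eval_reduce (D : nat) p z : tp_supp (fun n => `|n| <= D)%N p ->
  tp_eval (partial_series (tp_coef p) D) z = tp_eval p z.
Proof.
move=> /allP hp; rewrite partial_seriesE /tp_coef /tp_eval.
transitivity (\sum_(n <- zrange D) \sum_(x <- p) (if x.2 == n then x.1 * z ^ x.2 else 0)).
  apply: eq_bigr => n _; rewrite mulr_suml big_mkcond /=; apply: eq_bigr => x _.
  by case: eqP => [->|].
rewrite exchange_big /= big_seq [RHS]big_seq; apply: eq_bigr => x /hp xD.
rewrite (bigD1_seq x.2) ?mem_zrange ?zrange_uniq//= eqxx big1 ?addr0// => n.
by rewrite eq_sym => /negbTE ->.
Qed.

(** The k-th power has at most 2Dk + 1 coefficients, each at most 2 rho^k, on indices of weight at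
    most C exp(ek/2). The number of coefficients is itself at most B exp(ek/2), whence exp(ek) in
    all; [eta] and [B] are chosen for these two bounds. *)
Lemma wiener_pow_tp (D : nat) p (rho e : R) : tp_supp (fun n => `|n| <= D)%N p ->
  (forall t, normc (tp_eval p (circ t)) <= rho) -> 0 <= rho -> 0 < e ->
  exists2 C : R, 0 < C & forall k,
    wiener w xpredT (C * (expR e * rho) ^+ k) (fun z => tp_eval p z ^+ k).
Proof.
move=> hD hrho r0 e0.
have D1 : 0 < 2 * (D%:R + 1) :> R by rewrite mulr_gt0// ltr_wpDl.
set eta := e / (2 * (D%:R + 1)).
have eta0 : 0 < eta by rewrite divr_gt0.
have [C C0 hC] := weight_subexponential eta0.
have e2 : 0 < e / 2 by rewrite divr_gt0.
set B := 1 + 2 * D%:R / (e / 2).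
have B0 : 0 < B by rewrite ltr_pwDl// divr_ge0 ?mulr_ge0// ltW.
exists (2 * C * B); first by rewrite !mulr_gt0.
move=> k; set q := partial_series (tp_coef (tp_pow p k)) (D * k).
have qE t : tp_eval q (circ t) = tp_eval p (circ t) ^+ k.
  by rewrite tp_eval_reduce ?tp_eval_pow//; exact: tp_supp_pow.
apply: (wiener_ext qE); apply: (@wienerS _ w xpredT xpredT (tp_norm w q)) => //; last first.
  by apply: wiener_tp => //; exact/allP.
rewrite /tp_norm /q /partial_series big_map /=.
apply: (@le_trans _ _ (\sum_(n <- zrange (D * k)) (2 * rho ^+ k * (C * expR (e / 2 * k%:R))))).
  rewrite big_seq [leRHS]big_seq; apply: ler_sum => n; rewrite mem_zrange => nD.
  apply: ler_pM => //; first exact: normc_ge0.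
    rewrite -fourier_tp (le_trans (normc_fourier _ (integrable_tp_eval _)))// ler_wpM2l//.
    apply: norm1_T_bounded; first exact: measurable_tp_eval.
    by move=> t; rewrite tp_eval_pow normc_exp lerXn2r// nnegrE normc_ge0.
  rewrite (le_trans (hC n))// ler_pM2l// ler_expR /eta.
  apply: (@le_trans _ _ (e / (2 * (D%:R + 1)) * (D%:R * k%:R))).
    by rewrite -/eta ler_pM2l// -natrM ler_nat.
  rewrite mulrA ler_wpM2r// invfM mulrA -mulrA ler_piMr//; first exact: ltW.
  by rewrite mulrC ler_pdivrMr ?ltr_wpDl// mul1r lerDl.
rewrite big_const_seq count_predT iter_addr addr0 size_map size_iota.
rewrite -[leLHS]mulr_natr.
have h1 : (2 * (D * k)).+1%:R <= B * expR (e / 2 * k%:R).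
  apply: (@le_trans _ _ (B * (1 + e / 2 * k%:R))); last first.
    by rewrite ler_pM2l// expR_ge1Dx.
  have -> : B * (1 + e / 2 * k%:R) =
      (2 * D%:R * k%:R + 1) + (e / 2 * k%:R + 2 * D%:R / (e / 2)).
    by rewrite /B; field; rewrite gt_eqF.
  rewrite -addn1 natrD !natrM mulrA lerDl addr_ge0//.
    by rewrite mulr_ge0// ltW.
  by rewrite divr_ge0 ?mulr_ge0// ltW.
apply: (@le_trans _ _ (2 * rho ^+ k * (C * expR (e / 2 * k%:R)) * (B * expR (e / 2 * k%:R)))).
  by rewrite ler_wpM2l// !mulr_ge0 ?exprn_ge0 ?expR_ge0// ltW.
rewrite le_eqVlt; apply/orP; left; apply/eqP.
rewrite exprMn -expRM_natl.
have -> : k%:R * e = e / 2 * k%:R + e / 2 * k%:R by rewrite -mulrDl -splitr mulrC.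
by rewrite expRD; ring.
Qed.

(** Approximation in the norm of A_w, not just uniformly: in [wiener_spectral_radius] the remainder
    is multiplied by high powers of f. *)
Definition tp_approx f := forall e, 0 < e ->
  exists p, wiener w xpredT e (fun z => f z - tp_eval p z).

Lemma tp_supp_bound p : exists D : nat, tp_supp (fun n => `|n| <= D)%N p.
Proof.
exists (\max_(x <- p) `|x.2|)%N; apply/allP => x xp.
by rewrite (big_rem x xp) /= leq_maxl.
Qed.

Lemma tp_approx_wiener f : tp_approx f -> exists M, wiener w xpredT M f.
Proof.
move=> /(_ _ ltr01)[p hp]; exists (1 + tp_norm w p).
have hp' : wiener w xpredT (tp_norm w p) (tp_eval p) by apply: wiener_tp; exact/allP.
by apply: wiener_ext (wienerD hp hp') => t; rewrite subrK.
Qed.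

(** Write f = p + h with h of norm at most e. By induction on k, p^j f^k has norm at most C (rho +
    2e)^j (rho + 3e)^k, because p^j f^(k+1) = p^(j+1) f^k + h p^j f^k. The free exponent j takes the
    place of a binomial expansion. *)
Lemma wiener_spectral_radius f (rho r : R) : tp_approx f ->
  (forall t, normc (f (circ t)) <= rho) -> rho < r ->
  exists2 C, 0 < C & forall k, wiener w xpredT (C * r ^+ k) (fun z => f z ^+ k).
Proof.
move=> hf frho rhor.
have rho0 : 0 <= rho by rewrite (le_trans _ (frho 0))// normc_ge0.
pose e := (r - rho) / 4.
have e0 : 0 < e by rewrite divr_gt0// subr_gt0.
have [p hp] := hf _ e0; have [D hD] := tp_supp_bound p.
have prho t : normc (tp_eval p (circ t)) <= rho + e.
  rewrite -[tp_eval p _](subKr (f (circ t))) (le_trans (normc_subr _ _))// lerD//.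
  exact: (wiener_bounded _ t hp).
have re0 : 0 < rho + e by rewrite ltr_wpDl.
(* The rate ln x is the one for which exp(ln x) (rho + e) = rho + 2e. *)
pose x := 1 + e / (rho + e).
have x1 : 1 < x by rewrite ltrDl divr_gt0.
have lx0 : 0 < ln x by exact: ln_gt0.
have [C C0 hC] := wiener_pow_tp hD prho (ltW re0) lx0.
have thetaE : expR (ln x) * (rho + e) = rho + 2 * e.
  rewrite lnK ?posrE ?(lt_trans ltr01)// /x mulrDl mul1r divfK ?gt_eqF//; ring.
rewrite thetaE in hC.
exists C => // k.
pose h z := f z - tp_eval p z.
have main : forall k j, wiener w xpredT (C * (rho + 2 * e) ^+ j * (rho + 3 * e) ^+ k)
    (fun z => tp_eval p z ^+ j * f z ^+ k).
  elim=> [|l IH] j.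
    rewrite expr0 mulr1; apply: wiener_ext (hC j) => t; by rewrite expr0 mulr1.
  have := wienerD (IH j.+1) (wienerM w1 wM (fun _ _ _ _ => isT) hp (IH j)).
  have -> : C * (rho + 2 * e) ^+ j.+1 * (rho + 3 * e) ^+ l +
     e * (C * (rho + 2 * e) ^+ j * (rho + 3 * e) ^+ l) =
     C * (rho + 2 * e) ^+ j * (rho + 3 * e) ^+ l.+1 by rewrite !exprS; ring.
  by apply: wiener_ext => t; rewrite !exprS; ring.
have := main k 0%N; rewrite expr0 mulr1 => hk.
apply: wienerS (wiener_ext _ hk) => //; last by move=> t; rewrite expr0 mul1r.
rewrite ler_pM2l// lerXn2r ?nnegrE//.
- by rewrite addr_ge0// mulr_ge0// ltW.
- by rewrite (le_trans rho0)// ltW.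
- by rewrite /e; lra.
Qed.

Lemma is_derive_power_sum (y : R) K :
  is_derive y (1 : R) (fun t : R => \sum_(k < K) t ^+ k.+1 / k.+1%:R)
    (\sum_(k < K) y ^+ k).
Proof.
elim: K => [|K IH].
  rewrite big_ord0 (_ : (fun t : R => _) = cst 0); first exact: is_derive_cst.
  by apply/funext => t; rewrite big_ord0.
rewrite big_ord_recr /= (_ : (fun t : R => _) =
  (fun t : R => \sum_(k < K) t ^+ k.+1 / k.+1%:R) + (fun t : R => K.+1%:R^-1 * t ^+ K.+1)).
  apply: is_deriveD.
  have -> : (fun t : R => K.+1%:R^-1 * t ^+ K.+1) = K.+1%:R^-1 \*: ((@id R) ^+ K.+1).
    by apply/funext => t /=; rewrite exprfctE.
  apply: (is_derive_eq (is_deriveZ (K.+1%:R^-1 : R) (is_deriveX K.+1 (is_derive_id y (1 : R))))).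
  by rewrite -[LHS]/(K.+1%:R^-1 * (K.+1%:R * y ^+ K * 1)) mulr1 mulKf// pnatr_eq0.
by apply/funext => t; rewrite big_ord_recr /= [X in _ = X + _]/= mulrC.
Qed.

(** The difference vanishes at 0 and has derivative -y^K/(1 - y), so the mean value theorem bounds
    it. *)
Lemma ln_series_bound (x rho : R) (K : nat) : 0 <= x -> x <= rho -> rho < 1 ->
  `|ln (1 - x) + \sum_(k < K) x ^+ k.+1 / k.+1%:R| <= rho ^+ K / (1 - rho).
Proof.
move=> x0 xr r1.
pose F (y : R) := ln (1 - y) + \sum_(k < K) y ^+ k.+1 / k.+1%:R.
pose dF (y : R) := - (1 - y)^-1 + \sum_(k < K) y ^+ k.
have dFE y : y < 1 -> dF y = - (y ^+ K / (1 - y)).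
  move=> y1; have y10 : 1 - y != 0 by rewrite subr_eq0 gt_eqF.
  apply: (mulfI y10); rewrite /dF mulrDr mulrN divff// mulrN mulrCA divff// mulr1.
  have := subrX1 y K; rewrite -[y - 1]opprB mulNr => h.
  by rewrite -[(1 - y) * _]opprK -h; ring.
have hd (y : R) : y < 1 -> is_derive y (1 : R) F (dF y).
  move=> y1; rewrite /F /dF; apply: is_deriveD; last exact: is_derive_power_sum.
  have y10 : 0 < 1 - y by rewrite subr_gt0.
  have := @is_derive1_comp _ (@ln R) (fun t => 1 - t) y _ _
    (is_derive1_ln y10) (is_deriveB (is_derive_cst (1 : R) y (1 : R)) (is_derive_id y (1 : R))).
  by rewrite sub0r mulrN1.
have cF : {within `[0, x], continuous F}.
  apply: derivable_within_continuous => y; rewrite in_itv /= => /andP[_ yx].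
  by case: (hd y) => //; lra.
have [|c + hc] := @MVT_segment R F dF 0 x x0 _ cF.
  by move=> y; rewrite in_itv /= => /andP[_ yx]; apply: hd; lra.
rewrite in_itv /= => /andP[c0 cx].
have F0 : F 0 = 0.
  rewrite /F subr0 ln1 add0r big1// => k _; by rewrite expr0n /= mul0r.
move: hc; rewrite F0 !subr0 -/(F x) => ->.
rewrite dFE; last by lra.
have h : 0 <= c ^+ K / (1 - c) by apply: divr_ge0; [exact: exprn_ge0|lra].
rewrite normrM normrN (ger0_norm h).
rewrite (ger0_norm x0) -[leRHS]mulr1 ler_pM//.
- apply: ler_pM; [exact: exprn_ge0|by rewrite invr_ge0; lra| |].
    by rewrite lerXn2r ?nnegrE//; lra.
  by rewrite lef_pV2 ?posrE; lra.
- by lra.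
Qed.

Lemma geometric_sum_le (r : R) K : 0 <= r -> r < 1 -> \sum_(k < K) r ^+ k.+1 <= (1 - r)^-1.
Proof.
move=> r0 r1; have r10 : 0 < 1 - r by rewrite subr_gt0.
rewrite -[leRHS]mul1r ler_pdivlMr//.
have h := subrX1 r K.
apply: (@le_trans _ _ (r * (1 - r ^+ K))).
  rewrite -[1 - r ^+ K]opprB h -mulNr opprB mulrCA mulrC ler_wpM2l//; first exact: ltW.
  by rewrite mulr_sumr; apply: ler_sum => k _; rewrite exprS.
have := exprn_ge0 K r0; nra.
Qed.

(** The partial sums of the logarithmic series converge uniformly, and with r strictly between rho
    and 1 the spectral radius bound keeps their norms below C/(1 - r). *)
Lemma wiener_ln f (rho : R) : tp_approx f -> rho < 1 ->
  (forall t, f (circ t) = (Re (f (circ t)))%:C /\ 0 <= Re (f (circ t)) <= rho) ->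
  exists M, wiener w xpredT M (fun z => (ln (1 - Re (f z)))%:C).
Proof.
move=> hf rho1 frho.
have rho0 : 0 <= rho by have [_ /andP[h1 h2]] := frho 0; exact: le_trans h2.
have fb t : normc (f (circ t)) <= rho.
  have [-> /andP[h1 h2]] := frho t.
  by rewrite normc_RtoC ger0_norm.
pose r := (1 + rho) / 2.
have r1 : r < 1 by rewrite /r; lra.
have r0 : 0 <= r by rewrite /r; lra.
have rhor : rho < r by rewrite /r; lra.
have [C C0 hC] := wiener_spectral_radius hf fb rhor.
exists (C / (1 - r)); apply: wiener_lim => e e0.
have [K hK] : exists K, rho ^+ K / (1 - rho) <= e.
  have er : 0 < e * (1 - rho) by rewrite mulr_gt0// subr_gt0.
  have : rho ^+ n @[n --> \oo] --> (0 : R) by apply: cvg_expr; rewrite ger0_norm.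
  move/cvgrPdist_le => /(_ _ er)[K _ /(_ K (leqnn _))] /=.
  rewrite sub0r normrN => h; exists K; rewrite ler_pdivrMr ?subr_gt0//.
  exact: le_trans (ler_norm _) h.
exists (fun z => \sum_(k < K) - (k.+1%:R^-1) * f z ^+ k.+1); last first.
  move=> t; have [fE /andP[f0 fr]] := frho t.
  have := ln_series_bound K f0 fr rho1; set x := Re (f (circ t)) in fE f0 fr *.
  move=> /le_trans /(_ hK); apply: le_trans.
  rewrite fE -/x (_ : _ - _ = (- (ln (1 - x) + \sum_(k < K) x ^+ k.+1 / k.+1%:R))%:C).
    by rewrite normc_RtoC normrN.
  rewrite rmorphN rmorphD /= opprD addrC rmorph_sum -sumrN; congr (_ + _).
  apply: eq_bigr => k _; rewrite rmorphM rmorphXn fmorphV rmorph_nat /=.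
  by rewrite mulNr mulrC.
have h := wiener_sum K (fun k => wienerZ (- (k.+1%:R^-1)) (hC k.+1)).
apply: wienerS h => //.
apply: (@le_trans _ _ (\sum_(k < K) C * r ^+ k.+1)).
  apply: ler_sum => k _; rewrite normc_opp Normc.normcV.
  rewrite (_ : k.+1%:R = (k.+1%:R : R)%:C); last by rewrite rmorph_nat.
  rewrite normc_RtoC ger0_norm// ler_piMl ?mulr_ge0 ?exprn_ge0//; first exact: ltW.
  by rewrite invf_le1 ?ltr0n// ler1n.
by rewrite -mulr_sumr ler_wpM2l ?geometric_sum_le// ltW.
Qed.

Lemma tp_approxD f g : tp_approx f -> tp_approx g -> tp_approx (fun z => f z + g z).
Proof.
move=> hf hg e e0; have e2 : 0 < e / 2 by rewrite divr_gt0.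
have [p hp] := hf _ e2; have [q hq] := hg _ e2.
exists (p ++ q); rewrite [e]splitr.
by apply: wiener_ext (wienerD hp hq) => t; rewrite tp_eval_cat; ring.
Qed.

Lemma tp_approx_tp p : tp_approx (tp_eval p).
Proof.
move=> e e0; exists p => x x0; exists [::]; split => //.
  by rewrite /tp_norm big_nil ltW.
by move=> t; rewrite tp_eval_nil !subrr Normc.normc0 ltW.
Qed.

Lemma tp_approx_ext f g : (forall t, f (circ t) = g (circ t)) ->
  tp_approx f -> tp_approx g.
Proof.
by move=> fg hf e /hf[p hp]; exists p; apply: wiener_ext hp => t; rewrite fg.
Qed.

Lemma tp_approx_cst c : tp_approx (fun=> c).
Proof.
apply: tp_approx_ext (tp_approx_tp [:: (c, 0)]) => t.
by rewrite tp_eval_cons tp_eval_nil /= expr0z mulr1 addr0.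
Qed.

Lemma tp_approxM f g : tp_approx f -> tp_approx g -> tp_approx (fun z => f z * g z).
Proof.
move=> hf hg e e0; have e2 : 0 < e / 2 by rewrite divr_gt0.
have [M hM] := tp_approx_wiener hf; have M0 := wiener_ge0 w1 hM.
have M1 : 0 < M + 1 by rewrite ltr_wpDl.
have [q hq] := hg _ (divr_gt0 e2 M1).
have Nq0 := tp_norm_ge0 q w1.
have Nq1 : 0 < tp_norm w q + 1 by rewrite ltr_wpDl.
have [p hp] := hf _ (divr_gt0 e2 Nq1).
have hqq : wiener w xpredT (tp_norm w q) (tp_eval q) by apply: wiener_tp; exact/allP.
exists (tp_mul p q).
have h1 := wienerM w1 wM (fun _ _ _ _ => isT) hM hq.
have h2 := wienerM w1 wM (fun _ _ _ _ => isT) hp hqq.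
apply: wienerS (wiener_ext _ (wienerD h1 h2)) => //; last first.
  by move=> t; rewrite tp_eval_mul; ring.
rewrite [leRHS]splitr lerD//.
  by rewrite mulrA ler_pdivrMr// mulrC ler_wpM2l ?lerDl// ltW.
by rewrite mulrAC ler_pdivrMr// ler_wpM2l ?lerDl// ltW.
Qed.

Lemma tp_approx_conj f : tp_approx f -> tp_approx (fun z => Num.conj (f z)).
Proof.
move=> hf e /hf[p hp]; exists (tp_conj p).
by apply: wiener_ext (wiener_conj wN hp) => t; rewrite tp_eval_conj rmorphB.
Qed.

Lemma wiener_ln_1Dsqr f : tp_approx f ->
  exists M, wiener w xpredT M (fun z => (ln (1 + normc (f z) ^+ 2))%:C).
Proof.
move=> hf; have [M hM] := tp_approx_wiener hf; have M0 := wiener_ge0 w1 hM.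
(* V dominates 1 + |f|^2, so g = 1 - (1 + |f|^2)/V takes values in [0, 1 - 1/V] on the circle, and
   ln(1 + |f|^2) = ln V + ln(1 - g). *)
pose V := 1 + M ^+ 2; have V0 : 0 < V by rewrite ltr_pwDl// sqr_ge0.
pose g z := 1 + (- (V^-1)%:C) * (1 + f z * Num.conj (f z)).
have hg : tp_approx g.
  apply: tp_approxD; first exact: tp_approx_cst.
  apply: tp_approxM; first exact: tp_approx_cst.
  apply: tp_approxD; first exact: tp_approx_cst.
  by apply: tp_approxM => //; exact: tp_approx_conj.
have gE z : g z = (1 - (1 + normc (f z) ^+ 2) / V)%:C.
  rewrite /g mulz_conj -(rmorph1 (real_complex R)) -!rmorphD -rmorphN -rmorphM -rmorphD.
  by rewrite mulNr mulrC.
have rho1 : 1 - V^-1 < 1 by rewrite ltrBlDr ltrDl invr_gt0.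
have [|L hL] := wiener_ln hg rho1.
  move=> t; rewrite gE; split => //=.
  have fM : normc (f (circ t)) ^+ 2 <= M ^+ 2.
    by rewrite lerXn2r ?nnegrE ?normc_ge0//; exact: wiener_bounded hM.
  rewrite subr_ge0 ler_pdivrMr// mul1r lerD2l fM /= lerB//.
  by rewrite -[leLHS]mul1r ler_pM2r ?invr_gt0// lerDl sqr_ge0.
have hc := wiener_cst w (ln V)%:C (isT : xpredT 0).
exists (normc (ln V)%:C * w 0 + L).
apply: wiener_ext (wienerD hc hL) => t.
rewrite gE /= subKr -rmorphD /=; congr (_%:C).
have f1 : 0 < 1 + normc (f (circ t)) ^+ 2 by rewrite ltr_pwDl// sqr_ge0.
by rewrite lnM ?posrE ?invr_gt0// lnV ?posrE// addrCA subrr addr0.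
Qed.

End WienerLevy.

(** * Poisson integrals and boundary values *)

Section PoissonKernel.
Variable R : realType.
Implicit Types (f : R[i] -> R[i]) (r s t : R).

Definition herglotz f (z : R[i]) := integral_T (fun u => (u + z) / (u - z) * f u).

Lemma tp_norm_cons (w : int -> R) c n (p : tpoly R) :
  tp_norm w ((c, n) :: p) = normc c * w n + tp_norm w p.
Proof. exact: big_cons. Qed.

(** The expansion (u + z)/(u - z) = 1 + 2 sum (z/u)^k over k >= 1, cut after k = K, as a polynomial
    in 1/u. *)
Fixpoint herglotz_kernel_trunc (z : R[i]) (K : nat) : tpoly R :=
  if K is k.+1 then (2 * z ^+ k.+1, - (k.+1%:Z)) :: herglotz_kernel_trunc z k
  else [:: (1, 0)].

Lemma circ_sub_neq0 (z : R[i]) t : normc z < 1 -> circ t - z != 0.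
Proof.
by move=> z1; rewrite subr_eq0; apply: contraTneq z1 => <-; rewrite normc_circ ltxx.
Qed.

Lemma normc_circ_sub (z : R[i]) t : 1 - normc z <= normc (circ t - z).
Proof. by rewrite -[X in X - _](normc_circ t) normc_lerB. Qed.

Lemma herglotz_kernelE (z : R[i]) K t : normc z < 1 ->
  (circ t + z) / (circ t - z) = tp_eval (herglotz_kernel_trunc z K) (circ t) +
     2 * (z / circ t) ^+ K * (z / (circ t - z)).
Proof.
move=> z1; have u0 := circ_neq0 t; have uz := circ_sub_neq0 t z1.
elim: K => [|K IH]; rewrite /= tp_eval_cons /=.
  by rewrite tp_eval_nil expr0z expr0; field.
have -> : 2 * z ^+ K.+1 * circ t ^ (- K.+1%:Z) = 2 * (z / circ t) ^+ K * (z / circ t).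
  by rewrite -exprnN -exprVn -mulrA -exprMn -mulrA -exprSr.
rewrite IH exprSr; set x := (z / circ t) ^+ K; set y := tp_eval _ _.
by field; apply/andP.
Qed.

Lemma herglotz_kernel_rest (z : R[i]) K t : normc z < 1 ->
  normc (2 * (z / circ t) ^+ K * (z / (circ t - z))) <=
  2 * normc z ^+ K.+1 / (1 - normc z).
Proof.
move=> z1; rewrite !Normc.normcM normc_exp Normc.normcM !Normc.normcV normc_circ invr1 mulr1.
have -> : normc (2 : R[i]) = 2.
  by rewrite (_ : 2 = (2 : R)%:C) ?normc_RtoC ?ger0_norm// rmorph_nat.
rewrite exprSr !mulrA ler_wpM2l//; last first.
  have h : 0 < 1 - normc z by rewrite subr_gt0.
  by rewrite lef_pV2 ?posrE ?(lt_le_trans h)// normc_circ_sub.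
by rewrite !mulr_ge0 ?exprn_ge0 ?normc_ge0.
Qed.

Lemma fourier0 f : fourier f 0 = integral_T f.
Proof. by apply: integral_T_ext => t; rewrite oppr0 expr0z mulr1. Qed.

(** With the trivial weight 1, the truncated expansions give boundedness and measurability of the
    kernel at once. *)
Lemma wiener_herglotz_kernel (z : R[i]) : normc z < 1 ->
  wiener (fun=> 1) xpredT (1 + 2 / (1 - normc z)) (fun u => (u + z) / (u - z)).
Proof.
move=> z1 e e0; have z0 := normc_ge0 z; have h0 : 0 < 1 - normc z by rewrite subr_gt0.
have [K hK] : exists K, normc z ^+ K <= e * (1 - normc z) / 2.
  have er : 0 < e * (1 - normc z) / 2 by rewrite divr_gt0// mulr_gt0.
  have : normc z ^+ n @[n --> \oo] --> (0 : R) by apply: cvg_expr; rewrite ger0_norm.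
  move/cvgrPdist_le => /(_ _ er)[K _ /(_ K (leqnn _))] /=.
  rewrite sub0r normrN => h; exists K; exact: le_trans (ler_norm _) h.
exists (herglotz_kernel_trunc z K); split; first exact/allP.
  have -> : tp_norm (fun=> 1) (herglotz_kernel_trunc z K) =
      1 + 2 * \sum_(k < K) normc z ^+ k.+1.
    elim: K {hK} => [|k IH]; rewrite [herglotz_kernel_trunc _ _]/= tp_norm_cons.
      by rewrite /tp_norm big_nil big_ord0 mulr0 !addr0 Normc.normc1 mulr1.
    rewrite IH big_ord_recr [in RHS]/= Normc.normcM normc_exp mulr1.
    have -> : normc (2 : R[i]) = 2.
      by rewrite (_ : 2 = (2 : R)%:C) ?normc_RtoC ?ger0_norm// rmorph_nat.
    by ring.
  by rewrite lerD2l ler_pM2l// geometric_sum_le.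
move=> t; rewrite (herglotz_kernelE K t z1) opprD addrA subrr add0r normc_opp.
rewrite (le_trans (herglotz_kernel_rest K t z1))// ler_pdivrMr// mulrC -ler_pdivlMr//.
by rewrite (le_trans _ hK)// exprSr ler_piMr ?exprn_ge0// ltW.
Qed.

Lemma measurable_herglotz_kernel (z : R[i]) : normc z < 1 ->
  measurable_T (fun u => (u + z) / (u - z)).
Proof.
move=> z1.
suff : wiener (fun=> 1) xpredT (1 + 2 / (1 - normc z)) (fun u => (u + z) / (u - z)).
  exact: measurable_wiener.
exact: wiener_herglotz_kernel.
Qed.

Lemma integrable_herglotz f (z : R[i]) : normc z < 1 -> integrable_T f ->
  integrable_T (fun u => (u + z) / (u - z) * f u).
Proof.
move=> z1; apply: integrable_TM; first exact: measurable_herglotz_kernel.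
by move=> t; apply: wiener_bounded (wiener_herglotz_kernel z1).
Qed.

Lemma herglotz_kernel_fourier f (z : R[i]) K : integrable_T f ->
  fourier (fun u => tp_eval (herglotz_kernel_trunc z K) u * f u) 0 =
  fourier f 0 + 2 * \sum_(k < K) z ^+ k.+1 * fourier f k.+1%:Z.
Proof.
move=> hf; rewrite fourier_tp_mul//.
elim: K => [|K IH]; rewrite [herglotz_kernel_trunc _ _]/= big_cons [(_, _).1]/= [(_, _).2]/=.
  by rewrite big_nil big_ord0 mulr0 !addr0 mul1r.
by rewrite IH big_ord_recr /= sub0r opprK; ring.
Qed.

Lemma herglotz_series f (z : R[i]) K : normc z < 1 -> integrable_T f ->
  normc (herglotz f z - (fourier f 0 + 2 * \sum_(k < K) z ^+ k.+1 * fourier f k.+1%:Z))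
  <= 2 * (2 * normc z ^+ K.+1 / (1 - normc z) * norm1_T f).
Proof.
move=> z1 hf; have hp := tp_integrableM (herglotz_kernel_trunc z K) hf.
rewrite -herglotz_kernel_fourier// fourier0 -integral_TB//; last exact: integrable_herglotz.
have hb := integrable_TB (integrable_herglotz z1 hf) hp.
rewrite (le_trans (normc_integral_T hb))// ler_wpM2l//.
apply: le_norm1_T => // t.
rewrite (herglotz_kernelE K t z1) mulrDl addrAC subrr add0r Normc.normcM.
by rewrite ler_wpM2r ?normc_ge0// herglotz_kernel_rest.
Qed.

(** The expansion in powers of z involves only coefficients of index >= 0. This yields both the mean
    1 of the Poisson kernel and the uniqueness of Fourier coefficients. *)
Lemma herglotz_eq f (z c : R[i]) : normc z < 1 -> integrable_T f ->
  fourier f 0 = c -> (forall k : nat, fourier f k.+1%:Z = 0) -> herglotz f z = c.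
Proof.
move=> z1 hf f0 fk; apply/eqP; rewrite -subr_eq0; apply/eqP/Normc.eq0_normc.
apply/le_anti/andP; split; last exact: normc_ge0.
have z0 := normc_ge0 z; have h0 : 0 < 1 - normc z by rewrite subr_gt0.
have : 4 / (1 - normc z) * norm1_T f * normc z ^+ n @[n --> \oo] -->
    4 / (1 - normc z) * norm1_T f * 0.
  by apply: cvgM; [exact: cvg_cst|apply: cvg_expr; rewrite ger0_norm].
rewrite mulr0 => hlim; rewrite -(cvg_lim _ hlim)//.
apply: limr_ge; first by apply: cvgP hlim.
apply: nearW => K.
have := herglotz_series K z1 hf; rewrite f0 big1 ?mulr0 ?addr0; last first.
  by move=> k _; rewrite fk mulr0.
move=> /le_trans; apply.
rewrite exprSr -!mulrA; set N := norm1_T f.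
have N0 : 0 <= N by exact: norm1_T_ge0.
rewrite [leLHS](_ : _ = 4 * ((1 - normc z)^-1 * (N * normc z ^+ K)) * normc z); last by ring.
rewrite ler_piMr//; last exact: ltW.
by rewrite !mulr_ge0 ?invr_ge0 ?exprn_ge0// ltW.
Qed.

Definition poisson r t s : R := (1 - r ^+ 2) / (1 - 2 * r * cos (2 * pi * (t - s)) + r ^+ 2).

Lemma poisson_sym r t s : poisson r t s = poisson r s t.
Proof. by rewrite /poisson -[t - s]opprB mulrN cosN. Qed.

Lemma sqr_normc_circ_sub r t s :
  normc (circ s - r%:C * circ t) ^+ 2 = 1 - 2 * r * cos (2 * pi * (t - s)) + r ^+ 2.
Proof.
rewrite sqr_normcE /= mulrBr cosB !mul0r !subr0 !addr0.
have h1 := cos2Dsin2 (2 * pi * t); have h2 := cos2Dsin2 (2 * pi * s).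
set ct := cos (2 * pi * t) in h1 *; set st := sin (2 * pi * t) in h1 *.
set cs := cos (2 * pi * s) in h2 *; set ss := sin (2 * pi * s) in h2 *.
transitivity ((cs ^+ 2 + ss ^+ 2) - 2 * r * (ct * cs + st * ss) + r ^+ 2 * (ct ^+ 2 + st ^+ 2)).
  by ring.
by rewrite h1 h2 mulr1.
Qed.

Lemma normc_rcirc r t : 0 <= r -> normc (r%:C * circ t) = r.
Proof. by move=> r0; rewrite Normc.normcM normc_circ mulr1 normc_RtoC ger0_norm. Qed.

Lemma poisson_den_gt0 r t s : 0 <= r < 1 ->
  0 < 1 - 2 * r * cos (2 * pi * (t - s)) + r ^+ 2.
Proof.
move=> /andP[r0 r1]; rewrite -sqr_normc_circ_sub exprn_gt0//.
by rewrite (lt_le_trans _ (normc_circ_sub _ _))// normc_rcirc// subr_gt0.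
Qed.

Lemma poisson_ge0 r t s : 0 <= r < 1 -> 0 <= poisson r t s.
Proof.
move=> r01; have h := poisson_den_gt0 t s r01; move: r01 => /andP[r0 r1].
by rewrite divr_ge0 ?ltW// subr_gt0 expr_lt1.
Qed.

Lemma poisson_le r t s : 0 <= r < 1 -> poisson r t s <= 2 / (1 - r).
Proof.
move=> r01; have h := poisson_den_gt0 t s r01; move: (r01) => /andP[r0 r1].
have r10 : 0 < 1 - r by rewrite subr_gt0.
rewrite ler_pdivrMr// mulrAC ler_pdivlMr// -sqr_normc_circ_sub.
have : (1 - r) ^+ 2 <= normc (circ s - r%:C * circ t) ^+ 2.
  have := normc_circ_sub (r%:C * circ t) s; rewrite normc_rcirc// => h2.
  by rewrite lerXn2r ?nnegrE ?normc_ge0// ltW.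
by nra.
Qed.

Lemma Re_mulr_real (x : R[i]) (c : R) : Re (x * c%:C) = Re x * c.
Proof. by rewrite ReM mulr0 subr0. Qed.

Lemma Re_herglotz_kernel r t s : 0 <= r < 1 ->
  Re ((circ s + r%:C * circ t) / (circ s - r%:C * circ t)) = poisson r t s.
Proof.
move=> r01; have h := poisson_den_gt0 t s r01.
move: (r01) => /andP[r0 r1].
set u := circ s; set z := r%:C * circ t.
have uz : u - z != 0 by apply: circ_sub_neq0; rewrite normc_rcirc.
have -> : (u + z) / (u - z) = (u + z) * Num.conj (u - z) * ((normc (u - z) ^+ 2)^-1)%:C.
  have -> : ((normc (u - z) ^+ 2)^-1)%:C = ((normc (u - z) ^+ 2)%:C)^-1.
    exact: fmorphV.
  rewrite -mulz_conj invfM mulrACA divff ?mulr1//.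
  by rewrite conjC_eq0.
rewrite sqr_normc_circ_sub Re_mulr_real; congr (_ / _).
rewrite ReM !ReD Re_conj ReD ReN Im_conj !ImD ImN.
transitivity (normc u ^+ 2 - normc z ^+ 2); last first.
  by rewrite normc_circ normc_rcirc// expr1n.
by rewrite !sqr_normcE; ring.
Qed.

End PoissonKernel.

(** * Poisson integrals of integrable functions *)

Section PoissonIntegral.
Variable R : realType.
Local Notation I01 := (`[0%R, 1%R]%classic : set R).
Local Notation leb := (@lebesgue_measure R).
Implicit Types (r s t : R) (u v : R -> R).
Hint Extern 0 (measurable _) => exact: measurable01 : core.

Definition poisson_int r v t := int01 (fun s => poisson r t s * v s).

Lemma int01_poisson r t : 0 <= r < 1 -> int01 (poisson r t) = 1.
Proof.
move=> r01; move: (r01) => /andP[r0 r1].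
have z1 : normc (r%:C * circ t) < 1 by rewrite normc_rcirc.
have := herglotz_eq z1 (@integrable_T_cst R 1) (@fourier1 R 0) (fun k => @fourier1 R k.+1%:Z).
move=> h; transitivity (Re (herglotz (fun=> 1) (r%:C * circ t))); last by rewrite h.
rewrite /herglotz integral_TE -[RHS]/(int01 _); apply: eq_int01 => s _.
by rewrite mulr1 Re_herglotz_kernel.
Qed.

Lemma continuous_poisson_profile r : 0 <= r < 1 ->
  continuous (fun x : R => (1 - r ^+ 2) / (1 - 2 * r * cos (2 * pi * x) + r ^+ 2)).
Proof.
move=> r01 x; apply: cvgM; first exact: cvg_cst.
apply: cvgV.
  by have := poisson_den_gt0 x 0 r01; rewrite subr0 => /gt_eqF ->.
apply: cvgD; last exact: cvg_cst.
apply: cvgB; first exact: cvg_cst.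
apply: cvgM; first exact: cvg_cst.
have := @continuous_linear_comp R (2 * pi) (@cos R) (@continuous_cos R).
exact.
Qed.

Lemma measurable_poisson2 r : 0 <= r < 1 ->
  measurable_fun [set: R * R] (fun p : R * R => poisson r p.1 p.2).
Proof.
move=> r01; have := continuous_measurable_fun (continuous_poisson_profile r01).
move=> h; apply: (measurableT_comp h).
by apply: measurable_funB; [exact: measurable_fst|exact: measurable_snd].
Qed.

Lemma measurable_poisson r t : 0 <= r < 1 -> measurable_fun I01 (poisson r t).
Proof.
move=> r01; apply: measurable_funTS.
have := continuous_measurable_fun (continuous_poisson_profile r01) => h.
by apply: (measurableT_comp h); apply: measurable_funB; [exact: measurable_cst|exact: measurable_id].
Qed.

Lemma integrable_poisson r t v : 0 <= r < 1 -> integrable01 v ->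
  integrable01 (fun s => poisson r t s * v s).
Proof.
move=> r01 hv; apply: integrable01_le
   (integrable01Z (2 / (1 - r)) (integrable01_norm hv)).
  by apply: measurable_funM; [exact: measurable_poisson|exact: integrable01_measurable].
move=> s _; rewrite normrM ler_wpM2r// ger0_norm ?poisson_ge0//.
exact: poisson_le.
Qed.

Lemma poisson_intB r u v t : 0 <= r < 1 -> integrable01 u -> integrable01 v ->
  poisson_int r (fun s => u s - v s) t = poisson_int r u t - poisson_int r v t.
Proof.
move=> r01 hu hv; rewrite -int01B; [|exact: integrable_poisson..].
by apply: eq_int01 => s _; rewrite mulrBr.
Qed.

(** By Tonelli: the kernel is symmetric and has mean 1, so integrating over t first returns v. The
    functions are cut off to 0 outside [0, 1] because Tonelli is applied on the whole plane. *)
Lemma poisson_int_nneg r v : 0 <= r < 1 -> (forall t, I01 t -> 0 <= v t) ->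
  integrable01 v ->
  measurable_fun I01 (poisson_int r v) /\
  (\int[leb]_(t in I01) (poisson_int r v t)%:E = (int01 v)%:E)%E.
Proof.
move=> r01 v0 hv.
pose v' := v \_ I01.
have v'0 s : 0 <= v' s.
  by rewrite /v' patchE; case: ifPn => // /set_mem; exact: v0.
have mv' : measurable_fun [set: R] v'.
  exact: (@measurable_restrictT _ _ _ _ I01 v (@measurable01 R)).1 (integrable01_measurable hv).
have i0 t : 0 <= \1_I01 t :> R by rewrite indicE.
have mi : measurable_fun [set: R] (\1_I01 : R -> R) by exact: measurable_indic.
pose f := fun p : R * R => (poisson r p.1 p.2 * v' p.2 * \1_I01 p.1)%:E.
have mf : measurable_fun [set: R * R] f.
  apply/measurable_EFinP; apply: measurable_funM.
    apply: measurable_funM; first exact: measurable_poisson2.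
    by apply: (measurableT_comp mv'); exact: measurable_snd.
  by apply: (measurableT_comp mi); exact: measurable_fst.
have f0 p : (0 <= f p)%E by rewrite lee_fin; apply: mulr_ge0 => //; apply: mulr_ge0 => //; exact: poisson_ge0.
have FE t : I01 t -> (\int[leb]_s f (t, s) = (poisson_int r v t)%:E)%E.
  move=> It; rewrite EFin_int01; last exact: integrable_poisson.
  rewrite [RHS]integral_mkcond; apply: eq_integral => s _.
  rewrite /f /v' /= indicE (mem_set It) mulr1 !patchE; case: ifP => //.
  by rewrite mulr0.
split.
  apply/measurable_EFinP.
  have := measurable_fun_fubini_tonelli_F (m2 := leb) f mf f0.
  move=> /(measurable_funS measurableT (@subsetT _ I01)).
  by apply: eq_measurable_fun => t /set_mem It; rewrite /fubini_F FE.
transitivity (\int[leb]_t \int[leb]_s f (t, s))%E.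
  rewrite integral_mkcond; apply: eq_integral => t _; rewrite patchE.
  case: ifPn => It; first by rewrite FE//; exact: set_mem It.
  rewrite (eq_integral (fun=> 0%E)) ?integral0// => s _.
  by rewrite /f /= indicE (negbTE It) mulr0.
have -> := @fubini_tonelli _ _ _ _ R leb leb f mf f0.
rewrite EFin_int01// [RHS]integral_mkcond; apply: eq_integral => s _.
rewrite patchE; case: ifPn => Is; last first.
  rewrite (eq_integral (fun=> 0%E)) ?integral0// => t _.
  by rewrite /f /v' /= patchE (negbTE Is) mulr0 mul0r.
have hp := measurable_poisson s r01.
have ip : integrable01 (poisson r s).
  apply: (@integrable01_bounded _ (2 / (1 - r))) => // t _.
  by rewrite ger0_norm ?poisson_ge0// poisson_le.
rewrite -[v s]mulr1 -(int01_poisson s r01) -int01Z// EFin_int01; last exact: integrable01Z.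
rewrite [RHS]integral_mkcond; apply: eq_integral => t _.
rewrite /f /v' /= patchE indicE [RHS]patchE Is poisson_sym mulrC.
by case: ifP => It; rewrite ?mul0r// mul1r mulrC.
Qed.

(** The infimum of |d_k| over k >= K has integral 0, so for almost every t the values d_k(t) come
    arbitrarily near 0 infinitely often. This is weaker than a.e. convergence, but enough where a
    limit is known to exist or the approximants are explicit. *)
Lemma int01_small_ae (d : nat -> R -> R) :
  (forall k, integrable01 (d k)) ->
  (forall e, 0 < e -> exists K : nat, forall k, (K <= k)%N ->
     int01 (fun t => `|d k t|) <= e) ->
  ae01 (fun t => forall K e, 0 < e -> exists2 k : nat, (K <= k)%N & `|d k t| < e).
Proof.
move=> hd hlim.
pose D k t := (`|d k t|)%:E.
have mD k : measurable_fun I01 (D k).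
  by apply/measurable_EFinP; exact: integrable01_measurable (integrable01_norm (hd k)).
pose g K t := einfs (D^~ t) K.
have mg K : measurable_fun I01 (g K) by exact: measurable_fun_einfs.
have g0 K t : (0 <= g K t)%E.
  by apply: le_ereal_inf_tmp => y [k _ <-]; rewrite lee_fin.
have gD K k t : (K <= k)%N -> (g K t <= D k t)%E.
  by move=> Kk; apply: ereal_inf_lbound; exists k.
have gint K : (\int[leb]_(t in I01) g K t = 0)%E.
  apply/le_anti/andP; split; last by apply: integral_ge0 => t _.
  apply/lee_addgt0Pr => e e0; rewrite add0e.
  have [K' hK'] := hlim _ e0.
  have {hK'} := hK' (maxn K K') (leq_maxr _ _).
  rewrite -lee_fin EFin_int01; last exact: integrable01_norm.
  apply: le_trans; apply: ge0_le_integral => //.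
  - exact: mg.
  - exact: (mD (maxn K K')).
  - by move=> t _; apply: gD; exact: leq_maxl.
have gae K : ae01 (fun t => g K t = 0%E).
  have : (\int[leb]_(t in I01) `|g K t| = 0)%E.
    by under eq_integral do rewrite gee0_abs//.
  move/(ae_eq_integral_abs leb (@measurable01 R) (mg K)).
  by rewrite /ae01; apply: filterS => t h It; exact: h.
apply: ae01_mono (ae01_bigand gae) => t It h K e e0.
have : (g K t < e%:E)%E by rewrite h lte_fin.
rewrite /g /einfs => /ereal_inf_lt[y [k /= Kk <-] ky].
by exists k => //; rewrite -lte_fin.
Qed.

Lemma poisson_int_contraction r v : 0 <= r < 1 -> integrable01 v ->
  integrable01 (poisson_int r v) /\
  int01 (fun t => `|poisson_int r v t|) <= int01 (fun t => `|v t|).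
Proof.
move=> r01 hv; have hnv := integrable01_norm hv.
have [m1 e1] := poisson_int_nneg r01 (fun t _ => normr_ge0 (v t)) hnv.
have p0 t : 0 <= poisson_int r (fun s => `|v s|) t.
  by apply: int01_ge0 => s _; rewrite mulr_ge0// poisson_ge0.
(* A signed v is the difference of the nonnegative functions |v| + v and |v|, which gives
   measurability of its Poisson integral. *)
have hsum : integrable01 (fun t => `|v t| + v t) by exact: integrable01D.
have [m2 _] : measurable_fun I01 (poisson_int r (fun s => `|v s| + v s)) /\ True.
  split=> //; have [] := poisson_int_nneg r01 _ hsum => // t _.
  by rewrite -[X in _ + X]opprK subr_ge0 -normrN ler_norm.
have m : measurable_fun I01 (poisson_int r v).
  apply: eq_measurable_fun (measurable_funB m2 m1) => t _.
  rewrite /= -poisson_intB//; apply: eq_int01 => s _; congr (_ * _).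
  by rewrite addrAC subrr add0r.
have i1 : integrable01 (poisson_int r (fun s => `|v s|)).
  apply/integrableP; split; first exact/measurable_EFinP.
  by under eq_integral do rewrite /= ger0_norm//; rewrite e1 ltry.
have le1 t : `|poisson_int r v t| <= poisson_int r (fun s => `|v s|) t.
  rewrite (le_trans (ler_norm_int01 (integrable_poisson t r01 hv)))//.
  apply: le_int01.
  - by apply: integrable01_norm; exact: integrable_poisson.
  - exact: integrable_poisson.
  - by move=> s _; rewrite normrM ger0_norm// poisson_ge0.
have i2 : integrable01 (poisson_int r v).
  by apply: integrable01_le m _ i1 => t _; exact: le1.
split=> //; apply: (@le_trans _ _ (int01 (poisson_int r (fun s => `|v s|)))).
  apply: le_int01 => //; exact: integrable01_norm.
by rewrite -lee_fin EFin_int01// e1.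
Qed.

(** The parameters 0 and 1 are the same point of the circle, so distance of parameters controls
    distance on the circle only at interior t; this is why [dd] also stays below t and 1 - t. *)
Lemma circ_far (t d : R) : 0 < t < 1 -> 0 < d ->
  exists2 h : R, 0 < h & forall s, I01 s -> d <= `|s - t| ->
    h <= normc (circ s - circ t) ^+ 2.
Proof.
move=> /andP[t0 t1] d0.
pose dd := Num.min (Num.min d (2^-1)) (Num.min t (1 - t)).
have dd0 : 0 < dd by rewrite !lt_min d0 t0 subr_gt0 t1 invr_gt0 ltr0n.
have ddh : dd <= 2^-1 by rewrite !ge_min lexx orbT.
have ddt : dd <= t by rewrite !ge_min lexx !orbT.
have ddt1 : dd <= 1 - t by rewrite !ge_min lexx !orbT.
have ddd : dd <= d by rewrite !ge_min lexx.
have pi0 := @pi_gt0 R.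
have cosle (x : R) : dd <= x -> x <= 1 - dd -> cos (2 * pi * x) <= cos (2 * pi * dd).
  have main y : dd <= y -> y <= 2^-1 -> cos (2 * pi * y) <= cos (2 * pi * dd).
    move=> dy yh.
    have inpi z : dd <= z -> z <= 2^-1 -> 2 * pi * z \in `[0, pi].
      move=> dz zh; rewrite in_itv /=; apply/andP; split; first by nra.
      have : pi * z <= pi * 2^-1 by rewrite ler_pM2l.
      by lra.
    move: dy; rewrite le_eqVlt => /predU1P[->//|dy]; apply: ltW.
    have yin := inpi y (ltW dy) yh; have din := inpi dd (lexx _) ddh.
    by rewrite ltr_cos// ltr_pM2l ?mulr_gt0.
  move=> dx xd; have [xh|xh] := leP x 2^-1; first exact: main.
  have -> : cos (2 * pi * x) = cos (2 * pi * (1 - x)).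
    rewrite mulrBr mulr1 -[RHS]cosN opprB -(cosD2pi (2 * pi * x - 2 * pi)).
    by rewrite -[pi *+ 2]mulr_natl subrK.
  by apply: main; lra.
exists (2 * (1 - cos (2 * pi * dd))).
  have zin : (0 : R) \in `[0, pi] by rewrite in_itv /= lexx ltW.
  have din : 2 * pi * dd \in `[0, pi].
    rewrite in_itv /=; apply/andP; split; first by rewrite !mulr_ge0// ltW.
    have : pi * dd <= pi * 2^-1 by rewrite ler_pM2l.
    by lra.
  by rewrite mulr_gt0// subr_gt0 -[ltRHS](@cos0 R) ltr_cos// !mulr_gt0.
move=> s Is ds.
have [s0 s1] : 0 <= s /\ s <= 1 by move: Is; rewrite /= in_itv /= => /andP.
have -> : circ s - circ t = circ s - 1%:C * circ t by rewrite mul1r.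
rewrite sqr_normc_circ_sub expr1n.
have : cos (2 * pi * (t - s)) <= cos (2 * pi * dd).
  rewrite -[cos (2 * pi * (t - s))]cos_norm normrM ger0_norm; last first.
    by rewrite mulr_ge0// ltW.
  rewrite distrC; apply: cosle; first exact: le_trans ds.
  by rewrite ler_norml; apply/andP; split; lra.
by lra.
Qed.

Lemma poisson_int_cvg (g : R -> R) t : continuous g -> 0 < t < 1 ->
  forall e, 0 < e -> exists2 r0 : R, r0 < 1 & forall r, 0 <= r < 1 -> r0 <= r ->
    `|poisson_int r g t - g t| <= e.
Proof.
move=> cg t01 e e0.
have [B hB] : exists B, forall s, I01 s -> `|g s| <= B.
  have : compact (g @` I01).
    by apply: continuous_compact; [exact: continuous_subspaceT|exact: segment_compact].
  move/compact_bounded => [M [_ hM]]; exists (M + 1) => s Is.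
  by apply: (hM (M + 1)); [rewrite ltrDl|exists s].
have It : I01 t by case/andP: t01 => t0 t1; rewrite /= in_itv /= !ltW.
have B0 : 0 <= B by rewrite (le_trans _ (hB _ It)).
have ig : integrable01 g.
  apply: integrable01_bounded hB; apply: measurable_funTS; exact: continuous_measurable_fun.
have e2 : 0 < e / 2 by rewrite divr_gt0.
have [d d0 hd] : exists2 d : R, 0 < d & forall s, `|s - t| < d -> `|g s - g t| <= e / 2.
  have /cvgrPdist_le /(_ _ e2) := cg t.
  move=> /nbhs_ballP[d /= d0 hd]; exists d => // s st.
  by rewrite distrC; apply: hd; rewrite /ball /= distrC.
have [h h0 hh] := circ_far t01 d0.
(* Korovkin's trick: the far part of the integral is dominated by the
   quadratic test function [|circ s - circ t|^2]. *)
have test r s : 0 <= r < 1 -> poisson r t s * normc (circ s - circ t) ^+ 2 <= 4 * (1 - r ^+ 2).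
  move=> r01; have hden := poisson_den_gt0 t s r01; move: (r01) => /andP[r0 r1].
  rewrite /poisson mulrAC ler_pdivrMr// -sqr_normc_circ_sub.
  rewrite [leRHS]mulrAC [leRHS]mulrC ler_wpM2l//; first by rewrite subr_ge0 expr_le1// ltW.
  have h1 := normc_tri (circ s) (circ t) (r%:C * circ t).
  have h2 : normc (r%:C * circ t - circ t) = 1 - r.
    rewrite -{2}[circ t]mul1r -mulrBl Normc.normcM normc_circ mulr1.
    by rewrite -(rmorph1 (real_complex R)) -rmorphB normc_RtoC ler0_norm ?opprB// subr_le0 ltW.
  have h3 := normc_circ_sub (r%:C * circ t) s; rewrite normc_rcirc// in h3.
  have n0 := normc_ge0 (circ s - circ t).
  move: h1 h2 h3 n0; set x := normc _; set y := normc _; set z := normc _ => h1 h2 h3 n0.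
  have : x <= 2 * y by lra.
  by nra.
(* 2B bounds |g(s) - g(t)|, and away from t the kernel is at most 4(1 - r^2)/h by [test]. *)
pose c := 2 * B * 4 / h.
have c0 : 0 <= c by rewrite divr_ge0 ?mulr_ge0// ltW.
exists (1 - e / (4 * (c + 1))).
  by rewrite ltrBlDr ltrDl divr_gt0// mulr_gt0// ltr_wpDl.
move=> r r01 rr; move: (r01) => /andP[r0 r1].
have ip : integrable01 (poisson r t).
  apply: (@integrable01_bounded _ (2 / (1 - r))); first exact: measurable_poisson.
  by move=> s _; rewrite ger0_norm ?poisson_ge0// poisson_le.
have igt : integrable01 (fun s => g s - g t) by apply: integrable01B => //; exact: integrable01_cst.
have -> : poisson_int r g t - g t = poisson_int r (fun s => g s - g t) t.
  rewrite poisson_intB//; last exact: integrable01_cst.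
  congr (_ - _); rewrite -[LHS]mulr1 -(int01_poisson t r01) -int01Z//.
  by apply: eq_int01 => s _; rewrite mulrC.
have ipg := integrable_poisson t r01 igt.
apply: (le_trans (ler_norm_int01 ipg)).
apply: (@le_trans _ _ (int01 (fun s => e / 2 * poisson r t s + c * (1 - r ^+ 2)))).
  apply: le_int01; first exact: integrable01_norm.
    by apply: integrable01D; [exact: integrable01Z|exact: integrable01_cst].
  move=> s Is; have P0 := poisson_ge0 t s r01.
  have r20 : 0 <= 1 - r ^+ 2 by rewrite subr_ge0 expr_le1// ltW.
  rewrite normrM ger0_norm//; have [sd|sd] := ltP `|s - t| d.
    apply: ler_wpDr; first exact: mulr_ge0.
    by rewrite mulrC ler_wpM2r//; exact: hd.
  have hgB : `|g s - g t| <= 2 * B.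
    by rewrite (le_trans (ler_normB _ _))// mulrDl mul1r lerD// hB.
  have far := hh s Is sd; have ts := test r s r01.
  apply: ler_wpDl; first by rewrite mulr_ge0// ltW.
  have q1 : poisson r t s * h <= 4 * (1 - r ^+ 2).
    by rewrite (le_trans _ ts)// ler_wpM2l.
  have -> : c * (1 - r ^+ 2) = 4 * (1 - r ^+ 2) * (2 * B) / h by rewrite /c; ring.
  rewrite ler_pdivlMr// mulrAC; apply: ler_pM => //.
  by rewrite mulr_ge0// ltW.
rewrite int01D; [|exact: integrable01Z|exact: integrable01_cst].
rewrite int01Z// int01_poisson// int01_cst mulr1.
rewrite [leRHS]splitr lerD2l.
have q2 : 1 - r ^+ 2 <= 2 * (e / (4 * (c + 1))).
  have : 1 - r <= e / (4 * (c + 1)) by lra.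
  by nra.
apply: (le_trans (ler_wpM2l c0 q2)).
rewrite (_ : c * _ = e / 2 * (c / (c + 1))); last by field; rewrite gt_eqF// ltr_wpDl.
apply: ler_piMr; first exact: ltW.
by rewrite ler_pdivrMr ?ltr_wpDl// mul1r lerDl.
Qed.

End PoissonIntegral.

(** * Boundary behaviour almost everywhere, and uniqueness of Fourier coefficients *)

Section PoissonAE.
Variable R : realType.
Local Notation I01 := (`[0%R, 1%R]%classic : set R).
Local Notation leb := (@lebesgue_measure R).
Implicit Types (r s t : R) (u v : R -> R).

(** A sequence of radii tending to 1, since the almost everywhere arguments combine countably many
    statements. *)
Definition radius (k : nat) : R := 1 - k.+1%:R^-1.

Lemma radius01 k : 0 <= radius k < 1.
Proof.
rewrite /radius subr_ge0 invf_le1 ?ltr0n// ler1n /=.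
by rewrite ltrBlDr ltrDl invr_gt0 ltr0n.
Qed.

Lemma radius_near (r0 : R) : r0 < 1 -> exists K : nat, forall k, (K <= k)%N -> r0 <= radius k.
Proof.
move=> r1; have e0 : 0 < 1 - r0 by rewrite subr_gt0.
have [K _ hK] := @near_infty_natSinv_lt R (PosNum e0).
exists K => k /hK /= h; rewrite /radius lerBrDr -lerBrDl; exact: ltW.
Qed.

Lemma ae01_interior : ae01 (fun t : R => 0 < t < 1).
Proof.
exists [set 0; 1]%classic; split.
- by apply: measurableU; exact: measurable_set1.
- apply/eqP; rewrite eq_le measure_ge0 andbT.
  rewrite (le_trans (measureU2 _ _ _))//.
  have h x : leb [set x] = 0%E by exact: lebesgue_measure_set1.
  by rewrite -[X in (X + _ <= _)%E]/(leb [set 0]) -[X in (_ + X <= _)%E]/(leb [set 1]) !h adde0.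
- move=> t /= h; apply: contrapT => /not_orP[t0 t1]; apply: h.
  rewrite in_itv /= => /andP[a b]; rewrite !lt_neqAle a b !andbT eq_sym.
  by apply/andP; split; apply/eqP.
Qed.

(** Pointwise convergence at interior points holds almost everywhere, and as the kernel has mean 1
    the bound B of g also dominates its Poisson integrals. *)
Lemma poisson_L1_continuous (g : R -> R) : continuous g ->
  forall e, 0 < e -> exists K : nat, forall k, (K <= k)%N ->
    int01 (fun t => `|poisson_int (radius k) g t - g t|) <= e.
Proof.
move=> cg e e0.
have [B hB] : exists B, forall s, I01 s -> `|g s| <= B.
  have : compact (g @` I01).
    by apply: continuous_compact; [exact: continuous_subspaceT|exact: segment_compact].
  move/compact_bounded => [M [_ hM]]; exists (M + 1) => s Is.
  by apply: (hM (M + 1)); [rewrite ltrDl|exists s].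
have mg : measurable_fun I01 g by apply: measurable_funTS; exact: continuous_measurable_fun.
have ig : integrable01 g by apply: integrable01_bounded mg hB.
have iP k : integrable01 (poisson_int (radius k) g).
  by have [] := poisson_int_contraction (radius01 k) ig.
have PB k t : `|poisson_int (radius k) g t| <= B.
  have r01 := radius01 k.
  rewrite (le_trans (ler_norm_int01 (integrable_poisson t r01 ig)))//.
  have ip : integrable01 (poisson (radius k) t).
    apply: (@integrable01_bounded _ (2 / (1 - radius k))); first exact: measurable_poisson.
    by move=> s _; rewrite ger0_norm ?poisson_ge0// poisson_le.
  rewrite -[B]mulr1 -(int01_poisson t r01) -int01Z//; apply: le_int01.
  - by apply: integrable01_norm; exact: integrable_poisson.
  - exact: integrable01Z.
  - move=> s Is; rewrite normrM ger0_norm ?poisson_ge0// mulrC.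
    by rewrite ler_wpM2r ?poisson_ge0// hB.
have [|||||_ + _] := @dominated_convergence _ _ _ leb I01 (@measurable01 R)
  (fun k t => (poisson_int (radius k) g t)%:E) (EFin \o g) (fun=> B%:E).
- by move=> k; apply/measurable_EFinP; exact: integrable01_measurable.
- exact/measurable_EFinP.
- apply: ae01_mono ae01_interior => t _ t01.
  apply: cvg_EFin; first by apply: nearW.
  apply/cvgrPdist_le => x x0; have [r0 r1 h] := poisson_int_cvg cg t01 x0.
  have [K hK] := radius_near r1; exists K => // k Kk /=.
  by rewrite distrC; apply: h; [exact: radius01|exact: hK].
- exact: integrable01_cst.
- by apply: aeW => t k _; rewrite lee_fin.
move=> /fine_cvgP[_ /cvgrPdist_le /(_ _ e0)[K _ hK]].
exists K => k Kk; have := hK k Kk; rewrite /= sub0r normrN => h.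
by apply: le_trans (ler_norm _) h.
Qed.

(** Continuous functions are dense in L^1 and the Poisson integral is an L^1 contraction: three
    errors of e/3. *)
Lemma poisson_L1 u : integrable01 u ->
  forall e, 0 < e -> exists K : nat, forall k, (K <= k)%N ->
    int01 (fun t => `|poisson_int (radius k) u t - u t|) <= e.
Proof.
move=> iu e e0; have e3 : 0 < e / 3 by rewrite divr_gt0.
have [g_ [cg ig hg]] :=
  @approximation_continuous_integrable R I01 u (@measurable01 R) (leb01_fin R) iu.
move: hg => /fine_cvgP[_ /cvgrPdist_le /(_ _ e3)[N _ /(_ N (leqnn N))]].
rewrite /= sub0r normrN => /(le_trans (ler_norm _)) hN.
have {}ig : integrable01 (g_ N) by exact: ig.
have iug := integrable01B iu ig.
have {}hN : int01 (fun t => `|u t - g_ N t|) <= e / 3 by exact: hN.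
have [K hK] := poisson_L1_continuous (cg N) e3.
exists K => k Kk; have r01 := radius01 k.
have [i1 c1] := poisson_int_contraction r01 iug.
have [i2 _] := poisson_int_contraction r01 ig.
have [i3 _] := poisson_int_contraction r01 iu.
have i4 := integrable01B i2 ig.
apply: (@le_trans _ _ (int01 (fun t => (`|poisson_int (radius k) (fun s => u s - g_ N s) t| +
   `|poisson_int (radius k) (g_ N) t - g_ N t|) + `|u t - g_ N t|))).
  apply: le_int01.
  - by apply: integrable01_norm; exact: integrable01B.
  - by apply: integrable01D; [apply: integrable01D|]; exact: integrable01_norm.
  - move=> t _; rewrite poisson_intB//.
    set a := poisson_int _ u t; set b := poisson_int _ _ t; set c := g_ N t.
    have -> : a - u t = (a - b) + (b - c) - (u t - c) by ring.
    by rewrite (le_trans (ler_normB _ _))// lerD2r ler_normD.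
rewrite int01D; [|by apply: integrable01D; exact: integrable01_norm|exact: integrable01_norm].
rewrite int01D; [|exact: integrable01_norm..].
have := hK _ Kk; move: hN c1; lra.
Qed.

Lemma poisson_ae u : integrable01 u ->
  ae01 (fun t => forall (K : nat) e, 0 < e -> exists2 k : nat, (K <= k)%N &
    `|poisson_int (radius k) u t - u t| < e).
Proof.
move=> iu; apply: (int01_small_ae (d := fun k t => poisson_int (radius k) u t - u t)).
  move=> k; apply: integrable01B => //.
  by have [] := poisson_int_contraction (radius01 k) iu.
exact: poisson_L1.
Qed.

Implicit Types (f : R[i] -> R[i]).

Lemma poisson_herglotz (v : R[i] -> R) r t : 0 <= r < 1 ->
  poisson_int r (fun s => v (circ s)) t =
  Re (herglotz (fun z => (v z)%:C) (r%:C * circ t)).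
Proof.
move=> r01; rewrite /herglotz integral_TE -[RHS]/(int01 _); apply: eq_int01 => s _.
by rewrite Re_mulr_real Re_herglotz_kernel.
Qed.

Lemma integrable_T_real (v : R[i] -> R) :
  integrable_T (fun z => (v z)%:C) <-> integrable01 (fun t => v (circ t)).
Proof.
split=> [[]//|h]; split => //.
exact: integrable01_cst.
Qed.

(** All Poisson integrals of v vanish by [herglotz_eq], and for almost every t some of them are
    arbitrarily near v. *)
Lemma fourier_unique_real (v : R[i] -> R) : integrable_T (fun z => (v z)%:C) ->
  (forall n, fourier (fun z => (v z)%:C) n = 0) -> ae01 (fun t => v (circ t) = 0).
Proof.
move=> iv v0; have iu := (integrable_T_real v).1 iv.
apply: ae01_mono (poisson_ae iu) => t _ h.
apply/eqP; rewrite -normr_eq0; apply/eqP/le_anti/andP; split => //.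
apply/ler_addgt0Pr => e e0; rewrite add0r.
have [k _] := h 0%N e e0; have r01 := radius01 k; move: (r01) => /andP[r0 r1].
rewrite poisson_herglotz// (@herglotz_eq _ _ _ 0)//; last by rewrite normc_rcirc.
by rewrite /= sub0r normrN => /ltW.
Qed.

Lemma fourier_unique f : integrable_T f -> (forall n, fourier f n = 0) ->
  ae01 (fun t => f (circ t) = 0).
Proof.
move=> hf f0.
have icj : integrable_T (fun z => Num.conj (f z)).
  apply: integrable_T_le (integrable_T_normc hf).
    by apply: measurable_T_conj; exact: integrable_T_measurable.
  by move=> t _; rewrite normc_conj.
have cj0 n : fourier (fun z => Num.conj (f z)) n = 0.
  by rewrite fourier_conj// f0 rmorph0.
have h2 : 2 != 0 :> R[i] by rewrite pnatr_eq0.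
have ReE z : (Re z)%:C = 2^-1 * (z + Num.conj z).
  have -> : z + Num.conj z = 2 * (Re z)%:C by exact: addcJ.
  by rewrite mulKf.
have ImE z : (Im z)%:C = (- 'i%C * 2^-1) * (z - Num.conj z).
  have -> : z - Num.conj z = 2 * (Im z)%:C * 'i%C by exact: subcJ.
  transitivity (- ('i%C ^+ 2) * (Im z)%:C); first by rewrite sqr_i opprK mul1r.
  by field.
have a1 : ae01 (fun t => Re (f (circ t)) = 0).
  apply: (@fourier_unique_real (fun z => Re (f z))).
    apply: (@integrable_T_ext _ (fun z => 2^-1 * (f z + Num.conj (f z)))).
      by move=> t; rewrite -ReE.
    by apply: integrable_TZ; exact: integrable_TD.
  move=> n; rewrite (@fourier_ext _ _ (fun z => 2^-1 * (f z + Num.conj (f z)))); last first.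
    by move=> t; rewrite -ReE.
  by rewrite fourierZ ?fourierD ?f0 ?cj0 ?addr0 ?mulr0//; exact: integrable_TD.
have a2 : ae01 (fun t => Im (f (circ t)) = 0).
  apply: (@fourier_unique_real (fun z => Im (f z))).
    apply: (@integrable_T_ext _ (fun z => (- 'i%C * 2^-1) * (f z - Num.conj (f z)))).
      by move=> t; rewrite -ImE.
    by apply: integrable_TZ; exact: integrable_TB.
  move=> n; rewrite (@fourier_ext _ _ (fun z => (- 'i%C * 2^-1) * (f z - Num.conj (f z)))); last first.
    by move=> t; rewrite -ImE.
  by rewrite fourierZ ?fourierB ?f0 ?cj0 ?subrr ?mulr0//; exact: integrable_TB.
apply: ae01_mono (ae01_and a1 a2) => t _ [h1 h3].
by apply/eqP; rewrite eq_complex h1 h3 /= !eqxx.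
Qed.

Lemma radial_cvg (G : R[i] -> R[i]) t (l : R[i]) :
  ((G (r%:C * circ t) : R[i]^o) @[r --> 1^'-] --> (l : R[i]^o)) ->
  forall e, 0 < e -> exists K : nat, forall k, (K <= k)%N ->
    normc (G ((radius k)%:C * circ t) - l) <= e.
Proof.
move=> h e e0.
have e0' : 0 < e%:C by rewrite ltcR.
move/cvgrPdist_le : h => /(_ _ e0') [d /= d0 hd].
have d1 : 1 - d / 2 < 1 by rewrite ltrBlDr ltrDl divr_gt0.
have [K hK] := radius_near d1; exists K => k /hK rk.
have /andP[_ r1] := radius01 k.
have := hd (radius k) _ r1; rewrite normcEnorm lecR normc_distC; apply.
rewrite /ball /= ger0_norm ?subr_ge0 ?ltW//.
have : d / 2 < d by rewrite ltr_pdivrMr// ltr_pMr// ltr1n.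
move: rk; lra.
Qed.

(** On a radius, |G| is the exponential of the Poisson integral of v. Its limit exists and equals
    |g| by hypothesis, and the Poisson integrals come near v along suitable radii, so the limit must
    be exp v. *)
Lemma outer_modulus (G g : R[i] -> R[i]) (c : R[i]) (v : R[i] -> R) :
  normc c = 1 -> integrable_T (fun z => (v z)%:C) ->
  (forall z, normc z < 1 -> G z = c * cexp (herglotz (fun y => (v y)%:C) z)) ->
  boundary_values G g ->
  ae01 (fun t => normc (g (circ t)) = expR (v (circ t))).
Proof.
move=> c1 iv GE hb; have iu := (integrable_T_real v).1 iv.
apply: ae01_mono (ae01_and hb (poisson_ae iu)) => t It [/radial_cvg hl hp].
apply/eqP; rewrite -subr_eq0 -normr_eq0; apply/eqP/le_anti/andP; split => //.
apply/ler_addgt0Pr => e e0; rewrite add0r.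
have e2 : 0 < e / 2 by rewrite divr_gt0.
have [K hK] := hl _ e2.
have /cvgrPdist_le /(_ _ e2) := (@continuous_expR R) (v (circ t)).
move=> /nbhs_ballP[d /= d0 hd].
have [k Kk hk] := hp K d d0.
have h1 := hK k Kk; have h2 := hd (poisson_int (radius k) (fun s => v (circ s)) t).
have {}h2 : `|expR (v (circ t)) - expR (poisson_int (radius k) (fun s => v (circ s)) t)| <= e / 2.
  by apply: h2; rewrite /ball /= distrC.
have r01 := radius01 k; move: (r01) => /andP[r0 r1].
rewrite GE ?normc_rcirc// in h1.
have h3 := normc_ler_dist (c * cexp (herglotz (fun y => (v y)%:C) ((radius k)%:C * circ t))) (g (circ t)).
rewrite Normc.normcM c1 mul1r normc_cexp -poisson_herglotz// in h3.
rewrite [e]splitr; set x := normc (g _) in h3 *; set y := expR (v _) in h2 *.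
set p := expR _ in h2 h3.
have -> : x - y = - (p - x) - (y - p) by ring.
rewrite (le_trans (ler_normB _ _))// normrN lerD//.
exact: le_trans h3 h1.
Qed.

End PoissonAE.

(** * Finite nonlinear Fourier transforms *)

Section NlftPolynomials.
Variable R : realType.
Implicit Types (F : int -> R[i]) (p pa pb : tpoly R) (M : R[i] -> 'M[R[i]]_2).

Definition nlft_scale (x : R[i]) : R := (Num.sqrt (1 + normc x ^+ 2))^-1.

Lemma sqrtC_real (x : R) : 0 <= x -> sqrtC (x%:C : R[i]) = (Num.sqrt x)%:C.
Proof.
move=> x0; have s0 : 0 <= (Num.sqrt x)%:C :> R[i] by rewrite lecR sqrtr_ge0.
by rewrite -[in LHS](sqr_sqrtr x0) rmorphXn sqrCK.
Qed.

Lemma nlft_scale_gt0 x : 0 < nlft_scale x.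
Proof. by rewrite invr_gt0 sqrtr_gt0 ltr_pwDl// sqr_ge0. Qed.

Lemma nlft_scale_le1 x : nlft_scale x <= 1.
Proof.
rewrite invf_le1 ?sqrtr_gt0 ?ltr_pwDl ?sqr_ge0//.
by rewrite -[leLHS]sqrtr1 ler_wsqrtr// lerDl sqr_ge0.
Qed.

Lemma nlft_scale_sqr x : nlft_scale x ^+ 2 * (1 + normc x ^+ 2) = 1.
Proof.
have h : 0 < 1 + normc x ^+ 2 by rewrite ltr_pwDl// sqr_ge0.
by rewrite exprVn sqr_sqrtr ?ltW// mulVf// gt_eqF.
Qed.

(** From sqrt(1 + y) <= 1 + y <= e^y. Multiplied over k, it keeps the constants of all partial
    products above exp(-S), where S bounds the sum of the |F_k|^2. *)
Lemma nlft_scale_ge x : expR (- normc x ^+ 2) <= nlft_scale x.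
Proof.
have h : 1 <= 1 + normc x ^+ 2 by rewrite lerDl sqr_ge0.
have h0 : 0 < 1 + normc x ^+ 2 by rewrite (lt_le_trans ltr01).
have h1 : Num.sqrt (1 + normc x ^+ 2) <= expR (normc x ^+ 2).
  apply: le_trans (expR_ge1Dx _).
  rewrite -[leRHS]ger0_norm ?(ltW h0)// -sqrtr_sqr ler_wsqrtr// expr2.
  by apply: ler_peMr => //; exact: ltW.
by rewrite expRN lef_pV2 ?posrE ?expR_gt0 ?sqrtr_gt0.
Qed.

Lemma nlft_factorE F k z : let s := (nlft_scale (F k))%:C in
  [/\ nlft_factor F k z 0 0 = s, nlft_factor F k z 0 1 = s * (F k * z ^ k),
      nlft_factor F k z 1 0 = - (s * (Num.conj (F k) * z ^ (- k))) &
      nlft_factor F k z 1 1 = s].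
Proof.
have sE : (sqrtC (1 + `|F k| ^+ 2))^-1 = (nlft_scale (F k))%:C.
  rewrite normcEnorm -(rmorph1 (real_complex R)) -rmorphXn -rmorphD sqrtC_real.
    by rewrite -fmorphV.
  by rewrite addr_ge0// sqr_ge0.
rewrite /nlft_factor sE /=; split; rewrite !mxE //=; rewrite ?mulr1// mulrN//.
Qed.

(** Describes a partial product with indices in [lo, hi]: the spectrum of b follows the indices and
    that of a their nonpositive differences. In the products below, [kappa] is the product of the
    normalising factors. *)
Record su2_poly (lo hi : int) (kappa : R) M pa pb : Prop := Su2Poly {
  su2_00 : forall t, M (circ t) 0 0 = tp_eval pa (circ t);
  su2_01 : forall t, M (circ t) 0 1 = tp_eval pb (circ t);
  su2_10 : forall t, M (circ t) 1 0 = - Num.conj (tp_eval pb (circ t));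
  su2_11 : forall t, M (circ t) 1 1 = Num.conj (tp_eval pa (circ t));
  su2_det : forall t, normc (tp_eval pa (circ t)) ^+ 2 +
                      normc (tp_eval pb (circ t)) ^+ 2 = 1;
  su2_suppa : tp_supp (fun n => lo - hi <= n <= 0) pa;
  su2_suppb : tp_supp (fun n => lo <= n <= hi) pb;
  su2_coef0 : tp_coef pa 0 = kappa%:C }.

Definition tp_mono (c : R[i]) (k : int) p : tpoly R := [seq (c * x.1, k + x.2) | x <- p].

Lemma tp_eval_mono c k p t : tp_eval (tp_mono c k p) (circ t) =
  c * circ t ^ k * tp_eval p (circ t).
Proof.
rewrite /tp_eval /tp_mono big_map mulr_sumr; apply: eq_bigr => x _ /=.
by rewrite expfzDr ?circ_neq0// mulrACA.
Qed.

Lemma tp_coef_mono c k p n : tp_coef (tp_mono c k p) n = c * tp_coef p (n - k).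
Proof.
rewrite /tp_coef /tp_mono big_map mulr_sumr; apply: eq_bigl => x /=.
by rewrite addrC eq_sym -subr_eq eq_sym.
Qed.

Lemma tp_coef_cat p p' n : tp_coef (p ++ p') n = tp_coef p n + tp_coef p' n.
Proof. exact: big_cat. Qed.

Lemma tp_coef_conj p n : tp_coef (tp_conj p) n = Num.conj (tp_coef p (- n)).
Proof.
rewrite /tp_coef /tp_conj big_map rmorph_sum; apply: eq_bigl => x /=.
by rewrite eqr_oppLR.
Qed.

Lemma tp_norm_mono w c k p : (forall n m, w (n + m) <= w n * w m) ->
  tp_norm w (tp_mono c k p) <= normc c * w k * tp_norm w p.
Proof.
move=> wM; rewrite /tp_norm /tp_mono big_map mulr_sumr; apply: ler_sum => x _ /=.
by rewrite Normc.normcM mulrACA ler_wpM2l// mulr_ge0// normc_ge0.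
Qed.

Lemma tp_supp_mono (Q Q' : pred int) c k p : (forall n, Q n -> Q' (k + n)) ->
  tp_supp Q p -> tp_supp Q' (tp_mono c k p).
Proof. by move=> QQ /allP hp; apply/allP => x /mapP[y yp ->] /=; apply: QQ; exact: hp. Qed.

(* First rows of the products of ((a, b), (- star b, star a)) with a new leftmost
   (consa, consb) resp. rightmost (rconsa, rconsb) factor. *)
Definition consa (s : R) (Fk : R[i]) k pa pb : tpoly R :=
  tp_scale s%:C (pa ++ tp_mono (- Fk) k (tp_conj pb)).
Definition consb (s : R) (Fk : R[i]) k pa pb : tpoly R :=
  tp_scale s%:C (pb ++ tp_mono Fk k (tp_conj pa)).
Definition rconsa (s : R) (Fk : R[i]) k pa pb : tpoly R :=
  tp_scale s%:C (pa ++ tp_mono (- Num.conj Fk) (- k) pb).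
Definition rconsb (s : R) (Fk : R[i]) k pa pb : tpoly R :=
  tp_scale s%:C (pb ++ tp_mono Fk k pa).

Lemma tp_coef_scale c p n : tp_coef (tp_scale c p) n = c * tp_coef p n.
Proof. by rewrite /tp_coef /tp_scale big_map mulr_sumr. Qed.

Lemma mulmx2 (A B : 'M[R[i]]_2) i j : (A * B) i j = A i 0 * B 0 j + A i 1 * B 1 j.
Proof.
rewrite -[A * B]/(A *m B) mxE !big_ord_recl big_ord0 addr0.
by congr (A i _ * B _ j + A i _ * B _ j); apply/val_inj.
Qed.

(** Multiplicativity of the determinant, in one identity that serves multiplication from the left
    (with b conjugated) and from the right (with a and b exchanged). *)
Lemma su2_det_step (s : R) (Fk u a b : R[i]) : normc u = 1 ->
  s ^+ 2 * (1 + normc Fk ^+ 2) = 1 ->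
  normc a ^+ 2 + normc b ^+ 2 = 1 ->
  normc (s%:C * (a + - Fk * u * b)) ^+ 2 +
  normc (s%:C * (Num.conj b + Fk * u * Num.conj a)) ^+ 2 = 1.
Proof.
move=> u1 hs hab; apply: (@complexI R).
have sumE (x y : R[i]) : (normc x ^+ 2 + normc y ^+ 2)%:C = x * Num.conj x + y * Num.conj y.
  by rewrite !mulz_conj -rmorphD.
rewrite sumE.
have hs' : s%:C ^+ 2 * (1 + Fk * Num.conj Fk) = 1 :> R[i].
  by rewrite mulz_conj -(rmorph1 (real_complex R)) -rmorphD -rmorphXn -rmorphM hs.
have hab' : a * Num.conj a + b * Num.conj b = 1.
  by rewrite !mulz_conj -rmorphD hab.
have hu : u * Num.conj u = 1 by rewrite mulz_conj u1 expr1n.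
have sc : Num.conj (s%:C : R[i]) = s%:C by exact: conjc_real.
rewrite !(rmorphM, rmorphD, rmorphN) /= !conjCK sc.
transitivity (s%:C ^+ 2 * ((a * Num.conj a + b * Num.conj b) *
   (1 + Fk * Num.conj Fk * (u * Num.conj u)))); first by ring.
by rewrite hab' hu mul1r mulr1.
Qed.

(** The index k lies below the old spectrum of b, so the new coefficient of b at k sees only F_k
    times the constant coefficient of the old a. This is how F_k is read off from a product. *)
Lemma su2_cons F k lo hi kappa M pa pb : k < lo -> lo <= hi ->
  su2_poly lo hi kappa M pa pb ->
  let s := nlft_scale (F k) in
  su2_poly k hi (s * kappa) (fun z => nlft_factor F k z * M z)
    (consa s (F k) k pa pb) (consb s (F k) k pa pb) /\
  tp_coef (consb s (F k) k pa pb) k = F k * (s * kappa)%:C.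
Proof.
move=> klo lohi [h00 h01 h10 h11 hdet ha hb h0] s.
have sc : Num.conj (s%:C : R[i]) = s%:C by exact: conjc_real.
have ea t : tp_eval (consa s (F k) k pa pb) (circ t) =
    s%:C * (tp_eval pa (circ t) + - F k * circ t ^ k * Num.conj (tp_eval pb (circ t))).
  by rewrite tp_eval_scale tp_eval_cat tp_eval_mono tp_eval_conj.
have eb t : tp_eval (consb s (F k) k pa pb) (circ t) =
    s%:C * (tp_eval pb (circ t) + F k * circ t ^ k * Num.conj (tp_eval pa (circ t))).
  by rewrite tp_eval_scale tp_eval_cat tp_eval_mono tp_eval_conj.
have ca n : tp_coef (consa s (F k) k pa pb) n =
    s%:C * (tp_coef pa n - F k * Num.conj (tp_coef pb (k - n))).
  by rewrite tp_coef_scale tp_coef_cat tp_coef_mono tp_coef_conj opprB mulNr.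
have cb n : tp_coef (consb s (F k) k pa pb) n =
    s%:C * (tp_coef pb n + F k * Num.conj (tp_coef pa (k - n))).
  by rewrite tp_coef_scale tp_coef_cat tp_coef_mono tp_coef_conj opprB.
have ck : tp_coef pb k = 0.
  by apply: (tp_coef_supp hb); rewrite negb_and -ltNge klo.
have fE t := nlft_factorE F k (circ t).
split; last first.
  have kc : Num.conj (kappa%:C : R[i]) = kappa%:C by exact: conjc_real.
  by rewrite cb ck add0r subrr h0 kc rmorphM mulrCA.
split.
- move=> t; have [f1 f2 f3 f4] := fE t.
  by rewrite mulmx2 f1 f2 h00 h10 ea -/s; ring.
- move=> t; have [f1 f2 f3 f4] := fE t.
  by rewrite mulmx2 f1 f2 h01 h11 eb -/s; ring.
- move=> t; have [f1 f2 f3 f4] := fE t.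
  rewrite mulmx2 f3 f4 h00 h10 eb -/s !(rmorphM, rmorphD) /= sc conj_circXz conjCK.
  by ring.
- move=> t; have [f1 f2 f3 f4] := fE t.
  rewrite mulmx2 f3 f4 h01 h11 ea -/s !(rmorphM, rmorphD, rmorphN) /= sc conj_circXz conjCK.
  by ring.
- move=> t; rewrite ea eb.
  have := @su2_det_step s (F k) (circ t ^ k) (tp_eval pa (circ t)) (Num.conj (tp_eval pb (circ t))).
  rewrite conjCK normc_conj normc_circXz hdet nlft_scale_sqr; exact.
- apply: tp_supp_scale; rewrite tp_supp_cat; apply/andP; split.
    by apply: tp_suppS ha => n; lia.
  apply: (tp_supp_mono (Q := fun n => - hi <= n <= - lo)) => [n|]; first by lia.
  by apply: tp_supp_conj hb => n; lia.
- apply: tp_supp_scale; rewrite tp_supp_cat; apply/andP; split.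
    by apply: tp_suppS hb => n; lia.
  apply: (tp_supp_mono (Q := fun n => 0 <= n <= hi - lo)) => [n|]; first by lia.
  by apply: tp_supp_conj ha => n; lia.
- by rewrite ca subr0 ck rmorph0 mulr0 subr0 h0 rmorphM.
Qed.

Lemma su2_rcons F k lo hi kappa M pa pb : hi < k -> lo <= hi ->
  su2_poly lo hi kappa M pa pb ->
  let s := nlft_scale (F k) in
  su2_poly lo k (kappa * s) (fun z => M z * nlft_factor F k z)
    (rconsa s (F k) k pa pb) (rconsb s (F k) k pa pb) /\
  tp_coef (rconsb s (F k) k pa pb) k = F k * (kappa * s)%:C.
Proof.
move=> hik lohi [h00 h01 h10 h11 hdet ha hb h0] s.
have sc : Num.conj (s%:C : R[i]) = s%:C by exact: conjc_real.
have ea t : tp_eval (rconsa s (F k) k pa pb) (circ t) =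
    s%:C * (tp_eval pa (circ t) + - Num.conj (F k) * circ t ^ (- k) * tp_eval pb (circ t)).
  by rewrite tp_eval_scale tp_eval_cat tp_eval_mono.
have eb t : tp_eval (rconsb s (F k) k pa pb) (circ t) =
    s%:C * (tp_eval pb (circ t) + F k * circ t ^ k * tp_eval pa (circ t)).
  by rewrite tp_eval_scale tp_eval_cat tp_eval_mono.
have ck : tp_coef pb k = 0.
  by apply: (tp_coef_supp hb); rewrite negb_and -ltNge -ltNge hik orbT.
have fE t := nlft_factorE F k (circ t).
split; last first.
  rewrite tp_coef_scale tp_coef_cat tp_coef_mono ck add0r subrr h0 rmorphM.
  by rewrite mulrCA [s%:C * _]mulrC.
split.
- move=> t; have [f1 f2 f3 f4] := fE t.
  by rewrite mulmx2 f1 f3 h00 h01 ea -/s; ring.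
- move=> t; have [f1 f2 f3 f4] := fE t.
  by rewrite mulmx2 f2 f4 h00 h01 eb -/s; ring.
- move=> t; have [f1 f2 f3 f4] := fE t.
  rewrite mulmx2 f1 f3 h10 h11 eb -/s !(rmorphM, rmorphD) /= sc conj_circXz.
  by ring.
- move=> t; have [f1 f2 f3 f4] := fE t.
  rewrite mulmx2 f2 f4 h10 h11 ea -/s !(rmorphM, rmorphD, rmorphN) /= sc conj_circXz conjCK opprK.
  by ring.
- move=> t; rewrite ea eb addrC.
  have := @su2_det_step s (- F k) (circ t ^ k) (tp_eval pb (circ t)) (tp_eval pa (circ t)).
  rewrite normc_opp normc_circXz [normc (tp_eval pb _) ^+ 2 + _]addrC hdet nlft_scale_sqr opprK => /(_ erefl erefl erefl).
  move=> <-; congr (_ + _); congr (_ ^+ 2).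
  rewrite -[LHS]normc_conj !(rmorphM, rmorphD, rmorphN) /= conj_circXz conjCK opprK sc.
  by rewrite mulNr.
- apply: tp_supp_scale; rewrite tp_supp_cat; apply/andP; split.
    by apply: tp_suppS ha => n; lia.
  by apply: tp_supp_mono hb => n; lia.
- apply: tp_supp_scale; rewrite tp_supp_cat; apply/andP; split.
    by apply: tp_suppS hb => n; lia.
  by apply: tp_supp_mono ha => n; lia.
- rewrite tp_coef_scale tp_coef_cat tp_coef_mono sub0r opprK ck mulr0 addr0 h0.
  by rewrite rmorphM mulrC.
Qed.

Lemma su2_one lo : su2_poly lo lo 1 (fun=> 1) [:: (1, 0)] [::].
Proof.
split=> //.
- by move=> t; rewrite mxE tp_eval_cons tp_eval_nil /= expr0z mulr1 addr0.
- by move=> t; rewrite mxE tp_eval_nil.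
- by move=> t; rewrite mxE tp_eval_nil conjC0 oppr0.
- by move=> t; rewrite mxE tp_eval_cons tp_eval_nil /= expr0z mulr1 addr0 conjC1.
- move=> t; rewrite tp_eval_cons tp_eval_nil [(_, _).1]/= [(_, _).2]/= expr0z mulr1 addr0.
  by rewrite Normc.normc1 Normc.normc0 expr1n expr0n addr0.
- by rewrite /tp_supp /= subrr lexx.
- by rewrite /tp_coef big_cons big_nil /= addr0.
Qed.

End NlftPolynomials.

(** * Products of consecutive factors *)

Section NlftProducts.
Variable R : realType.
Variable F : int -> R[i].
Variable N : nat.
Implicit Types (w : int -> R).

Definition nlft_range (m n : nat) (z : R[i]) : 'M[R[i]]_2 :=
  \prod_(m <= j < n) nlft_factor F (j%:Z - N%:Z) z.

Definition nlft_const (m n : nat) : R :=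
  \prod_(m <= j < n) nlft_scale (F (j%:Z - N%:Z)).

Lemma nlft_trunc_split m z : (m <= (2 * N).+1)%N ->
  nlft_trunc F N z = nlft_range 0 m z * nlft_range m (2 * N).+1 z.
Proof. by move=> mN; rewrite /nlft_trunc /nlft_range -big_cat_nat. Qed.

Lemma su2_poly_ext lo hi kappa (M M' : R[i] -> 'M[R[i]]_2) pa pb :
  (forall z, M z = M' z) -> su2_poly lo hi kappa M pa pb -> su2_poly lo hi kappa M' pa pb.
Proof. by move=> MM; have -> : M' = M by apply/funext => z; rewrite MM. Qed.

(** The lower end is one below the first index -N, so that the empty product m = 0 has lo <= hi too.
    For the last clause, each factor multiplies the sum of the two norms by at most 1 + |F_k| w(k),
    and w(0) is the norm of the initial constant 1. *)
Lemma nlft_range_left m : exists pa pb,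
  [/\ su2_poly (- N%:Z - 1) (m%:Z - N%:Z - 1) (nlft_const 0 m) (nlft_range 0 m) pa pb,
      forall j : nat, m = j.+1 ->
        tp_coef pb (j%:Z - N%:Z) = F (j%:Z - N%:Z) * (nlft_const 0 m)%:C &
      forall w, (forall n, 1 <= w n) -> (forall n, w (- n) = w n) ->
        (forall n k, w (n + k) <= w n * w k) ->
        tp_norm w pa + tp_norm w pb <=
        w 0 * \prod_(0 <= j < m) (1 + normc (F (j%:Z - N%:Z)) * w (j%:Z - N%:Z))].
Proof.
elim: m => [|m [pa [pb [h1 _ h3]]]].
  exists [:: (1, 0)], [::]; split=> [|//|w w1 wN wM].
    rewrite /nlft_const big_geq// sub0r.
    apply: su2_poly_ext (su2_one R _) => z.
    by rewrite /nlft_range big_geq.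
  by rewrite big_geq// tp_norm_cons Normc.normc1 mul1r mulr1 /tp_norm !big_nil !addr0.
have [|| h4 h5] := @su2_rcons R F (m%:Z - N%:Z) _ _ _ _ _ _ _ _ h1; [lia|lia|].
set s := nlft_scale _ in h4 h5.
have ck : nlft_const 0 m.+1 = nlft_const 0 m * s.
  by rewrite /nlft_const big_nat_recr.
do 2 eexists; split.
- have -> : (m.+1%:Z - N%:Z - 1) = m%:Z - N%:Z by lia.
  rewrite ck; apply: su2_poly_ext h4 => z.
  by rewrite /nlft_range big_nat_recr.
- by move=> j [<-]; rewrite h5 ck.
- move=> w w1 wN wM; have {}h3 := h3 w w1 wN wM.
  rewrite big_nat_recr//= mulrA; set k := (m%:Z - N%:Z).
  have s0 : 0 <= s by apply: ltW; exact: nlft_scale_gt0.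
  have s1 : s <= 1 by exact: nlft_scale_le1.
  have sn : normc (s%:C : R[i]) = s by rewrite normc_RtoC ger0_norm.
  rewrite !tp_norm_scale sn !tp_norm_cat -mulrDr.
  set x := tp_norm w pa in h3 *; set y := tp_norm w pb in h3 *.
  have x0 : 0 <= x by exact: tp_norm_ge0.
  have y0 : 0 <= y by exact: tp_norm_ge0.
  have w0 : 0 <= w k by exact: le_trans (w1 k).
  have fw : 0 <= normc (F k) * w k by rewrite mulr_ge0 ?normc_ge0.
  have b1 := tp_norm_mono (- Num.conj (F k)) (- k) pb wM.
  have b2 := tp_norm_mono (F k) k pa wM.
  rewrite normc_opp normc_conj wN -/y -/k in b1; rewrite -/x in b2.
  apply: (@le_trans _ _ ((x + y) * (1 + normc (F k) * w k))); last first.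
    by rewrite ler_wpM2r// addr_ge0.
  apply: (@le_trans _ _ (x + normc (F k) * w k * y + (y + normc (F k) * w k * x))).
    rewrite -[leRHS]mul1r; apply: ler_pM => //.
      by rewrite !addr_ge0// tp_norm_ge0.
    by rewrite !lerD.
  by rewrite le_eqVlt; apply/orP; left; apply/eqP; ring.
Qed.

Lemma nlft_range_right m : (m <= (2 * N).+1)%N -> exists pa pb,
  su2_poly (m%:Z - N%:Z) (N%:Z + 1) (nlft_const m (2 * N).+1)
    (nlft_range m (2 * N).+1) pa pb /\
  ((m <= 2 * N)%N -> tp_coef pb (m%:Z - N%:Z) =
     F (m%:Z - N%:Z) * (nlft_const m (2 * N).+1)%:C).
Proof.
(* Induction on the number i of factors, added one by one on the left; the upper end N + 1 again
   makes room for the empty product. *)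
move=> mN; rewrite -(subKn mN); set i := ((2 * N).+1 - m)%N.
have : (i <= (2 * N).+1)%N by rewrite leq_subr.
elim: i => [|i IH] iN.
  rewrite subn0; exists [:: (1, 0)], [::]; split; last by rewrite ltnn.
  have -> : (2 * N).+1%:Z - N%:Z = N%:Z + 1 by lia.
  rewrite /nlft_const big_geq//.
  apply: su2_poly_ext (su2_one R _) => z.
  by rewrite /nlft_range big_geq.
have [pa [pb [h1 _]]] := IH (ltnW iN).
set n := ((2 * N).+1 - i.+1)%N.
have nE : ((2 * N).+1 - i)%N = n.+1 by rewrite /n; lia.
rewrite nE in h1.
have nN : (n < (2 * N).+1)%N by rewrite /n; lia.
have [|| h4 h5] := @su2_cons R F (n%:Z - N%:Z) _ _ _ _ _ _ _ _ h1; [lia|lia|].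
set s := nlft_scale _ in h4 h5.
have ck : nlft_const n (2 * N).+1 = s * nlft_const n.+1 (2 * N).+1.
  by rewrite /nlft_const big_ltn.
do 2 eexists; split.
- rewrite ck; apply: su2_poly_ext h4 => z.
  by rewrite /nlft_range [in RHS]big_ltn.
- by move=> _; rewrite h5 ck.
Qed.

Lemma nlft_const_bounds m n (S : R) : (n <= (2 * N).+1)%N ->
  (forall s : seq int, uniq s -> \sum_(k <- s) normc (F k) ^+ 2 <= S) ->
  expR (- S) <= nlft_const m n <= 1.
Proof.
move=> nN hS; apply/andP; split.
  apply: (@le_trans _ _ (\prod_(m <= j < n) expR (- normc (F (j%:Z - N%:Z)) ^+ 2))).
    rewrite -(big_morph _ (@expRD R) (@expR0 R)) ler_expR sumrN lerN2.
    rewrite -(big_map (fun j : nat => j%:Z - N%:Z) xpredT (fun k => normc (F k) ^+ 2)).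
    by apply: hS; rewrite map_inj_uniq ?iota_uniq// => i j /addIr[].
  by apply: ler_prod => j _; rewrite expR_ge0 nlft_scale_ge.
apply: (@le_trans _ _ (\prod_(m <= j < n) 1)); last by rewrite big1_eq.
by apply: ler_prod => j _; rewrite ltW ?nlft_scale_gt0 ?nlft_scale_le1.
Qed.

End NlftProducts.

(** * The linear systems satisfied by the tails *)

Section Majorant.
Variables (R : realType) (D om : nat -> R) (n0 L : nat) (B0 : R).
Hypothesis D0 : forall k, 0 <= D k.
Hypothesis om1 : forall k, 1 <= om k.
Hypothesis omD : forall j l, om j <= om (j + l)%N * om l.
Hypothesis B00 : 0 <= B0.
Hypothesis Dsmall : forall K, \sum_(n0 <= k < K) D k * om k <= 2^-1.

Let om0 k : 0 <= om k. Proof. exact: le_trans (om1 k). Qed.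
Hint Resolve om0 D0 : core.

(** Entries below n0 are removed, which leaves a weighted mass of at most 1/2; in the equations for
    a cut n >= n0 only the remaining entries occur. *)
Definition tailD k := if (n0 <= k)%N then D k else 0.

Lemma tailD_ge0 k : 0 <= tailD k. Proof. by rewrite /tailD; case: ifP. Qed.
Hint Resolve tailD_ge0 : core.

Lemma tailD_weighted l : \sum_(j < L) tailD (j + l)%N * om (j + l)%N <= 2^-1.
Proof.
apply: le_trans (Dsmall (L + l)).
set f := fun k => tailD k * om k.
have f0 k : 0 <= f k by rewrite mulr_ge0.
rewrite -(big_mkord xpredT (fun j => f (j + l)%N)).
have -> : \sum_(0 <= j < L) f (j + l)%N = \sum_(l <= i < L + l) f i.
  by rewrite -{2}[l]add0n big_addn addnK.
have -> : \sum_(n0 <= k < L + l) D k * om k = \sum_(0 <= k < L + l) f k.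
  rewrite (@big_nat_widenl _ _ _ n0 0)// big_mkcond; apply: eq_bigr => k _.
  by rewrite /f /tailD /=; case: ifP; rewrite ?mul0r.
rewrite (@big_cat_nat _ _ _ l 0 (L + l)) ?leq_addl//= lerDr.
by apply: sumr_ge0.
Qed.

Lemma tailD_sum l : \sum_(j < L) tailD (j + l)%N <= 2^-1.
Proof.
apply: le_trans (tailD_weighted l); apply: ler_sum => j _.
by rewrite ler_peMr.
Qed.

Definition conv_tail (A : nat -> R) j := \sum_(l < L) tailD (j + l)%N * A l.

Definition wnorm (A : nat -> R) := \sum_(l < L) A l * om l.

Lemma conv_tail_ge0 A j : (forall l, 0 <= A l) -> 0 <= conv_tail A j.
Proof. by move=> A0; apply: sumr_ge0 => l _; rewrite mulr_ge0. Qed.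

(** The inequality om j <= om (j + l) om l moves the output weight onto the kernel and the input;
    the kernel then contributes at most 1/2 for each l. *)
Lemma wnorm_conv_tail A : (forall l, 0 <= A l) -> wnorm (conv_tail A) <= 2^-1 * wnorm A.
Proof.
move=> A0; rewrite /wnorm /conv_tail.
under eq_bigr do rewrite mulr_suml.
rewrite exchange_big mulr_sumr /=; apply: ler_sum => l _.
apply: (@le_trans _ _ ((\sum_(j < L) tailD (j + l)%N * om (j + l)%N) * (A l * om l))).
  rewrite mulr_suml; apply: ler_sum => j _.
  by rewrite [leRHS]mulrACA ler_wpM2l// mulr_ge0.
by rewrite ler_wpM2r ?tailD_weighted// mulr_ge0.
Qed.

(* Independent of the cut n, hence the summability in n of the resulting bound. *)
Fixpoint majorant (k : nat) (l : nat) : R :=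
  if k is k'.+1 then B0 * (l == 0%N)%:R + conv_tail (conv_tail (majorant k')) l else 0.

Lemma majorant_ge0 k l : 0 <= majorant k l.
Proof.
elim: k l => [//|k IH] l /=; apply: addr_ge0; first by rewrite mulr_ge0.
by apply: conv_tail_ge0 => j; exact: conv_tail_ge0.
Qed.

(** Two contractions give a factor 1/4, and the bound 2 B0 om(0) is stable under x -> B0 om(0) +
    x/4. *)
Lemma wnorm_majorant k : wnorm (majorant k) <= 2 * B0 * om 0.
Proof.
elim: k => [|k IH].
  by rewrite /wnorm big1 ?mulr_ge0// => l _; rewrite mul0r.
have h1 := wnorm_conv_tail (fun l => conv_tail_ge0 l (majorant_ge0 k)).
have h2 := wnorm_conv_tail (majorant_ge0 k).
have h3 : wnorm (fun l => B0 * (l == 0%N)%:R) <= B0 * om 0.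
  rewrite /wnorm; case: L => [|L']; first by rewrite big_ord0 mulr_ge0.
  by rewrite big_ord_recl /= mulr1 big1 ?addr0// => l _; rewrite mulr0 mul0r.
have -> : wnorm (majorant k.+1) = wnorm (fun l => B0 * (l == 0%N)%:R) +
    wnorm (conv_tail (conv_tail (majorant k))).
  by rewrite /wnorm -big_split /=; apply: eq_bigr => l _; rewrite mulrDl.
have : 0 <= B0 * om 0 by rewrite mulr_ge0.
move: IH h1 h2 h3; rewrite -!mulrA; lra.
Qed.

(** Here x comes from the diagonal entry and y from the off-diagonal one. Substituting one
    inequality into the other gives a recursion for x. It is silent on x 0, for which only the bound
    B0 is available: hence the source term of [majorant]. The remainder follows T -> T/4 + 3e/2,
    which stays below B0/4^k + 4e. *)
Lemma majorant_bound (n : nat) (x y : nat -> R) (e : R) (k : nat) :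
  (n0 <= n)%N -> 0 <= e -> (forall l, 0 <= x l <= B0) -> (forall j, 0 <= y j) ->
  (forall j, (n <= j)%N -> y j <= \sum_(l < L) x l * D (j + l)%N + e) ->
  (forall l, (0 < l)%N -> x l <= \sum_(j < L | (n <= j)%N) y j * D (l + j)%N + e) ->
  forall j, (n <= j)%N ->
    y j <= conv_tail (majorant k) j + (B0 / 4 ^+ k + 5 * e).
Proof.
move=> n0n e0 hx y0 hy hxy.
have stepy A T : (forall l, x l <= A l + T) -> 0 <= T ->
    forall j, (n <= j)%N -> y j <= conv_tail A j + (T / 2 + e).
  move=> hA T0 j nj; apply: (le_trans (hy j nj)); rewrite addrA lerD2r.
  apply: (@le_trans _ _ (\sum_(l < L) (tailD (j + l)%N * A l + tailD (j + l)%N * T))).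
    apply: ler_sum => l _; rewrite -mulrDr mulrC /tailD ifT ?ler_wpM2l//.
    by rewrite (leq_trans n0n)// (leq_trans nj)// leq_addr.
  rewrite big_split /= lerD2l -mulr_suml mulrC ler_wpM2l//.
  by under eq_bigr do rewrite addnC; exact: tailD_sum.
have main : forall l, x l <= majorant k l + (B0 / 4 ^+ k + 4 * e).
  elim: k => [|k IH] l.
    have /andP[_ h] := hx l.
    by rewrite /= add0r expr0 divr1 (le_trans h)// lerDl mulr_ge0.
  have T0 : 0 <= B0 / 4 ^+ k + 4 * e by rewrite addr_ge0 ?mulr_ge0// invr_ge0 exprn_ge0.
  have hyk := stepy _ _ IH T0.
  have Ek : B0 / 4 ^+ k.+1 = (B0 / 4 ^+ k) / 4 by rewrite exprSr invfM mulrA.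
  have Tk : 0 <= B0 / 4 ^+ k.+1 + 4 * e by rewrite addr_ge0 ?mulr_ge0// invr_ge0 exprn_ge0.
  have c0 : 0 <= conv_tail (conv_tail (majorant k)) l.
    by apply: conv_tail_ge0 => i; apply: conv_tail_ge0; exact: majorant_ge0.
  case: l c0 => [|l] c0.
    have /andP[_ x0] := hx 0%N; rewrite (le_trans x0)//= mulr1.
    by rewrite -addrA lerDl; exact: addr_ge0 c0 Tk.
  rewrite /= mulr0 add0r (le_trans (hxy l.+1 isT))//.
  set T := B0 / 4 ^+ k + 4 * e in T0 hyk *.
  apply: (@le_trans _ _ (conv_tail (conv_tail (majorant k)) l.+1 + 2^-1 * (T / 2 + e) + e)); last first.
    by rewrite -addrA lerD2l Ek /T; lra.
  rewrite lerD2r big_mkcond /=.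
  apply: (@le_trans _ _ (\sum_(j < L) (tailD (l.+1 + j)%N * conv_tail (majorant k) j +
     tailD (j + l.+1)%N * (T / 2 + e)))).
    apply: ler_sum => j _.
    have Te : 0 <= T / 2 + e by rewrite addr_ge0// divr_ge0.
    have cj : 0 <= conv_tail (majorant k) j by apply: conv_tail_ge0; exact: majorant_ge0.
    case: ifP => nj; last by rewrite addr_ge0// mulr_ge0.
    rewrite [(j + _)%N]addnC -mulrDr mulrC /tailD ifT ?ler_wpM2l//; first exact: hyk.
    by rewrite (leq_trans n0n)// (leq_trans nj)// leq_addl.
  rewrite big_split /= lerD2l -mulr_suml ler_wpM2r ?tailD_sum//.
  by rewrite addr_ge0// divr_ge0.
move=> j nj.
have T0 : 0 <= B0 / 4 ^+ k + 4 * e by rewrite addr_ge0 ?mulr_ge0// invr_ge0 exprn_ge0.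
apply: (le_trans (stepy _ _ main T0 j nj)).
have b0 : 0 <= B0 / 4 ^+ k by rewrite divr_ge0// exprn_ge0.
by rewrite lerD2l; lra.
Qed.

End Majorant.

(** * Passage from truncations to the L^2 limit *)

Section L2Limits.
Variable R : realType.
Local Notation I01 := (`[0%R, 1%R]%classic : set R).
Implicit Types (f g : R[i] -> R[i]).

Lemma cvg_L2T_small (f_ : nat -> R[i] -> R[i]) f :
  (forall n, measurable_T (f_ n)) -> measurable_T f -> cvg_L2T f_ f ->
  forall e, 0 < e -> exists K : nat, forall n, (K <= n)%N ->
    [/\ integrable_T (fun z => f_ n z - f z),
        integrable01 (fun t => normc (f_ n (circ t) - f (circ t)) ^+ 2),
        int01 (fun t => normc (f_ n (circ t) - f (circ t)) ^+ 2) <= e &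
        norm1_T (fun z => f_ n z - f z) <= e].
Proof.
move=> mf_ mf hc e e0.
(* The measure has mass 1, so x <= e/2 + x^2/(e/2) turns a small mean square into a small mean;
   (e/2)^2 makes the second term at most e/2. *)
pose d := Num.min e (e / 2 * (e / 2)).
have e2 : 0 < e / 2 by rewrite divr_gt0.
have d0 : 0 < d by rewrite lt_min e0 mulr_gt0.
move: hc => /fine_cvgP[[K1 _ h1] /cvgrPdist_le /(_ _ d0)[K2 _ h2]].
exists (maxn K1 K2) => n; rewrite geq_max => /andP[n1 n2].
have md : measurable_T (fun z => f_ n z - f z) by exact: measurable_TB.
have mn := measurable_T_normc md.
have m2 := measurable_funX 2 mn.
have i2 : integrable01 (fun t => normc (f_ n (circ t) - f (circ t)) ^+ 2).
  apply/integrableP; split; first exact/measurable_EFinP.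
  under eq_integral do rewrite /= ger0_norm ?sqr_ge0//.
  by have := h1 n n1; rewrite fin_numE => /andP[_]; rewrite ltey.
have s2 : int01 (fun t => normc (f_ n (circ t) - f (circ t)) ^+ 2) <= d.
  have := h2 n n2; rewrite /= sub0r normrN; apply: le_trans; exact: ler_norm.
have dle t : normc (f_ n (circ t) - f (circ t)) <=
    e / 2 + (e / 2)^-1 * normc (f_ n (circ t) - f (circ t)) ^+ 2.
  set x := normc _; have x0 : 0 <= x by exact: normc_ge0.
  have [xe|xe] := leP x (e / 2).
    by rewrite (le_trans xe)// lerDl mulr_ge0 ?sqr_ge0// invr_ge0 ltW.
  apply: ler_wpDl; first exact: ltW.
  by rewrite mulrC ler_pdivlMr// expr2 ler_wpM2l// ltW.
have ir : integrable01 (fun t => e / 2 + (e / 2)^-1 * normc (f_ n (circ t) - f (circ t)) ^+ 2).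
  by apply: integrable01D; [exact: integrable01_cst|exact: integrable01Z].
have i1 : integrable_T (fun z => f_ n z - f z).
  by apply: (integrable_T_le md _ ir) => y _; exact: dle.
split=> //; first by rewrite (le_trans s2)// ge_min lexx.
apply: (@le_trans _ _ (int01 (fun t => e / 2 + (e / 2)^-1 * normc (f_ n (circ t) - f (circ t)) ^+ 2))).
  by apply: le_int01 => [||y _]; [exact: (integrable_T_normc i1)|exact: ir|exact: dle].
rewrite int01D; [|exact: integrable01_cst|exact: integrable01Z].
rewrite int01_cst int01Z// [leRHS]splitr lerD2l mulrC ler_pdivrMr//.
by rewrite (le_trans s2)// ge_min lexx orbT.
Qed.

Variable F : int -> R[i].
Variables a b : R[i] -> R[i].
Hypothesis ab : is_nlft F a b.

Lemma nlft_poly N : exists pa pb,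
  [/\ forall t, nlft_trunc F N (circ t) 0 0 = tp_eval pa (circ t),
      forall t, nlft_trunc F N (circ t) 0 1 = tp_eval pb (circ t),
      forall t, normc (tp_eval pa (circ t)) ^+ 2 + normc (tp_eval pb (circ t)) ^+ 2 = 1 &
      forall w, (forall n, 1 <= w n) -> (forall n, w (- n) = w n) ->
        (forall n k, w (n + k) <= w n * w k) ->
        tp_norm w pa + tp_norm w pb <=
        w 0 * \prod_(0 <= j < (2 * N).+1) (1 + normc (F (j%:Z - N%:Z)) * w (j%:Z - N%:Z))].
Proof.
have [pa [pb [[h1 h2 h3 h4 h5 h6 h7 h8] _ h9]]] := nlft_range_left F N (2 * N).+1.
by exists pa, pb; split.
Qed.

Lemma nlft_trunc_measurable N :
  measurable_T (fun z => nlft_trunc F N z 0 0) /\ measurable_T (fun z => nlft_trunc F N z 0 1).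
Proof.
have [pa [pb [h1 h2 _ _]]] := nlft_poly N.
split; [apply: measurable_T_ext (measurable_tp_eval pa)|apply: measurable_T_ext (measurable_tp_eval pb)].
  by move=> t; rewrite h1.
by move=> t; rewrite h2.
Qed.

Lemma nlft_approx e : 0 < e -> exists K : nat, forall N, (K <= N)%N ->
  [/\ integrable_T (fun z => nlft_trunc F N z 0 0 - a z),
      integrable_T (fun z => nlft_trunc F N z 0 1 - b z),
      norm1_T (fun z => nlft_trunc F N z 0 0 - a z) <= e &
      norm1_T (fun z => nlft_trunc F N z 0 1 - b z) <= e].
Proof.
move=> e0; have [ma mb ha hb] := ab.
have [K1 h1] := cvg_L2T_small (fun N => (nlft_trunc_measurable N).1) ma ha e0.
have [K2 h2] := cvg_L2T_small (fun N => (nlft_trunc_measurable N).2) mb hb e0.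
exists (maxn K1 K2) => N; rewrite geq_max => /andP[/h1[x1 _ _ x2] /h2[y1 _ _ y2]].
by split.
Qed.

Lemma nlft_integrable : integrable_T a /\ integrable_T b.
Proof.
have [K /(_ K (leqnn K)) [h1 h2 _ _]] := nlft_approx ltr01.
have [pa [pb [e1 e2 _ _]]] := nlft_poly K.
split.
  apply: integrable_T_ext (integrable_TB (integrable_tp_eval pa) h1) => t.
  by rewrite e1 subKr.
apply: integrable_T_ext (integrable_TB (integrable_tp_eval pb) h2) => t.
by rewrite e2 subKr.
Qed.

(** The identity holds for the truncations, and squared moduli converge in L^1, since they differ by
    at most |y - x|^2 + 2|y - x| when |y| <= 1. Each of the two entries costs e + 2e. *)
Lemma nlft_unitary : ae01 (fun t => normc (a (circ t)) ^+ 2 + normc (b (circ t)) ^+ 2 = 1).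
Proof.
have [ma mb ha hb] := ab.
pose q t := normc (a (circ t)) ^+ 2 + normc (b (circ t)) ^+ 2 - 1.
have mq : measurable_fun I01 q.
  apply: measurable_funB; last exact: measurable_cst.
  by apply: measurable_funD; apply: measurable_funX; exact: measurable_T_normc.
have key e : 0 < e -> integrable01 q /\ int01 (fun t => `|q t|) <= 6 * e.
  move=> e0.
  have [K1 h1] := cvg_L2T_small (fun N => (nlft_trunc_measurable N).1) ma ha e0.
  have [K2 h2] := cvg_L2T_small (fun N => (nlft_trunc_measurable N).2) mb hb e0.
  have [x1 x2 x3 x4] := h1 _ (leq_maxl K1 K2).
  have [y1 y2 y3 y4] := h2 _ (leq_maxr K1 K2).
  set N := maxn K1 K2 in x1 x2 x3 x4 y1 y2 y3 y4.
  have [pa [pb [e1 e2 e3 _]]] := nlft_poly N.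
  pose da t := normc (nlft_trunc F N (circ t) 0 0 - a (circ t)).
  pose db t := normc (nlft_trunc F N (circ t) 0 1 - b (circ t)).
  have ida : integrable01 da by exact: (integrable_T_normc x1).
  have idb : integrable01 db by exact: (integrable_T_normc y1).
  have iA : integrable01 (fun t => da t ^+ 2 + 2 * da t).
    by apply: integrable01D => //; exact: integrable01Z.
  have iB : integrable01 (fun t => db t ^+ 2 + 2 * db t).
    by apply: integrable01D => //; exact: integrable01Z.
  have qle t : `|q t| <= (da t ^+ 2 + 2 * da t) + (db t ^+ 2 + 2 * db t).
    have sq (x y : R[i]) : normc y <= 1 ->
        `|normc x ^+ 2 - normc y ^+ 2| <= normc (y - x) ^+ 2 + 2 * normc (y - x).
      move=> y1'; have := normc_ler_dist x y; rewrite normc_distC => dxy.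
      have nx := normc_ge0 x; have ny := normc_ge0 y.
      rewrite subr_sqr normrM.
      have sle : `|normc x + normc y| <= normc (y - x) + 2.
        rewrite ger0_norm ?addr_ge0//; have := ler_norm (normc x - normc y); lra.
      apply: (le_trans (ler_pM (normr_ge0 _) (normr_ge0 _) dxy sle)).
      by rewrite mulrDr expr2 mulrC [2 * _]mulrC.
    have na : normc (tp_eval pa (circ t)) <= 1.
      by rewrite -(@ler_sqr R) ?nnegrE ?normc_ge0// expr1n -(e3 t) lerDl sqr_ge0.
    have nb : normc (tp_eval pb (circ t)) <= 1.
      by rewrite -(@ler_sqr R) ?nnegrE ?normc_ge0// expr1n -(e3 t) lerDr sqr_ge0.
    rewrite /q -[X in _ - X](e3 t) /da /db e1 e2.
    have -> (x y z y' : R) : x + y - (z + y') = (x - z) + (y - y') by ring.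
    by apply: (le_trans (ler_normD _ _)); apply: lerD; [exact: sq|exact: sq].
  have iAB := integrable01D iA iB.
  have iq : integrable01 q by apply: integrable01_le mq _ iAB => t _; exact: qle.
  split=> //; apply: (@le_trans _ _ (int01 (fun t => (da t ^+ 2 + 2 * da t) + (db t ^+ 2 + 2 * db t)))).
    by apply: le_int01 => //; exact: integrable01_norm.
  rewrite int01D// int01D ?int01D//; [|exact: integrable01Z|exact: integrable01Z].
  rewrite !int01Z//; move: x3 x4 y3 y4; rewrite /norm1_T -/da -/db; lra.
have [iq _] := key 1 ltr01.
have q0 : int01 (fun t => `|q t|) = 0.
  apply/le_anti/andP; split; last by apply: int01_ge0.
  apply/ler_addgt0Pr => e e0; rewrite add0r.
  have e6 : 0 < e / 6 by rewrite divr_gt0.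
  by have [_ h] := key _ e6; rewrite (le_trans h)// mulrC divfK.
by apply: ae01_mono (int01_eq0_ae iq q0) => t _ /eqP; rewrite subr_eq0 => /eqP.
Qed.

Lemma nlft_wiener w : (forall n, 1 <= w n) -> (forall n, w (- n) = w n) ->
  (forall n k, w (n + k) <= w n * w k) -> ell1 w F ->
  ell1 w (fourier a) /\ ell1 w (fourier b).
Proof.
move=> w1 wN wM hF; have w0 n : 0 <= w n by exact: le_trans (w1 n).
have F0 n : 0 <= normc (F n) * w n by rewrite mulr_ge0 ?normc_ge0.
have [M M0 [hM _]] := esum_finite_bound hF F0.
(* 1 + x <= e^x turns the product into the exponential of the weighted sum, so the bound is the same
   for all N. *)
have bound N : w 0 * \prod_(0 <= j < (2 * N).+1) (1 + normc (F (j%:Z - N%:Z)) * w (j%:Z - N%:Z))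
    <= w 0 * expR M.
  rewrite ler_wpM2l//.
  apply: (@le_trans _ _ (\prod_(0 <= j < (2 * N).+1) expR (normc (F (j%:Z - N%:Z)) * w (j%:Z - N%:Z)))).
    by apply: ler_prod => j _; rewrite addr_ge0//= expR_ge1Dx.
  rewrite -(big_morph _ (@expRD R) (@expR0 R)) ler_expR.
  rewrite -(big_map (fun j : nat => j%:Z - N%:Z) xpredT (fun k => normc (F k) * w k)).
  by apply: hM; rewrite map_inj_uniq ?iota_uniq// => i j /addIr[].
have [ia ib] := nlft_integrable.
split; apply: (@ell1_fourier_lim _ w w1 (w 0 * expR M)) => // e e0;
    have [K /(_ K (leqnn K)) [h1 h2 h3 h4]] := nlft_approx e0;
    have [pa [pb [e1 e2 e3 /(_ w w1 wN wM) e4]]] := nlft_poly K.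
  exists pa; first by rewrite (le_trans _ (bound K))// (le_trans _ e4)// lerDl tp_norm_ge0.
  by rewrite (le_trans _ h3)// le_eqVlt; apply/orP; left; apply/eqP/eq_int01 => t _; rewrite e1.
exists pb; first by rewrite (le_trans _ (bound K))// (le_trans _ e4)// lerDr tp_norm_ge0.
by rewrite (le_trans _ h4)// le_eqVlt; apply/orP; left; apply/eqP/eq_int01 => t _; rewrite e2.
Qed.

End L2Limits.

(** * From approximate linear systems to a weighted l^1 bound *)

Section Tails.
Variable R : realType.
Implicit Types (f g h : R[i] -> R[i]) (p q : tpoly R).

Lemma fourier_tp_vanish (Q : pred int) p f n : integrable_T f -> tp_supp Q p ->
  (forall k, Q k -> fourier f (n - k) = 0) ->
  fourier (fun z => tp_eval p z * f z) n = 0.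
Proof.
move=> hf /allP hp h; rewrite fourier_tp_mul// big_seq big1// => x /hp xQ.
by rewrite h ?mulr0.
Qed.

(** [sg] will be 1 or -1, according to whether the polynomial has its spectrum in the nonnegative or
    the nonpositive indices. The convolution sum is regrouped by exponent so that true coefficients
    appear. *)
Lemma normc_fourier_tp (sg : int) p f n (L : nat) :
  sg != 0 -> integrable_T f ->
  tp_supp (fun k => [exists l : 'I_L, k == sg * (l : nat)%:Z]) p ->
  normc (fourier (fun z => tp_eval p z * f z) n) <=
  \sum_(l < L) normc (tp_coef p (sg * (l : nat)%:Z)) * normc (fourier f (n - sg * (l : nat)%:Z)).
Proof.
move=> sg0 hf /allP hp; rewrite fourier_tp_mul//.
have -> : \sum_(x <- p) x.1 * fourier f (n - x.2) =
   \sum_(l < L) tp_coef p (sg * (l : nat)%:Z) * fourier f (n - sg * (l : nat)%:Z).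
  transitivity (\sum_(x <- p) \sum_(l < L)
     (if x.2 == sg * (l : nat)%:Z then x.1 * fourier f (n - x.2) else 0)).
    rewrite big_seq [RHS]big_seq; apply: eq_bigr => x /hp /existsP[l /eqP xl].
    rewrite (bigD1 l)//= xl eqxx big1 ?addr0// => i /negbTE il.
    rewrite (inj_eq (mulfI sg0)) eqz_nat.
    by rewrite (_ : (l == i :> nat) = false)// eq_sym; exact: il.
  rewrite exchange_big /=; apply: eq_bigr => l _.
  rewrite /tp_coef mulr_suml [RHS]big_mkcond /=; apply: eq_bigr => x _.
  by case: eqP => [->|].
apply: (le_trans (normc_sum _ _ _)); apply: ler_sum => l _.
by rewrite Normc.normcM.
Qed.

(** One equation of the system: lhs is p h + q up to an L^1 error, and its n-th coefficient
    vanishes. The constant 4 is the 2 of [normc_fourier] times 2 for the errors of both matrix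
    entries. *)
Lemma coef_estimate (Bg e : R) lhs h dA dB p q n : 0 <= Bg ->
  integrable_T lhs -> integrable_T h -> integrable_T dA -> integrable_T dB ->
  fourier lhs n = 0 ->
  (forall t, normc (lhs (circ t) - (tp_eval p (circ t) * h (circ t) + tp_eval q (circ t))) <=
     Bg * (normc (dA (circ t)) + normc (dB (circ t)))) ->
  norm1_T dA <= e -> norm1_T dB <= e ->
  normc (tp_coef q n) <= normc (fourier (fun z => tp_eval p z * h z) n) + 4 * Bg * e.
Proof.
move=> B0 il ih iA iB l0 hle hA hB.
have ip := tp_integrableM p ih; have iq := integrable_tp_eval q.
have ipq := integrable_TD ip iq.
have ierr := integrable_TB il ipq.
have E : tp_coef q n = - fourier (fun z => tp_eval p z * h z) n -
    fourier (fun z => lhs z - (tp_eval p z * h z + tp_eval q z)) n.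
  by rewrite fourierB// fourierD// l0 fourier_tp; ring.
rewrite E (le_trans (normc_subr _ _))// normc_opp lerD2l.
rewrite (le_trans (normc_fourier _ ierr))//.
rewrite (_ : 4 * Bg * e = 2 * (Bg * (e + e))); last by ring.
rewrite ler_wpM2l//.
apply: (@le_trans _ _ (int01 (fun t => Bg * (normc (dA (circ t)) + normc (dB (circ t)))))).
  apply: le_int01; first exact: (integrable_T_normc ierr).
    by apply: integrable01Z; apply: integrable01D; exact: integrable_T_normc.
  by move=> t _; exact: hle.
rewrite int01Z; last by apply: integrable01D; exact: integrable_T_normc.
rewrite int01D; [|exact: integrable_T_normc..].
by rewrite ler_wpM2l// lerD.
Qed.

(** The order of choices is essential: first the range of n to be summed, up to K; then the number k
    of iterations and the error, in terms of the total weight [W] of that range; the truncation N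
    last. The majorant depends on N through its length, but the bound on its weighted norm does
    not. *)
Lemma tail_bound (Fn D om : nat -> R) (kap : R) :
  0 < kap -> (forall n, 0 <= Fn n) -> (forall k, 0 <= D k) -> (forall k, 1 <= om k) ->
  (forall j l, om j <= om (j + l)%N * om l) ->
  (exists n0, forall K, \sum_(n0 <= k < K) D k * om k <= 2^-1) ->
  (forall e, 0 < e -> exists K : nat, forall N, (K <= N)%N -> forall n, (n <= N)%N ->
     exists x y : nat -> R,
     [/\ forall l, 0 <= x l <= 2, forall j, 0 <= y j,
      forall j, (n <= j)%N -> y j <= \sum_(l < (2 * N).+2) x l * D (j + l)%N + e,
      forall l, (0 < l)%N -> x l <= \sum_(j < (2 * N).+2 | (n <= j)%N) y j * D (l + j)%N + e
      & kap * Fn n <= y n]) ->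
  exists n0 C, forall K, \sum_(n0 <= k < K) Fn k * om k <= C.
Proof.
move=> kap0 Fn0 D0 om1 omD [n0 hn0] hsys.
have om0 k : 0 <= om k by exact: le_trans (om1 k).
exists n0, (kap^-1 * (2 * om 0%N + 1)) => K.
rewrite ler_pdivlMl// mulr_sumr.
set W := \sum_(n0 <= k < K) om k.
have W0 : 0 <= W by apply: sumr_ge0.
have W1 : 0 < W + 1 by rewrite ltr_wpDl.
(* The error at each n is at most 2/4^k + 5(d/5) <= 2d, and 2dW <= 1: this is the summand 1 in the
   final constant. *)
pose d := (W + 1)^-1 / 2; have d0 : 0 < d by rewrite divr_gt0// invr_gt0.
have [k hk] : exists k, 2 / 4 ^+ k <= d.
  have : (4^-1 : R) ^+ n @[n --> \oo] --> (0 : R).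
    by apply: cvg_expr; rewrite ger0_norm ?invf_lt1// ?ltr1n.
  have d2 : 0 < d / 2 by rewrite divr_gt0.
  move/cvgrPdist_le => /(_ _ d2)[k _ /(_ k (leqnn _))] /=.
  rewrite sub0r normrN => h; exists k; rewrite -exprVn mulrC -ler_pdivlMr//.
  exact: le_trans (ler_norm _) h.
have [K0 hK0] := hsys (d / 5) (divr_gt0 d0 (ltr0n _ 5)).
set N := maxn K0 K; have {}hK0 := hK0 N (leq_maxl _ _).
pose L := (2 * N).+2.
pose A := conv_tail D n0 L (majorant D n0 L 2 k).
have two0 : 0 <= 2 :> R by [].
have M0 := majorant_ge0 (D := D) n0 L D0 two0 k.
have A0 j : 0 <= A j by exact: conv_tail_ge0.
have AW : wnorm om L A <= 2 * om 0%N.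
  have h1 := @wnorm_conv_tail R D om n0 L D0 om1 omD hn0 _ M0.
  have h2 := wnorm_majorant L D0 om1 omD two0 hn0 k.
  rewrite -/A in h1; move: h1 h2; lra.
apply: (@le_trans _ _ (\sum_(n0 <= i < K) (A i * om i + 2 * d * om i))).
  rewrite big_seq [leRHS]big_seq; apply: ler_sum => n; rewrite mem_index_iota => /andP[nn nK].
  have nN : (n <= N)%N by rewrite (leq_trans (ltnW nK))// leq_maxr.
  have [x [y [hx hy hyx hxy hF]]] := hK0 n nN.
  rewrite mulrA -mulrDl ler_wpM2r// (le_trans hF)//.
  have d5 : 0 <= d / 5 by rewrite divr_ge0// ltW.
  have := majorant_bound D0 om1 two0 hn0 k nn d5 hx hy hyx hxy (leqnn n).
  rewrite -/L -/A => /le_trans; apply; rewrite lerD2l.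
  move: hk; lra.
rewrite big_split /= lerD//.
  apply: le_trans AW; rewrite /wnorm -(big_mkord xpredT (fun i => A i * om i)).
  have [nK|nK] := leqP n0 K; last first.
    rewrite big_geq ?(ltnW nK)//; apply: sumr_ge0 => i _; exact: mulr_ge0.
  have KL : (K <= L)%N.
    by rewrite /L /N; have := leq_maxr K0 K; lia.
  rewrite (@big_cat_nat _ _ _ n0 0 L)//=; last exact: leq_trans KL.
  rewrite (@big_cat_nat _ _ _ K n0 L)//=.
  have p1 : 0 <= \sum_(0 <= i < n0) A i * om i by apply: sumr_ge0 => i _; exact: mulr_ge0.
  have p2 : 0 <= \sum_(K <= i < L) A i * om i by apply: sumr_ge0 => i _; exact: mulr_ge0.
  by rewrite addrCA lerDl addr_ge0.
rewrite -mulr_sumr -/W /d mulrCA divff// mulr1 mulrC ler_pdivrMr// mul1r lerDl.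
exact: ler01.
Qed.

End Tails.

(** * The two linear systems for the truncated transform *)

Section Systems.
Variables (R : realType) (F : int -> R[i]) (S : R).
Hypothesis hS : forall s : seq int, uniq s -> \sum_(k <- s) normc (F k) ^+ 2 <= S.
(** [al] and [be] are representatives of a^* and b, and [g] is the inverse of [al], with
    coefficients on indices >= 0 only. The relation between [g] and [al] holds at every point of the
    circle, which keeps the algebra below free of null sets. *)
Variables (al be g : R[i] -> R[i]) (Bg : R).
Hypothesis ibe : integrable_T be.
Hypothesis mg : measurable_T g.
Hypothesis gB : forall t, normc (g (circ t)) <= Bg.
Hypothesis gal : forall t, g (circ t) * al (circ t) = 1.
Hypothesis g0 : forall n, n < 0 -> fourier g n = 0.
Local Notation dA N := (fun z => nlft_trunc F N z 0 0 - Num.conj (al z)).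
Local Notation dB N := (fun z => nlft_trunc F N z 0 1 - be z).
Hypothesis conv : forall e, 0 < e -> exists K : nat, forall N, (K <= N)%N ->
  [/\ integrable_T (dA N), integrable_T (dB N), norm1_T (dA N) <= e & norm1_T (dB N) <= e].

Let Bg0 : 0 <= Bg. Proof. exact: le_trans (normc_ge0 _) (gB 0). Qed.

Let ig : integrable_T g. Proof. exact: integrable_T_bounded mg gB. Qed.

Lemma su2_le1 (lo hi : int) (kap : R) M pa pb (t : R) : su2_poly lo hi kap M pa pb ->
  normc (tp_eval pa (circ t)) <= 1 /\ normc (tp_eval pb (circ t)) <= 1.
Proof.
move=> h; have e := su2_det h t; split.
  by rewrite -(@ler_sqr R) ?nnegrE ?normc_ge0// expr1n -e lerDl sqr_ge0.
by rewrite -(@ler_sqr R) ?nnegrE ?normc_ge0// expr1n -e lerDr sqr_ge0.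
Qed.

Lemma coef_le2 (p : tpoly R) n : (forall t, normc (tp_eval p (circ t)) <= 1) ->
  0 <= normc (tp_coef p n : R[i]) <= 2.
Proof.
move=> h; rewrite normc_ge0 /= -fourier_tp.
rewrite (le_trans (normc_fourier _ (integrable_tp_eval _)))// -[leRHS]mulr1 ler_wpM2l//.
by apply: norm1_T_bounded h; exact: measurable_tp_eval.
Qed.

Lemma nlft_trunc_entries N m pa pb pa' pb' lo hi kap lo' hi' kap' : (m <= (2 * N).+1)%N ->
  su2_poly lo hi kap (nlft_range F N 0 m) pa pb ->
  su2_poly lo' hi' kap' (nlft_range F N m (2 * N).+1) pa' pb' -> forall t,
  nlft_trunc F N (circ t) 0 0 = tp_eval pa (circ t) * tp_eval pa' (circ t) -
    tp_eval pb (circ t) * Num.conj (tp_eval pb' (circ t)) /\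
  nlft_trunc F N (circ t) 0 1 = tp_eval pa (circ t) * tp_eval pb' (circ t) +
    tp_eval pb (circ t) * Num.conj (tp_eval pa' (circ t)).
Proof.
move=> mN h h' t; rewrite !(nlft_trunc_split F _ mN) !mulmx2.
rewrite (su2_00 h) (su2_01 h) (su2_00 h') (su2_01 h') (su2_10 h') (su2_11 h').
by split=> //; rewrite mulrN.
Qed.

Lemma su2_conj (lo hi : int) (kap : R) M pa pb (t : R) : su2_poly lo hi kap M pa pb ->
  tp_eval pa (circ t) * Num.conj (tp_eval pa (circ t)) +
  tp_eval pb (circ t) * Num.conj (tp_eval pb (circ t)) = 1 :> R[i].
Proof. by move=> h; rewrite !mulz_conj -rmorphD (su2_det h t). Qed.

Lemma err_le (x u v d1 d2 : R[i]) : normc x <= Bg -> normc u <= 1 -> normc v <= 1 ->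
  normc (x * (u * d2 + v * d1)) <= Bg * (normc d1 + normc d2).
Proof.
move=> xB u1 v1; rewrite Normc.normcM; apply: ler_pM; rewrite ?normc_ge0//.
rewrite (le_trans (normc_addr _ _))// !Normc.normcM addrC.
by apply: lerD; apply: ler_piMl => //; exact: normc_ge0.
Qed.

(* N0, N1: first row of the product of the two halves; (X, B) is the half whose
   coefficients are estimated. *)
Lemma splitting_err (X Xc B Bc G al0 B' Y be0 N0 N1 : R[i]) :
  N0 = X * Y - Bc * B' -> N1 = Xc * B' + B * Y ->
  X * Xc + B * Bc = 1 -> G * al0 = 1 -> normc G <= Bg ->
  [/\ normc X <= 1, normc Xc <= 1, normc B <= 1 & normc Bc <= 1] ->
  normc (B' * G - (X * (be0 * G) - B)) <= Bg * (normc (N0 - al0) + normc (N1 - be0)) /\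
  normc (Y * G - (Bc * (be0 * G) + Xc)) <= Bg * (normc (N0 - al0) + normc (N1 - be0)).
Proof.
move=> -> -> det gl GB [X1 Xc1 b1 Bc1]; split.
  rewrite (_ : _ - _ = G * (X * (Xc * B' + B * Y - be0) + - B * (X * Y - Bc * B' - al0))).
    by apply: err_le; rewrite ?normc_opp.
  transitivity (G * (B' * (X * Xc + B * Bc)) - (X * (be0 * G) - B * (G * al0))); last by ring.
  by rewrite det gl !mulr1 [B' * G]mulrC.
rewrite (_ : _ - _ = G * (Bc * (Xc * B' + B * Y - be0) + Xc * (X * Y - Bc * B' - al0))).
  exact: err_le.
transitivity (G * (Y * (X * Xc + B * Bc)) - (Bc * (be0 * G) + Xc * (G * al0))); last by ring.
by rewrite det gl !mulr1 [Y * G]mulrC.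
Qed.

Lemma small_eps e : 0 < e -> 0 < e / (4 * Bg + 1) /\ 4 * Bg * (e / (4 * Bg + 1)) <= e.
Proof.
move=> e0; have h : 0 < 4 * Bg + 1 by rewrite ltr_wpDl// mulr_ge0.
split; first by rewrite divr_gt0.
by rewrite mulrA ler_pdivrMr// mulrC ler_pM2l// lerDl.
Qed.

(** x l and y j are the moduli of the coefficients of index -l and -j in the left product. Its
    factors run over the indices -N, ..., -n, so the top coefficient of its b is F(-n) times a
    normalising constant, which is at least exp(-S). *)
Lemma left_system e : 0 < e -> exists K : nat, forall N, (K <= N)%N -> forall n, (n <= N)%N ->
  exists x y : nat -> R,
  [/\ forall l, 0 <= x l <= 2, forall j, 0 <= y j,
   forall j, (n <= j)%N -> y j <= \sum_(l < (2 * N).+2) x l *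
      normc (fourier (fun z => be z * g z) (- (j + l)%N%:Z)) + e,
   forall l, (0 < l)%N -> x l <= \sum_(j < (2 * N).+2 | (n <= j)%N) y j *
      normc (fourier (fun z => be z * g z) (- (l + j)%N%:Z)) + e
   & expR (- S) * normc (F (- n%:Z)) <= y n].
Proof.
move=> e0; have [d0 hd] := small_eps e0; set d := e / (4 * Bg + 1) in d0 hd.
have [K hK] := conv d0; exists K => N KN n nN.
have [iA iB nA nB] := hK N KN.
set c := fun z => be z * g z.
have ic : integrable_T c.
  by apply: integrable_T_ext (integrable_TM mg gB ibe) => t; rewrite mulrC.
pose m := (N - n).+1.
have mN : (m <= (2 * N).+1)%N by rewrite /m; clear - nN; lia.
have [pa [pb [h hlead _]]] := nlft_range_left F N m.
have [pa' [pb' [h' _]]] := nlft_range_right F mN.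
have hiE : m%:Z - N%:Z - 1 = - n%:Z by rewrite /m; clear - nN; lia.
have lo'E : m%:Z - N%:Z = 1 - n%:Z by rewrite /m; clear - nN; lia.
rewrite hiE in h; rewrite lo'E in h'.
have entries := nlft_trunc_entries mN h h'.
have u1 t := su2_le1 t h.
have sa := su2_suppa h; have sb := su2_suppb h.
have sa' := su2_suppa h'; have sb' := su2_suppb h'.
have cb0 i : i > - n%:Z -> tp_coef pb i = 0.
  by move=> hi; apply: (tp_coef_supp sb); rewrite negb_and -!ltNge hi orbT.
have err t : let d1 := nlft_trunc F N (circ t) 0 0 - Num.conj (al (circ t)) in
    let d2 := nlft_trunc F N (circ t) 0 1 - be (circ t) in
    let G := g (circ t) in
    normc (tp_eval pb' (circ t) * G - (Num.conj (tp_eval pa (circ t)) * (be (circ t) * G)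
      - tp_eval pb (circ t))) <= Bg * (normc d1 + normc d2) /\
    normc (Num.conj (tp_eval pa' (circ t)) * G - (Num.conj (tp_eval pb (circ t)) *
      (be (circ t) * G) + tp_eval pa (circ t))) <= Bg * (normc d1 + normc d2).
  have [ua ub] := u1 t; have [eA eB] := entries t.
  (* The relations are written with a^* whereas [conv] controls a, so the diagonal error is
     conjugated first. *)
  rewrite /= -(normc_conj (_ - Num.conj (al _))) rmorphB /= conjCK.
  apply: (splitting_err _ _ _ _ (gal t) (gB t)); rewrite ?normc_conj//.
  - by rewrite eA rmorphB !rmorphM /= conjCK.
  - by rewrite mulrC; exact: su2_conj h.
exists (fun l => normc (tp_coef pa (- l%:Z))), (fun j => normc (tp_coef pb (- j%:Z))).
split.
- by move=> l; apply: coef_le2 => t; have [] := u1 t.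
- by move=> j; exact: normc_ge0.
- move=> j nj.
  pose lhs z := tp_eval pb' z * g z.
  (* [pb'] starts at index 1 - n and [g] at 0, so the indices -j <= -n are out of reach. *)
  have l0 : fourier lhs (- j%:Z) = 0.
    by apply: (fourier_tp_vanish ig sb') => k /andP[k1 k2]; apply: g0; clear - nj k1; lia.
  have := @coef_estimate R Bg d lhs c (dA N) (dB N) (tp_conj pa) (tp_scale (-1) pb) (- j%:Z)
    Bg0 (tp_integrableM _ ig) ic iA iB l0 _ nA nB.
  rewrite tp_coef_scale mulN1r normc_opp => est.
  apply: (le_trans (est _)).
    by move=> t; rewrite tp_eval_conj tp_eval_scale mulN1r; have [] := err t.
  rewrite lerD//.
  apply: (le_trans (@normc_fourier_tp R 1 _ _ _ (2 * N).+2 (oner_neq0 _) ic _)).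
    apply: tp_supp_conj sa => k /andP[k1 k2]; apply/existsP.
    have kl : (`|k| < (2 * N).+2)%N by (clear - k1 k2 nN; lia).
    by exists (Ordinal kl); rewrite /= mul1r; apply/eqP; clear - k2; lia.
  apply: ler_sum => l _; rewrite mul1r tp_coef_conj normc_conj.
  by rewrite (_ : - j%:Z - (l : nat)%:Z = - (j + l)%N%:Z)//; clear; lia.
- move=> l l0'.
  pose lhs z := tp_eval (tp_conj pa') z * g z.
  (* Both factors live on nonnegative indices; hence an equation for each l > 0, and none for l =
     0. *)
  have l0 : fourier lhs (- l%:Z) = 0.
    apply: (@fourier_tp_vanish R (fun k => 0 <= k) _ _ _ ig) => [|k k0]; last by apply: g0; clear - k0 l0'; lia.
    by apply: tp_supp_conj sa' => k /andP[k1 k2]; clear - k2; lia.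
  have := @coef_estimate R Bg d lhs c (dA N) (dB N) (tp_conj pb) pa (- l%:Z)
    Bg0 (tp_integrableM _ ig) ic iA iB l0 _ nA nB.
  move=> est; apply: (le_trans (est _)).
    by move=> t; rewrite /lhs !tp_eval_conj; have [] := err t.
  rewrite lerD//.
  apply: (le_trans (@normc_fourier_tp R 1 _ _ _ (2 * N).+2 (oner_neq0 _) ic _)).
    apply: tp_supp_conj sb => k /andP[k1 k2]; apply/existsP.
    have kl : (`|k| < (2 * N).+2)%N by (clear - k1 k2; lia).
    by exists (Ordinal kl); rewrite /= mul1r; apply/eqP; clear - k2; lia.
  rewrite [leRHS]big_mkcond; apply: ler_sum => j _; rewrite mul1r tp_coef_conj normc_conj.
  case: ifPn => nj.
    by rewrite (_ : - l%:Z - (j : nat)%:Z = - (l + j)%N%:Z)//; clear; lia.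
  by rewrite cb0 ?Normc.normc0 ?mul0r//; clear - nj; lia.
- have := hlead (N - n)%N erefl.
  have -> : (N - n)%N%:Z - N%:Z = - n%:Z by (clear - nN; lia).
  move=> ->; rewrite Normc.normcM mulrC ler_wpM2l ?normc_ge0//.
  have /andP[k1 k2] := @nlft_const_bounds R F N 0 m S mN hS.
  by rewrite normc_RtoC ger0_norm// (le_trans (expR_ge0 _) k1).
Qed.

(** The mirror image: the factors n, ..., N on the right of the cut are estimated, F(n) sits at the
    lowest index of their b, and the conjugate of [g], with coefficients on nonpositive indices,
    takes the place of [g]. *)
Lemma right_system e : 0 < e -> exists K : nat, forall N, (K <= N)%N -> forall n, (n <= N)%N ->
  exists x y : nat -> R,
  [/\ forall l, 0 <= x l <= 2, forall j, 0 <= y j,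
   forall j, (n <= j)%N -> y j <= \sum_(l < (2 * N).+2) x l *
      normc (fourier (fun z => be z * Num.conj (g z)) (j + l)%N%:Z) + e,
   forall l, (0 < l)%N -> x l <= \sum_(j < (2 * N).+2 | (n <= j)%N) y j *
      normc (fourier (fun z => be z * Num.conj (g z)) (l + j)%N%:Z) + e
   & expR (- S) * normc (F n%:Z) <= y n].
Proof.
move=> e0; have [d0 hd] := small_eps e0; set d := e / (4 * Bg + 1) in d0 hd.
have [K hK] := conv d0; exists K => N KN n nN.
have [iA iB nA nB] := hK N KN.
pose gc z := Num.conj (g z).
have mgc : measurable_T gc by exact: measurable_T_conj.
have gcB t : normc (gc (circ t)) <= Bg by rewrite normc_conj.
have igc : integrable_T gc by exact: integrable_T_bounded mgc gcB.
have gc0 k : 0 < k -> fourier gc k = 0.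
  by move=> k0; rewrite fourier_conj// g0 ?oppr_lt0// conjC0.
set r := fun z => be z * Num.conj (g z).
have ir : integrable_T r.
  by apply: integrable_T_ext (integrable_TM mgc gcB ibe) => t; rewrite mulrC.
pose m := (N + n)%N.
have mN : (m <= (2 * N).+1)%N by rewrite /m; clear - nN; lia.
have [pa' [pb' [h' _ _]]] := nlft_range_left F N m.
have [pa [pb [h hlead]]] := nlft_range_right F mN.
have hi'E : m%:Z - N%:Z - 1 = n%:Z - 1 by rewrite /m; clear; lia.
have loE : m%:Z - N%:Z = n%:Z by rewrite /m; clear; lia.
rewrite hi'E in h'; rewrite loE in h hlead.
have entries := nlft_trunc_entries mN h' h.
have u1 t := su2_le1 t h.
have sa := su2_suppa h; have sb := su2_suppb h.
have sa' := su2_suppa h'; have sb' := su2_suppb h'.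
have cb0 i : i < n%:Z -> tp_coef pb i = 0.
  by move=> hi; apply: (tp_coef_supp sb); rewrite negb_and -!ltNge hi.
have N1 : -1 != 0 :> int by [].
have err t : let d1 := nlft_trunc F N (circ t) 0 0 - Num.conj (al (circ t)) in
    let d2 := nlft_trunc F N (circ t) 0 1 - be (circ t) in
    let G := gc (circ t) in
    normc (tp_eval pb' (circ t) * G - (tp_eval pa (circ t) * (be (circ t) * G)
      - tp_eval pb (circ t))) <= Bg * (normc d1 + normc d2) /\
    normc (tp_eval pa' (circ t) * G - (Num.conj (tp_eval pb (circ t)) *
      (be (circ t) * G) + Num.conj (tp_eval pa (circ t)))) <= Bg * (normc d1 + normc d2).
  have [ua ub] := u1 t; have [eA eB] := entries t.
  apply: (splitting_err _ _ _ (su2_conj t h) _ (gcB t)); rewrite ?normc_conj//.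
  - by rewrite eA; ring.
  - by rewrite eB; ring.
  - by rewrite -rmorphM gal rmorph1.
exists (fun l => normc (tp_coef pa (- l%:Z))), (fun j => normc (tp_coef pb j%:Z)).
split.
- by move=> l; apply: coef_le2 => t; have [] := u1 t.
- by move=> j; exact: normc_ge0.
- move=> j nj.
  pose lhs z := tp_eval pb' z * gc z.
  have l0 : fourier lhs j%:Z = 0.
    by apply: (fourier_tp_vanish igc sb') => k /andP[k1 k2]; apply: gc0; clear - nj k2; lia.
  have := @coef_estimate R Bg d lhs r (dA N) (dB N) pa (tp_scale (-1) pb) j%:Z
    Bg0 (tp_integrableM _ igc) ir iA iB l0 _ nA nB.
  rewrite tp_coef_scale mulN1r normc_opp => est.
  apply: (le_trans (est _)).
    by move=> t; rewrite tp_eval_scale mulN1r; have [] := err t.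
  rewrite lerD//.
  apply: (le_trans (@normc_fourier_tp R (-1) _ _ _ (2 * N).+2 N1 ir _)).
    apply: tp_suppS sa => k /andP[k1 k2]; apply/existsP.
    have kl : (`|k| < (2 * N).+2)%N by (clear - k1 k2; lia).
    by exists (Ordinal kl); rewrite /= mulN1r; apply/eqP; clear - k2; lia.
  apply: ler_sum => l _; rewrite mulN1r opprK.
  by rewrite (_ : j%:Z + (l : nat)%:Z = (j + l)%N%:Z)//; clear; lia.
- move=> l l0'.
  pose lhs z := tp_eval pa' z * gc z.
  have l0 : fourier lhs l%:Z = 0.
    by apply: (fourier_tp_vanish igc sa') => k /andP[k1 k2]; apply: gc0; clear - k2 l0'; lia.
  have := @coef_estimate R Bg d lhs r (dA N) (dB N) (tp_conj pb) (tp_conj pa) l%:Z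
    Bg0 (tp_integrableM _ igc) ir iA iB l0 _ nA nB.
  rewrite tp_coef_conj normc_conj => est; apply: (le_trans (est _)).
    by move=> t; rewrite !tp_eval_conj; have [] := err t.
  rewrite lerD//.
  apply: (le_trans (@normc_fourier_tp R (-1) _ _ _ (2 * N).+2 N1 ir _)).
    apply: tp_supp_conj sb => k /andP[k1 k2]; apply/existsP.
    have kl : (`|k| < (2 * N).+2)%N by (clear - k1 k2; lia).
    by exists (Ordinal kl); rewrite /= mulN1r; apply/eqP; clear - k1; lia.
  rewrite [leRHS]big_mkcond; apply: ler_sum => j _; rewrite mulN1r tp_coef_conj normc_conj !opprK.
  case: ifPn => nj.
    by rewrite (_ : l%:Z + (j : nat)%:Z = (l + j)%N%:Z)//; clear; lia.
  by rewrite cb0 ?Normc.normc0 ?mul0r//; clear - nj; lia.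
- rewrite hlead; last by rewrite /m; clear - nN; lia.
  rewrite Normc.normcM mulrC ler_wpM2l ?normc_ge0//.
  have /andP[k1 k2] := @nlft_const_bounds R F N m (2 * N).+1 S (leqnn _) hS.
  by rewrite normc_RtoC ger0_norm// (le_trans (expR_ge0 _) k1).
Qed.

End Systems.

(** * Sums over the integers from sums over two half-lines *)

Section IntegerSums.
Variable R : realType.
Implicit Types (a : int -> R).

Lemma sum_zrange (V : nmodType) (f : int -> V) K :
  \sum_(n <- zrange K) f n =
  \sum_(0 <= k < K.+1) f k%:Z + \sum_(0 <= k < K) f (- k.+1%:Z).
Proof.
rewrite /zrange big_map -[iota 0 _]/(index_iota 0 (2 * K).+1).
rewrite (@big_cat_nat _ _ _ K)//=; last by lia.
rewrite addrC; congr (_ + _).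
  rewrite -{1}[K]add0n big_addn (_ : (2 * K).+1 - K = K.+1)%N; last by lia.
  by apply: eq_bigr => k _; congr f; lia.
rewrite big_nat_rev /= big_nat [RHS]big_nat; apply: eq_bigr => k kK; congr f; lia.
Qed.

Lemma sum_uniq_le (a : int -> R) (s s' : seq int) : (forall n, 0 <= a n) ->
  uniq s -> uniq s' -> {subset s <= s'} -> \sum_(n <- s) a n <= \sum_(n <- s') a n.
Proof.
move=> a0 us us' ss.
rewrite [leRHS](bigID (fun n => n \in s)) /= -[leLHS]addr0.
apply: lerD; last exact: sumr_ge0.
rewrite -[leRHS]big_filter le_eqVlt; apply/orP; left; apply/eqP/perm_big.
apply: uniq_perm => //; first exact: filter_uniq.
by move=> n; rewrite mem_filter andb_idr//; exact: ss.
Qed.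

(** The finitely many terms skipped on each half-line only enlarge the constants, and every finite
    set of indices lies in some symmetric range. *)
Lemma bounded_two_sided a n1 n2 (C1 C2 : R) : (forall n, 0 <= a n) ->
  (forall K, \sum_(n1 <= k < K) a k%:Z <= C1) ->
  (forall K, \sum_(n2 <= k < K) a (- k%:Z) <= C2) ->
  exists M, forall s : seq int, uniq s -> \sum_(n <- s) a n <= M.
Proof.
move=> a0 h1 h2.
have ext (b : nat -> R) n C : (forall k, 0 <= b k) -> (forall K, \sum_(n <= k < K) b k <= C) ->
    forall K, \sum_(0 <= k < K) b k <= C + \sum_(0 <= k < n) b k.
  move=> b0 h K; have C0 : 0 <= C by rewrite (le_trans _ (h n))// big_geq.
  have [nK|Kn] := leqP n K.
    by rewrite (@big_cat_nat _ _ _ n)//= addrC lerD2r.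
  rewrite (@big_cat_nat _ _ _ K 0 n)//=; last exact: ltnW.
  by rewrite addrCA lerDl addr_ge0// sumr_ge0.
have e1 := ext _ n1 C1 (fun k => a0 k%:Z) h1.
have e2 := ext _ n2 C2 (fun k => a0 (- k%:Z)) h2.
exists ((C1 + \sum_(0 <= k < n1) a k%:Z) + (C2 + \sum_(0 <= k < n2) a (- k%:Z))) => s us.
pose K := (\max_(n <- s) `|n|)%N.
apply: (@le_trans _ _ (\sum_(n <- zrange K) a n)).
  apply: sum_uniq_le => //; first exact: zrange_uniq.
  by move=> n ns; rewrite mem_zrange /K (big_rem n ns) /= leq_maxl.
rewrite sum_zrange lerD//.
apply: le_trans (e2 K.+1).
by rewrite [leRHS]big_nat_recl// lerDr.
Qed.

Lemma small_tail_nat a (sg : int) : sg = 1 \/ sg = -1 -> (forall n, 0 <= a n) ->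
  (\esum_(n in [set: int]) (a n)%:E < +oo)%E ->
  exists n0, forall K, \sum_(n0 <= k < K) a (sg * k%:Z) <= 2^-1.
Proof.
move=> hsg a0 afin.
have h2 : 0 < 2^-1 :> R by rewrite invr_gt0.
have [K0 hK0] := esum_finite_tail afin a0 h2.
exists K0.+1 => K; rewrite -(big_map (fun k : nat => sg * k%:Z) xpredT a).
apply: hK0; first by rewrite map_inj_uniq ?iota_uniq// => i j; case: hsg => ->; lia.
by move=> n /mapP[k]; rewrite mem_index_iota => /andP[k1 _] ->; case: hsg => ->; lia.
Qed.

End IntegerSums.

(** * Weighted summability of F from both systems *)

Section NlftTails.
Variables (R : realType) (w : int -> R) (F : int -> R[i]).
Hypothesis w1 : forall n, 1 <= w n.
Hypothesis wN : forall n, w (- n) = w n.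
Hypothesis wM : forall n m, w (n + m) <= w n * w m.
Hypothesis F2 : ell2 F.
Variables (al be g : R[i] -> R[i]) (Bg : R).
Hypothesis ibe : integrable_T be.
Hypothesis mg : measurable_T g.
Hypothesis gB : forall t, normc (g (circ t)) <= Bg.
Hypothesis gal : forall t, g (circ t) * al (circ t) = 1.
Hypothesis g0 : forall n, n < 0 -> fourier g n = 0.
Hypothesis conv : forall e, 0 < e -> exists K : nat, forall N, (K <= N)%N ->
  [/\ integrable_T (fun z => nlft_trunc F N z 0 0 - Num.conj (al z)),
      integrable_T (fun z => nlft_trunc F N z 0 1 - be z),
      norm1_T (fun z => nlft_trunc F N z 0 0 - Num.conj (al z)) <= e &
      norm1_T (fun z => nlft_trunc F N z 0 1 - be z) <= e].
Hypothesis c1 : ell1 w (fourier (fun z => be z * g z)).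
Hypothesis c2 : ell1 w (fourier (fun z => be z * Num.conj (g z))).

Lemma nlft_coefficients_ell1 : ell1 w F.
Proof.
have w0 n : 0 <= w n by exact: le_trans (w1 n).
have nw0 (f : int -> R[i]) n : 0 <= normc (f n) * w n by rewrite mulr_ge0 ?normc_ge0.
have [S S0 [hS _]] := esum_finite_bound F2 (fun n => sqr_ge0 (normc (F n))).
have kap0 := expR_gt0 (- S).
pose om (k : nat) := w k%:Z.
have omD (j l : nat) : om j <= om (j + l)%N * om l.
  (* Submultiplicativity for j = (j + l) + (-l), after evenness has replaced w(l) by w(-l). *)
  rewrite /om -(wN l%:Z); apply: le_trans (wM _ _).
  by rewrite (_ : (j + l)%N%:Z - l%:Z = j%:Z)//; lia.
have omN (k : nat) : w (- k%:Z) = om k by exact: wN.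
have [n1 [C1 h1]] : exists n0 C, forall K, \sum_(n0 <= k < K) normc (F (k%:Z)) * om k <= C.
  apply: (tail_bound kap0 (fun n => normc_ge0 (F n%:Z))
    (D := fun k => normc (fourier (fun z => be z * Num.conj (g z)) k%:Z))) => //.
  - by move=> k; exact: normc_ge0.
  - by move=> k; exact: w1.
  - have [n0 hn0] := small_tail_nat (or_introl erefl) (nw0 _) c2.
    exists n0 => K; apply: le_trans (hn0 K); rewrite le_eqVlt; apply/orP; left; apply/eqP.
    by apply: eq_bigr => k _; rewrite mul1r.
  - by move=> e e0; exact: (right_system hS ibe mg gB gal g0 conv e0).
have [n2 [C2 h2]] : exists n0 C, forall K, \sum_(n0 <= k < K) normc (F (- k%:Z)) * om k <= C.
  apply: (tail_bound kap0 (fun n => normc_ge0 (F (- n%:Z)))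
    (D := fun k => normc (fourier (fun z => be z * g z) (- k%:Z)))) => //.
  - by move=> k; exact: normc_ge0.
  - by move=> k; exact: w1.
  - have [n0 hn0] := small_tail_nat (or_intror erefl) (nw0 _) c1.
    exists n0 => K; apply: le_trans (hn0 K); rewrite le_eqVlt; apply/orP; left; apply/eqP.
    by apply: eq_bigr => k _; rewrite mulN1r wN.
  - by move=> e e0; exact: (left_system hS ibe mg gB gal g0 conv e0).
have h2' K : \sum_(n2 <= k < K) normc (F (- k%:Z)) * w (- k%:Z) <= C2.
  by apply: le_trans (h2 K); under eq_bigr do rewrite wN.
have [M hM] := bounded_two_sided (nw0 F) h1 h2'.
exact: esum_finite_ub (nw0 F) hM.
Qed.

End NlftTails.

(** * The analytic completion of a real function on the circle *)

Section OuterFunction.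
Variables (R : realType) (w : int -> R).
Hypothesis w1 : forall n, 1 <= w n.
Hypothesis wN : forall n, w (- n) = w n.
Implicit Types (v : R[i] -> R).

Let w0 n : 0 <= w n. Proof. exact: le_trans (w1 n). Qed.

Lemma ell1_le (x y : int -> R[i]) (c : R) : 0 <= c ->
  (forall n, normc (x n) <= c * normc (y n)) -> ell1 w y -> ell1 w x.
Proof.
move=> c0 xy hy; have y0 n : 0 <= normc (y n) * w n by rewrite mulr_ge0 ?normc_ge0.
have [M M0 [hM _]] := esum_finite_bound hy y0.
apply: (@esum_finite_ub _ _ (c * M)) => [n|s us]; first by rewrite mulr_ge0 ?normc_ge0.
apply: (@le_trans _ _ (\sum_(n <- s) c * (normc (y n) * w n))).
  by apply: ler_sum => n _; rewrite mulrA ler_wpM2r.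
by rewrite -mulr_sumr ler_wpM2l// hM.
Qed.

Lemma ell1_opp (x y : int -> R[i]) : (forall n, normc (x n) = normc (y (- n))) ->
  ell1 w y -> ell1 w x.
Proof.
move=> xy hy; have y0 n : 0 <= normc (y n) * w n by rewrite mulr_ge0 ?normc_ge0.
have [M M0 [hM _]] := esum_finite_bound hy y0.
apply: (@esum_finite_ub _ _ M) => [n|s us]; first by rewrite mulr_ge0 ?normc_ge0.
apply: (@le_trans _ _ (\sum_(n <- map -%R s) normc (y n) * w n)).
  by rewrite big_map; apply: ler_sum => n _; rewrite xy wN.
by apply: hM; rewrite map_inj_uniq//; exact: oppr_inj.
Qed.

(** Taylor coefficients of the Herglotz integral of v; on the circle their series represents v plus
    i times its conjugate function. *)
Definition herglotz_coef v (n : int) : R[i] :=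
  let c := fourier (fun z => (v z)%:C) in
  if n == 0 then c 0 else if 0 < n then 2 * c n else 0.

Lemma normc2 : normc (2 : R[i]) = 2.
Proof. by rewrite (_ : 2 = (2 : R)%:C) ?normc_RtoC ?ger0_norm// rmorph_nat. Qed.

Lemma herglotz_coef_ell1 v : ell1 w (fourier (fun z => (v z)%:C)) ->
  ell1 w (herglotz_coef v).
Proof.
apply: (@ell1_le _ _ 2) => // n; rewrite /herglotz_coef.
case: eqP => [->|_]; first by rewrite ler_peMl ?normc_ge0// ler1n.
case: ifP => _; first by rewrite Normc.normcM normc2.
by rewrite Normc.normc0 mulr_ge0 ?normc_ge0.
Qed.

Definition herglotz_partial v K (z : R[i]) :=
  fourier (fun y => (v y)%:C) 0 +
  2 * \sum_(k < K) z ^+ k.+1 * fourier (fun y => (v y)%:C) k.+1%:Z.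

Lemma herglotz_partialE v K (z : R[i]) :
  tp_eval (partial_series (herglotz_coef v) K) z = herglotz_partial v K z.
Proof.
rewrite partial_seriesE sum_zrange [X in _ + X]big1 ?addr0; last first.
  by move=> k _; rewrite /herglotz_coef /= mul0r.
rewrite big_nat_recl//= /herglotz_partial /herglotz_coef eqxx expr0z mulr1; congr (_ + _).
rewrite mulr_sumr big_mkord; apply: eq_bigr => k _ /=.
by rewrite mulrAC -mulrA.
Qed.

(** An Abel summation. Comparing the integral with its Taylor polynomial costs a factor 1/(1 - r),
    so the degree M used there depends on r. Summability of the coefficients then leads back,
    uniformly in the closed disc, to a degree L chosen beforehand, and the polynomial of degree L is
    Lipschitz there with constant [B]. *)
Lemma herglotz_radial v : integrable_T (fun z => (v z)%:C) ->
  ell1 w (fourier (fun z => (v z)%:C)) ->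
  forall t e, 0 < e -> exists K : nat, forall k, (K <= k)%N ->
    normc (herglotz (fun z => (v z)%:C) ((radius R k)%:C * circ t) -
           fseries (herglotz_coef v) (circ t)) <= e.
Proof.
move=> iv hv t e e0; have hd := herglotz_coef_ell1 hv.
have e4 : 0 < e / 4 by rewrite divr_gt0.
have [L1 hL1] := fseries_cvg w1 hd e4.
have [L2 hL2] := tail_list_small w1 hd e4.
pose L := maxn L1 L2.
pose c (k : nat) := normc (fourier (fun z => (v z)%:C) k%:Z).
pose B := \sum_(k < L) 2 * k.+1%:R * c k.+1.
have B0 : 0 <= B by apply: sumr_ge0 => k _; rewrite !mulr_ge0 ?normc_ge0.
have B1 : 0 < B + 1 by rewrite ltr_wpDl.
have rad : 1 - e / 4 / (B + 1) < 1 by rewrite ltrBlDr ltrDl divr_gt0.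
have [K hK] := radius_near rad; exists K => k /hK hr.
set r := radius R k in hr *; have r01 : 0 <= r < 1 by exact: radius01.
move: (r01) => /andP[r0 r1].
set u := circ t; set z := r%:C * u.
have zr : normc z = r by rewrite normc_rcirc.
have z1 : normc z < 1 by rewrite zr.
have tail M : (L <= M)%N -> normc (herglotz_partial v M z - herglotz_partial v L z) <= e / 4.
  move=> LM; rewrite -!herglotz_partialE partial_series_diff//.
  apply: le_trans (hL2 L M (leq_maxr _ _)).
  rewrite /tp_eval /tp_norm (le_trans (normc_sum _ _ _))//.
  rewrite /tail_list !big_map big_filter [leRHS]big_filter.
  apply: ler_sum => -[n|n] _; rewrite [(_, _).1]/= [(_, _).2]/=; last first.
    have -> : herglotz_coef v (Negz n) = 0 by [].
    by rewrite mul0r Normc.normc0 mul0r.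
  rewrite Normc.normcM ler_wpM2l ?normc_ge0// (le_trans _ (w1 n))//.
  by rewrite -exprnP normc_exp zr exprn_ile1// ltW.
have h1 : normc (herglotz (fun y => (v y)%:C) z - herglotz_partial v L z) <= e / 4 + e / 4.
  have [M [LM hM]] : exists M, (L <= M)%N /\
      2 * (2 * normc z ^+ M.+1 / (1 - normc z) * norm1_T (fun y => (v y)%:C)) <= e / 4.
    rewrite zr; set Nv := norm1_T _; have Nv0 : 0 <= Nv by exact: norm1_T_ge0.
    pose q := 4 / (1 - r) * Nv + 1.
    have p0 : 0 <= 4 / (1 - r) * Nv by rewrite mulr_ge0// divr_ge0// subr_ge0 ltW.
    have q0 : 0 < q by rewrite ltr_wpDl.
    have d0 : 0 < e / 4 / q by rewrite divr_gt0.
    have : r ^+ n @[n --> \oo] --> (0 : R) by apply: cvg_expr; rewrite ger0_norm.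
    move/cvgrPdist_le => /(_ _ d0)[M0 _ hM0]; exists (maxn L M0).
    split; first exact: leq_maxl.
    have := hM0 (maxn L M0).+1; rewrite /= sub0r normrN ger0_norm ?exprn_ge0// => hh.
    have {}hh := hh (leqW (leq_maxr _ _)).
    rewrite (_ : 2 * _ = 4 / (1 - r) * Nv * r ^+ (maxn L M0).+1); last by ring.
    apply: (le_trans (ler_wpM2l p0 hh)).
    rewrite mulrA ler_pdivrMr// mulrC ler_pM2l// lerDl ler01//.
  rewrite (le_trans (normc_tri _ _ (herglotz_partial v M z)))// lerD//; last exact: tail.
  exact: le_trans (herglotz_series M z1 iv) hM.
have h2 : normc (herglotz_partial v L z - herglotz_partial v L u) <= e / 4.
  have zu : normc (z - u) = 1 - r.
    rewrite /z -{2}[u]mul1r -mulrBl Normc.normcM normc_circ mulr1.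
    by rewrite -(rmorph1 (real_complex R)) -rmorphB normc_RtoC ler0_norm ?opprB// subr_le0 ltW.
  rewrite /herglotz_partial opprD addrACA subrr add0r -mulrBr -sumrB Normc.normcM normc2.
  apply: (@le_trans _ _ (B * (1 - r))).
    rewrite /B mulr_suml.
    apply: (@le_trans _ _ (2 * \sum_(k0 < L) k0.+1%:R * (1 - r) * c k0.+1)).
      rewrite ler_wpM2l// (le_trans (normc_sum _ _ _))//; apply: ler_sum => i _.
      rewrite -mulrBl Normc.normcM ler_wpM2r ?normc_ge0//.
      have := @normc_subXX R z u 1 i.+1 ler01; rewrite zu expr1n mulr1; apply.
        by rewrite ltW.
      by rewrite normc_circ.
    rewrite mulr_sumr; apply: ler_sum => i _.
    by rewrite le_eqVlt; apply/orP; left; apply/eqP; ring.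
  apply: (@le_trans _ _ (B * (e / 4 / (B + 1)))).
    by rewrite ler_wpM2l//; move: hr; lra.
  by rewrite mulrA ler_pdivrMr// mulrC ler_pM2l// lerDl ler01.
have h3 : normc (herglotz_partial v L u - fseries (herglotz_coef v) u) <= e / 4.
  by rewrite -herglotz_partialE; apply: hL1; exact: leq_maxl.
apply: (le_trans (normc_tri _ _ (herglotz_partial v L z))).
apply: (@le_trans _ _ (e / 4 + e / 4 + (e / 4 + e / 4))); last by lra.
apply: lerD h1 _.
by rewrite (le_trans (normc_tri _ _ (herglotz_partial v L u)))// lerD.
Qed.

End OuterFunction.

(** * The theorem *)

Section MainTheorem.
Variables (R : realType) (w : int -> R) (F : int -> R[i]) (a b : R[i] -> R[i]).
Hypothesis w_beurling : strong_beurling_weight w.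
Hypothesis F2 : ell2 F.
Hypothesis ab : is_nlft F a b.

Let w1 n : 1 <= w n. Proof. by have [] := w_beurling. Qed.
Let wN n : w (- n) = w n. Proof. by have [] := w_beurling. Qed.
Let wM n m : w (n + m) <= w n * w m. Proof. by have [] := w_beurling. Qed.
Let wlog_lim : ln (w n%:Z) / n%:R @[n --> \oo] --> (0 : R).
Proof. by have [] := w_beurling. Qed.

Lemma integrable_T_star f : integrable_T f -> integrable_T (star f : R[i] -> R[i]).
Proof.
move=> hf; apply: integrable_T_le (integrable_T_normc hf).
  by apply: measurable_T_star; exact: integrable_T_measurable.
by move=> t _; rewrite star_circ normc_conj.
Qed.

Lemma nlft_in_beurling : ell1 w F -> beurling_algebra w (star a) /\ beurling_algebra w b.
Proof.
move=> hF; have [ia ib] := nlft_integrable ab.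
have [fa fb] := nlft_wiener ab w1 wN wM hF.
split; split=> //; first exact: integrable_T_star.
apply: (ell1_opp w1 wN _ fa) => n.
rewrite (@fourier_ext _ _ (fun z => Num.conj (a z))); last by move=> t; rewrite star_circ.
by rewrite fourier_conj// normc_conj.
Qed.

Lemma cexp_near (x y : R[i]) (d : R) : normc (x - y) <= d -> d <= 2^-1 ->
  normc (cexp x - cexp y) <= expR (complex.Re y) * (6 * d).
Proof.
move=> xy d2; have d0 : 0 <= d by exact: le_trans (normc_ge0 _) xy.
have -> : cexp x - cexp y = cexp y * ((cexp (x - y) - 1 - (x - y)) + (x - y)).
  by rewrite subrK mulrBr mulr1 -cexpD [y + _]addrC subrK.
rewrite Normc.normcM normc_cexp ler_wpM2l ?expR_ge0//.
rewrite (le_trans (normc_addr _ _))//.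
have h1 := cexp_taylor (le_trans xy d2).
apply: (le_trans (lerD h1 xy)).
have x0 := normc_ge0 (x - y).
have : normc (x - y) ^+ 2 <= d * 2^-1.
  by rewrite expr2 ler_pM// (le_trans xy).
lra.
Qed.

Lemma nlft_inverse : outer_on_disc (star a) ->
  beurling_algebra w (fun z => b z / star a z) -> ell1 w F.
Proof.
move=> [G [_ hG [c0 [phi [c01 phi0 ilnphi GE]]]]] [iq hq].
set q := fun z => b z / star a z in iq hq.
pose v z := ln (phi z).
have hmod := outer_modulus c01 ilnphi GE hG.
have [ia ib] := nlft_integrable ab.
(* The version of b/a^* given by its Fourier series: it has the same coefficients as q, hence agrees
   with it almost everywhere. *)
pose s := fseries (fourier q).
have [Ms hs] : exists M, wiener w xpredT M s by exact: (wiener_fseries w1 hq).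
have is_ : integrable_T s by exact: (integrable_wiener w1 hs).
have qs : ae01 (fun t => q (circ t) = s (circ t)).
  have := @fourier_unique R (fun z => q z - s z) (integrable_TB iq is_).
  move=> h; apply: ae01_mono (h _) => [t _ /eqP|n].
    by rewrite subr_eq0 => /eqP.
  by rewrite fourierB// (fourier_fseries w1 hq) subrr.
have sap : tp_approx w s 
  by move=> e e0; have [K hK] := wiener_fseries_tail w1 hq e0; exists (partial_series (fourier q) K).
have [Ml hl] := wiener_ln_1Dsqr w1 wN wM wlog_lim sap.
have il := integrable_wiener w1 hl.
(* By [outer_modulus], v = ln phi is ln |a| almost everywhere; this identity transfers weighted
   summability from [s] to v. *)
have lnv : ae01 (fun t => (ln (1 + normc (s (circ t)) ^+ 2))%:C = (-2)%:C * (v (circ t))%:C :> R[i]).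
  apply: ae01_mono (ae01_and (ae01_and hmod qs) (nlft_unitary ab)) => t _ [[h1 h2] h3].
  rewrite star_circ normc_conj in h1.
  rewrite -rmorphM; congr (_%:C); rewrite -h2 /q star_circ Normc.normcM Normc.normcV normc_conj.
  rewrite h1 in h3 *; set E := expR _ in h3 *; have E0 : 0 < E by exact: expR_gt0.
  have -> : 1 + (normc (b (circ t)) / E) ^+ 2 = E ^- 2.
    have eb : normc (b (circ t)) ^+ 2 = 1 - E ^+ 2 by rewrite -h3; ring.
    by rewrite exprMn eb; field; rewrite gt_eqF.
  by rewrite lnV ?posrE ?exprn_gt0// lnXn// expRK mulNr mulr_natl.
have hv : ell1 w (fourier (fun z => (v z)%:C)).
  apply: (@ell1_le _ _ w1 _ (fourier (fun z => (ln (1 + normc (s z) ^+ 2))%:C)) 2^-1).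
  - by [].
  - move=> n.
    have -> : fourier (fun z => (ln (1 + normc (s z) ^+ 2))%:C) n =
        fourier (fun z => (-2)%:C * (v z)%:C) n.
      apply: fourier_ae_eq lnv; first exact: integrable_T_measurable.
      exact: (integrable_T_measurable (integrable_TZ _ ilnphi)).
    rewrite fourierZ// Normc.normcM normc_RtoC normrN ger0_norm// mulrA mulVf// mul1r//.
  - exact: (wiener_ell1 w1 hl).
pose h := fseries (herglotz_coef v).
have hd := herglotz_coef_ell1 w1 hv.
have [Mh hh] : exists M, wiener w (fun n => 0 <= n) M h.
  apply: (wiener_fseries w1 hd) => n; rewrite -ltNge /herglotz_coef => n0.
  by rewrite lt_eqF// ltNge ltW.
have Qadd (n m : int) : 0 <= n -> 0 <= m -> 0 <= n + m by exact: addr_ge0.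
pose al z := c0 * cexp (h z).
pose g z := c0^-1 * cexp (- h z).
have c0n : c0 != 0.
  by apply: contra_eq_neq c01 => ->; rewrite Normc.normc0 eq_sym oner_neq0.
have wal : exists M, wiener w (fun n => 0 <= n) M al.
  by eexists; apply: wienerZ; exact: (wiener_cexp w1 wM (lexx 0) Qadd hh).
have wg : exists M, wiener w (fun n => 0 <= n) M g.
  eexists; apply: wienerZ; apply: (wiener_cexp w1 wM (lexx 0) Qadd).
  by apply: wiener_ext (wienerZ (-1) hh) => t; rewrite mulN1r.
have [Mal {}wal] := wal; have [Mg {}wg] := wg.
have gal t : g (circ t) * al (circ t) = 1.
  by rewrite /g /al mulrACA mulVf// mul1r -cexpD addNr cexp0.
(* The radial limits of G are computed twice: they are a^* by hypothesis, and c0 exp h by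
   [herglotz_radial]. *)
have a_al : ae01 (fun t => star a (circ t) = al (circ t)).
  apply: ae01_mono hG => t It /radial_cvg hrad.
  apply/eqP; rewrite -subr_eq0; apply/eqP/Normc.eq0_normc/le_anti/andP; split; last exact: normc_ge0.
  apply/ler_addgt0Pr => e e0; rewrite add0r.
  have e2 : 0 < e / 2 by rewrite divr_gt0.
  have [K1 h1] := hrad _ e2.
  pose E := expR (complex.Re (h (circ t))); have E0 : 0 < E by exact: expR_gt0.
  (* [cexp_near] asks for d <= 1/2 and multiplies the error by 6 exp(Re h), written [E * 6]. *)
  pose d := Num.min (2^-1) (e / 2 / (E * 6)).
  have d0 : 0 < d by rewrite lt_min invr_gt0 ltr0n divr_gt0// mulr_gt0.
  have [K2 h2] := herglotz_radial w1 ilnphi hv t d0.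
  have {}h1 := h1 _ (leq_maxl K1 K2); have {}h2 := h2 _ (leq_maxr K1 K2).
  set r := radius R (maxn K1 K2) in h1 h2.
  have /andP[r0 r1] : 0 <= r < 1 by exact: radius01.
  rewrite (le_trans (normc_tri _ _ (G (r%:C * circ t))))// [leRHS]splitr normc_distC lerD//.
  rewrite GE ?normc_rcirc// /al -mulrBr Normc.normcM c01 mul1r.
  have dh : d <= 2^-1 by rewrite ge_min lexx.
  apply: (le_trans (cexp_near h2 dh)); rewrite -/E.
  have : d <= e / 2 / (E * 6) by rewrite ge_min lexx orbT.
  by rewrite ler_pdivlMr ?mulr_gt0// mulrC -mulrA.
(* b is recovered as the product of b/a^* and a^*, now in a version that lies in A_w. *)
pose be z := s z * al z.
have wal' : wiener w xpredT Mal al by apply: wienerS wal.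
have wg' : wiener w xpredT Mg g by apply: wienerS wg.
have addT (n m : int) : xpredT n -> xpredT m -> xpredT (n + m) by [].
have wbe := wienerM w1 wM addT hs wal'.
have aal : ae01 (fun t => a (circ t) = Num.conj (al (circ t))).
  by apply: ae01_mono a_al => t _ <-; rewrite star_circ conjCK.
have bbe : ae01 (fun t => b (circ t) = be (circ t)).
  apply: ae01_mono (ae01_and a_al qs) => t _ [h1 h2].
  rewrite /be -h2 /q h1 divfK//; apply: contra_eq_neq (gal t) => ->.
  by rewrite mulr0 eq_sym oner_neq0.
have mal : measurable_T al by exact: (measurable_wiener wal).
have mbe : measurable_T be by exact: (measurable_wiener wbe).
have ibe : integrable_T be by exact: (integrable_wiener w1 wbe).
have ial : integrable_T al by exact: (integrable_wiener w1 wal).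
have ialc : integrable_T (fun z => Num.conj (al z)).
  by exact: (integrable_wiener w1 (wiener_conj wN wal')).
have [ma mb _ _] := ab.
apply: (@nlft_coefficients_ell1 R w F w1 wN wM F2 al be g Mg) => //.
- exact: (measurable_wiener wg).
- by move=> t; exact: (wiener_bounded w1 t wg).
- by move=> n n0; apply: (wiener_fourier0 w1 wg); rewrite -ltNge.
- move=> e e0; have [K hK] := nlft_approx ab e0; exists K => N /hK[x1 x2 x3 x4].
  have [mA mB] := nlft_trunc_measurable F N.
  have [pa [pb [e1 e2 _ _]]] := nlft_poly F N.
  have iA : integrable_T (fun z => nlft_trunc F N z 0 0).
    by apply: integrable_T_ext (integrable_tp_eval pa) => t; rewrite e1.
  have iB : integrable_T (fun z => nlft_trunc F N z 0 1).
    by apply: integrable_T_ext (integrable_tp_eval pb) => t; rewrite e2.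
  split.
  + exact: integrable_TB.
  + exact: integrable_TB.
  + apply: le_trans x3; rewrite le_eqVlt; apply/orP; left; apply/eqP.
    apply: norm1_T_ae_eq; first exact: (integrable_T_measurable (integrable_TB iA ialc)).
      by apply: measurable_TB.
    by apply: ae01_mono aal => t _ ->.
  + apply: le_trans x4; rewrite le_eqVlt; apply/orP; left; apply/eqP.
    apply: norm1_T_ae_eq; first exact: (integrable_T_measurable (integrable_TB iB ibe)).
      by apply: measurable_TB.
    by apply: ae01_mono bbe => t _ ->.
- have hcs : wiener w xpredT Ms (fun z => be z * g z).
    by apply: wiener_ext hs => t; rewrite /be -mulrA [al _ * _]mulrC gal mulr1.
  exact: (wiener_ell1 w1 hcs).
(* The quotient b/a, which governs the positive indices, has no hypothesis of its own: it is in A_w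
   as the product of [be] with the conjugate of [g]. *)
- exact: (wiener_ell1 w1 (wienerM w1 wM addT wbe (wiener_conj wN wg'))).
Qed.

End MainTheorem.

Theorem theorem1 (R : realType) (w : int -> R) (F : int -> R[i])
    (a b : R[i] -> R[i])
    (w_beurling : strong_beurling_weight w)
    (F_ell2 : ell2 F)
    (ab_nlft : is_nlft F a b) :
  (ell1 w F -> beurling_algebra w (star a) /\ beurling_algebra w b) /\
  (outer_on_disc (star a) ->
   beurling_algebra w (fun z => b z / star a z) ->
   ell1 w F).
Proof.
split; first exact: nlft_in_beurling.
exact: nlft_inverse.
Qed.
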